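(* Let $\mathcal{I}$ be a finite inverse category equipped with a wide subcategory of weak equivalences containing the isomorphisms and closed under 2-out-of-3. Let $\mathcal{C}$ be a finitely complete category equipped with a wide subcategory of fibrations and a wide subcategory of weak equivalences. Assume: fibrations are stable under pullback; fibrations are stable under pushforward along fibrations; weak equivalences in $\mathcal{C}$ contain the isomorphisms and are closed under 2-out-of-3; and both pullbacks and pushforwards in $\mathcal{C}$ are homotopically logically behaved. Suppose that for each $i \in \mathcal{I}$ and each non-identity weak equivalence $w \colon i \to j$ in $\mathcal{I}$ with domain $i$, either all maps in $\mathcal{I}$ with domain $i$ are weak equivalences, or $w$ is an initial object of $\partial(i/\mathcal{I})$. Then pushforwards of homotopical Reedy fibrations along homotopical Reedy fibrations are again homotopical Reedy fibrations. That is, if $A, B, C \in \mathcal{C}^{\mathcal{I}}$ are homotopical diagrams and $p \colon B \to A$ and $k \colon C \to B$ are Reedy fibrations, then the pushforward $p_*k \colon p_*C \to A$ of $k$ along $p$ in $\mathcal{C}^{\mathcal{I}}$ exists, is a Reedy fibration, and $p_*C$ is a homotopical diagram.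
   Context: **Inverse categories.** An inverse category is a category $\mathcal{I}$ admitting a degree function $\deg \colon \mathrm{ob}\,\mathcal{I} \to \mathbb{N}$ such that $\deg i > \deg j$ for every non-identity map $i \to j$. It is finite if it has finitely many objects and morphisms. For $i \in \mathcal{I}$, $\partial(i/\mathcal{I})$ is the full subcategory of the coslice $i/\mathcal{I}$ on all objects other than $\mathrm{id}_i$. **Matching objects and Reedy fibrations.** For $X \in \mathcal{C}^{\mathcal{I}}$, the matching object is $M_iX = \lim(\partial(i/\mathcal{I}) \to \mathcal{I} \xrightarrow{X} \mathcal{C})$, and the matching map $m_iX \colon X_i \to M_iX$ is induced by the cone $(X_f \colon X_i \to X_j)_{f \colon i \to j \in \partial(i/\mathcal{I})}$. A map $p \colon E \to B$ in $\mathcal{C}^{\mathcal{I}}$ is a Reedy fibration if for every $i$ the relative matching map $E_i \to B_i \times_{M_iB} M_iE$, induced by $p_i$ and $m_iE$, is a fibration in $\mathcal{C}$. **Pushforwards.** For $p \colon B \to A$ in a category with pullbacks and $k \colon C \to B$, a pushforward of $k$ along $p$ is an object $p_*k \colon p_*C \to A$ of the slice over $A$ representing $x \mapsto \mathrm{Hom}_{/B}(p^*x, k)$, where $p^*$ is pullback along $p$. Its counit is written $\mathrm{ev} \colon p^*p_*C \to C$ (over $B$). ''Fibrations are stable under pushforward along fibrations'' means: for all fibrations $k \colon C \to B$ and $p \colon B \to A$, the pushforward $p_*k$ exists and is a fibration. **Homotopical diagrams.** A diagram $X \colon \mathcal{I} \to \mathcal{C}$ is homotopical if it sends weak equivalences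 to weak equivalences. A homotopical Reedy fibration is a Reedy fibration between homotopical diagrams. **Homotopically logically behaved pullbacks.** This means: - weak equivalences are preserved by pullback along fibrations; and - pullbacks preserve weak equivalences between fibrations: if $X \to A$ and $Y \to A$ are fibrations, $X \to Y$ is a weak equivalence over $A$, and $A' \to A$ is any map, then $A'\times_A X \to A' \times_A Y$ is a weak equivalence. **Homotopically logically behaved pushforwards.** This means: - pushforwards along fibrations preserve weak equivalences between fibrations: if $p \colon B \to A$ is a fibration, $X \to B$ and $Y \to B$ are fibrations, and $X \to Y$ is a weak equivalence over $B$, then $p_*X \to p_*Y$ is a weak equivalence; and - for every commutative square $p g = f p'$ with $p \colon B \to A$ and $p' \colon B' \to A'$ fibrations and $g \colon B' \to B$ and $f \colon A' \to A$ weak equivalences, and every fibration $C \to B$, the map $f^*p_*C \to p'_*g^*C$ over $A'$ is a weak equivalence, where this map is the transpose of $p'^*f^*p_*C \cong g^*p^*p_*C \xrightarrow{g^*\mathrm{ev}} g^*C$. *)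

(* Defs.v *)
From Stdlib Require Import FinFun ProofIrrelevance FunctionalExtensionality.

Set Implicit Arguments.
Unset Strict Implicit.
Unset Printing Implicit Defensive.

Declare Scope cat_scope.
Delimit Scope cat_scope with cat.

Record Category := {
  Ob :> Type;
  Hom : Ob -> Ob -> Type;
  idm : forall a, Hom a a;
  comp : forall a b c, Hom b c -> Hom a b -> Hom a c;
  comp_idl : forall a b (f : Hom a b), comp (idm b) f = f;
  comp_idr : forall a b (f : Hom a b), comp f (idm a) = f;
  comp_assoc : forall a b c d (h : Hom c d) (g : Hom b c) (f : Hom a b),
    comp h (comp g f) = comp (comp h g) f
}.

Arguments Hom {_} _ _.
Arguments idm {_} _.
Arguments comp {_ _ _ _} _ _.

Notation "g ∘ f" := (comp g f) (at level 40, left associativity) : cat_scope.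
Local Open Scope cat_scope.

Definition is_iso (C : Category) (a b : C) (f : Hom a b) : Prop :=
  exists g : Hom b a, g ∘ f = idm a /\ f ∘ g = idm b.

Definition is_initial (C : Category) (x : C) : Prop :=
  forall y : C, exists h : Hom x y, forall h' : Hom x y, h' = h.

Record Functor (I C : Category) := {
  fob :> I -> C;
  fmap : forall i j : I, Hom i j -> Hom (fob i) (fob j);
  fmap_id : forall i, fmap (idm i) = idm (fob i);
  fmap_comp : forall i j k (g : Hom j k) (f : Hom i j),
    fmap (g ∘ f) = fmap g ∘ fmap f
}.

Arguments fmap {_ _} _ {_ _} _.

Definition functor_comp (I J C : Category) (G : Functor J C) (F : Functor I J) :
  Functor I C.
Proof.
  refine {| fob := fun i => G (F i); fmap := fun i j f => fmap G (fmap F f) |}.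
  - intros i; now rewrite !fmap_id.
  - intros i j k g f; now rewrite !fmap_comp.
Defined.

Record NatTrans (I C : Category) (X Y : Functor I C) := {
  component :> forall i : I, Hom (X i) (Y i);
  naturality : forall (i j : I) (f : Hom i j),
    fmap Y f ∘ component i = component j ∘ fmap X f
}.

Lemma nat_trans_eq (I C : Category) (X Y : Functor I C) (s t : NatTrans X Y) :
  (forall i, s i = t i) -> s = t.
Proof.
  destruct s as [s hs], t as [t ht]; simpl; intros e.
  assert (e' : s = t) by (apply functional_extensionality_dep; exact e).
  subst t; f_equal; apply proof_irrelevance.
Qed.

Definition nat_id (I C : Category) (X : Functor I C) : NatTrans X X.
Proof.
  refine {| component := fun i => idm (X i) |}.
  intros i j f; now rewrite comp_idl, comp_idr.
Defined.

Definition nat_comp (I C : Category) (X Y Z : Functor I C)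
  (t : NatTrans Y Z) (s : NatTrans X Y) : NatTrans X Z.
Proof.
  refine {| component := fun i => t i ∘ s i |}.
  intros i j f.
  now rewrite comp_assoc, naturality, <- comp_assoc, naturality, comp_assoc.
Defined.

Definition FunCat (I C : Category) : Category.
Proof.
  refine {| Ob := Functor I C; Hom := @NatTrans I C; idm := @nat_id I C;
            comp := @nat_comp I C |}.
  - intros; apply nat_trans_eq; intros i; apply comp_idl.
  - intros; apply nat_trans_eq; intros i; apply comp_idr.
  - intros; apply nat_trans_eq; intros i; apply comp_assoc.
Defined.

Definition whisker (I J C : Category) (X Y : Functor J C) (t : NatTrans X Y)
  (F : Functor I J) : NatTrans (functor_comp X F) (functor_comp Y F).
Proof.
  refine {| component := (fun i => t (F i))
              : forall i, Hom (functor_comp X F i) (functor_comp Y F i) |}.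
  intros i j f; exact (naturality t (fmap F f)).
Defined.

Definition FullSub (C : Category) (P : C -> Prop) : Category.
Proof.
  refine {| Ob := {x : C | P x};
            Hom := fun x y => Hom (proj1_sig x) (proj1_sig y);
            idm := fun x => idm (proj1_sig x);
            comp := fun x y z g f => g ∘ f |}.
  - intros; apply comp_idl.
  - intros; apply comp_idr.
  - intros; apply comp_assoc.
Defined.

Definition full_sub_incl (C : Category) (P : C -> Prop) :
  Functor (FullSub P) C.
Proof.
  now refine {| fob := (fun x => proj1_sig x) : FullSub P -> C;
                fmap := fun x y f => f |}.
Defined.

Record Over (C : Category) (A : C) := mk_over {
  over_dom : C;
  over_arr : Hom over_dom A
}.

Arguments mk_over {_ _ _} _.

Definition over_hom (C : Category) (A : C) (x y : Over A) : Type :=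
  {h : Hom (over_dom x) (over_dom y) | over_arr y ∘ h = over_arr x}.

Lemma over_hom_eq (C : Category) (A : C) (x y : Over A) (g h : over_hom x y) :
  proj1_sig g = proj1_sig h -> g = h.
Proof.
  destruct g as [g eg], h as [h eh]; simpl; intros e; subst h.
  f_equal; apply proof_irrelevance.
Qed.

Definition over_id (C : Category) (A : C) (x : Over A) : over_hom x x :=
  exist _ (idm (over_dom x)) (comp_idr (over_arr x)).

Definition over_comp (C : Category) (A : C) (x y z : Over A)
  (g : over_hom y z) (f : over_hom x y) : over_hom x z.
Proof.
  exists (proj1_sig g ∘ proj1_sig f).
  now rewrite comp_assoc, (proj2_sig g), (proj2_sig f).
Defined.

Definition Slice (C : Category) (A : C) : Category.
Proof.
  refine {| Ob := Over A; Hom := @over_hom C A; idm := @over_id C A;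
            comp := @over_comp C A |}.
  - intros; apply over_hom_eq; apply comp_idl.
  - intros; apply over_hom_eq; apply comp_idr.
  - intros; apply over_hom_eq; apply comp_assoc.
Defined.

Record Under (C : Category) (A : C) := mk_under {
  under_cod : C;
  under_arr : Hom A under_cod
}.

Arguments mk_under {_ _ _} _.

Definition under_hom (C : Category) (A : C) (x y : Under A) : Type :=
  {h : Hom (under_cod x) (under_cod y) | h ∘ under_arr x = under_arr y}.

Lemma under_hom_eq (C : Category) (A : C) (x y : Under A) (g h : under_hom x y) :
  proj1_sig g = proj1_sig h -> g = h.
Proof.
  destruct g as [g eg], h as [h eh]; simpl; intros e; subst h.
  f_equal; apply proof_irrelevance.
Qed.

Definition under_id (C : Category) (A : C) (x : Under A) : under_hom x x :=
  exist _ (idm (under_cod x)) (comp_idl (under_arr x)).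

Definition under_comp (C : Category) (A : C) (x y z : Under A)
  (g : under_hom y z) (f : under_hom x y) : under_hom x z.
Proof.
  exists (proj1_sig g ∘ proj1_sig f).
  now rewrite <- comp_assoc, (proj2_sig f), (proj2_sig g).
Defined.

Definition Coslice (C : Category) (A : C) : Category.
Proof.
  refine {| Ob := Under A; Hom := @under_hom C A; idm := @under_id C A;
            comp := @under_comp C A |}.
  - intros; apply under_hom_eq; apply comp_idl.
  - intros; apply under_hom_eq; apply comp_idr.
  - intros; apply under_hom_eq; apply comp_assoc.
Defined.

Definition coslice_proj (C : Category) (A : C) : Functor (Coslice A) C.
Proof.
  now refine {| fob := (fun x => under_cod x) : Coslice A -> C;
                fmap := fun x y f => proj1_sig f |}.
Defined.

(* Equality of arrows with a common domain, hence of objects of the coslice: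
   it makes sense before the codomain of [f] is known to be [i]. *)
Definition non_identity (I : Category) (i j : I) (f : Hom i j) : Prop :=
  mk_under f <> mk_under (idm i).

Definition inverse_category (I : Category) : Prop :=
  exists deg : I -> nat,
    forall (i j : I) (f : Hom i j), non_identity f -> deg j < deg i.

Definition finite_category (I : Category) : Prop :=
  Finite I /\ Finite {i : I & {j : I & Hom i j}}.

(* The category written ∂(i/I). *)
Definition Boundary (I : Category) (i : I) : Category :=
  FullSub (fun x : Coslice i => x <> mk_under (idm i)).

Definition boundary_proj (I : Category) (i : I) : Functor (Boundary i) I :=
  functor_comp (coslice_proj i) (full_sub_incl _).

(* Limits and pullbacks are not chosen: every construction below that uses one
   takes it as an argument, and every property quantifies over all of them. *)

Record Cone (J C : Category) (D : Functor J C) := {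
  apex : C;
  leg : forall j : J, Hom apex (D j);
  leg_comm : forall (i j : J) (f : Hom i j), fmap D f ∘ leg i = leg j
}.

Definition cone_push (J C : Category) (D D' : Functor J C) (t : NatTrans D D')
  (K : Cone D) : Cone D'.
Proof.
  refine {| apex := apex K; leg := fun j => t j ∘ leg K j |}.
  intros i j f; now rewrite comp_assoc, naturality, <- comp_assoc, leg_comm.
Defined.

Record Limit (J C : Category) (D : Functor J C) := {
  lim_cone :> Cone D;
  lim_lift : forall K : Cone D, Hom (apex K) (apex lim_cone);
  lim_lift_leg : forall (K : Cone D) (j : J),
    leg lim_cone j ∘ lim_lift K = leg K j;
  lim_uniq : forall (T : C) (h h' : Hom T (apex lim_cone)),
    (forall j : J, leg lim_cone j ∘ h = leg lim_cone j ∘ h') -> h = h'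
}.

Definition finitely_complete (C : Category) : Prop :=
  forall J : Category, finite_category J ->
  forall D : Functor J C, inhabited (Limit D).

Record Pullback (C : Category) (X Y A : C) (f : Hom X A) (g : Hom Y A) := {
  pb_ob : C;
  pb_fst : Hom pb_ob X;
  pb_snd : Hom pb_ob Y;
  pb_comm : f ∘ pb_fst = g ∘ pb_snd;
  pb_lift : forall (T : C) (u : Hom T X) (v : Hom T Y),
    f ∘ u = g ∘ v -> Hom T pb_ob;
  pb_lift_fst : forall (T : C) (u : Hom T X) (v : Hom T Y) (e : f ∘ u = g ∘ v),
    pb_fst ∘ pb_lift e = u;
  pb_lift_snd : forall (T : C) (u : Hom T X) (v : Hom T Y) (e : f ∘ u = g ∘ v),
    pb_snd ∘ pb_lift e = v;
  pb_uniq : forall (T : C) (h h' : Hom T pb_ob),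
    pb_fst ∘ h = pb_fst ∘ h' -> pb_snd ∘ h = pb_snd ∘ h' -> h = h'
}.

(* p^* x for a map x over A; p^* on maps of the slice is [base_change_map]. *)
Definition base_change (C : Category) (A B : C) (p : Hom B A) (x : Slice A)
  (P : Pullback (over_arr x) p) : Slice B :=
  mk_over (pb_snd P).

Definition base_change_map (C : Category) (A B : C) (p : Hom B A)
  (x y : Slice A) (P : Pullback (over_arr x) p) (Q : Pullback (over_arr y) p)
  (h : Hom x y) : Hom (base_change P) (base_change Q).
Proof.
  assert (e : over_arr y ∘ (proj1_sig h ∘ pb_fst P) = p ∘ pb_snd P)
    by now rewrite comp_assoc, (proj2_sig h), pb_comm.
  exact (exist _ (pb_lift Q e) (pb_lift_snd Q e)).
Defined.

(* The canonical map p'^* f^* x -> g^* p^* x over B' for a commutative square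
   p g = f p'; it is an isomorphism. *)
Definition base_change_square (C : Category) (A B A' B' : C)
  (p : Hom B A) (p' : Hom B' A') (g : Hom B' B) (f : Hom A' A)
  (sq : p ∘ g = f ∘ p') (x : Slice A)
  (fx : Pullback (over_arr x) f)
  (p'fx : Pullback (over_arr (base_change fx)) p')
  (px : Pullback (over_arr x) p)
  (gpx : Pullback (over_arr (base_change px)) g) :
  Hom (base_change p'fx) (base_change gpx).
Proof.
  assert (e : over_arr x ∘ (pb_fst fx ∘ pb_fst p'fx) = p ∘ (g ∘ pb_snd p'fx)).
  { rewrite !comp_assoc, sq, pb_comm, <- !comp_assoc.
    f_equal; exact (pb_comm p'fx). }
  exact (exist _ (pb_lift gpx (pb_lift_snd px e)) (pb_lift_snd gpx _)).
Defined.

(* A representation of x |-> Hom_{/B}(p^* x, k). As p^* x is only determined up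
   to isomorphism, the bijection is given for all choices of the pullback, and
   naturality for h = id relates these choices. *)
Record Pushforward (C : Category) (A B : C) (p : Hom B A) (k : Slice B) := {
  pf_ob : Slice A;
  pf_transpose : forall (x : Slice A) (P : Pullback (over_arr x) p),
    Hom x pf_ob -> Hom (base_change P) k;
  pf_untranspose : forall (x : Slice A) (P : Pullback (over_arr x) p),
    Hom (base_change P) k -> Hom x pf_ob;
  pf_transposeK : forall (x : Slice A) (P : Pullback (over_arr x) p)
    (u : Hom x pf_ob), pf_untranspose (P := P) (pf_transpose P u) = u;
  pf_untransposeK : forall (x : Slice A) (P : Pullback (over_arr x) p)
    (v : Hom (base_change P) k), pf_transpose P (pf_untranspose (P := P) v) = v;
  pf_natural : forall (x y : Slice A) (P : Pullback (over_arr x) p)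
    (Q : Pullback (over_arr y) p) (h : Hom x y) (u : Hom y pf_ob),
    pf_transpose P (u ∘ h) = pf_transpose Q u ∘ base_change_map P Q h
}.

Arguments pf_transpose {_ _ _ _ _} _ {_} _ _.
Arguments pf_untranspose {_ _ _ _ _} _ {_} _ _.

Definition pf_ev (C : Category) (A B : C) (p : Hom B A) (k : Slice B)
  (F : Pushforward p k) (P : Pullback (over_arr (pf_ob F)) p) : Hom (base_change P) k :=
  pf_transpose F P (idm (pf_ob F)).

(* The map p_* h; it does not depend on the choice of the pullback P. *)
Definition pf_map (C : Category) (A B : C) (p : Hom B A) (k l : Slice B)
  (F : Pushforward p k) (G : Pushforward p l) (P : Pullback (over_arr (pf_ob F)) p)
  (h : Hom k l) : Hom (pf_ob F) (pf_ob G) :=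
  pf_untranspose G P (h ∘ pf_ev P).

(* The map f^* p_* k -> p'_* g^* k over A'. *)
Definition pf_base_change (C : Category) (A B A' B' : C)
  (p : Hom B A) (p' : Hom B' A') (g : Hom B' B) (f : Hom A' A)
  (sq : p ∘ g = f ∘ p') (k : Slice B) (F : Pushforward p k)
  (gk : Pullback (over_arr k) g) (F' : Pushforward p' (base_change gk))
  (fF : Pullback (over_arr (pf_ob F)) f)
  (p'fF : Pullback (over_arr (base_change fF)) p')
  (pF : Pullback (over_arr (pf_ob F)) p)
  (gpF : Pullback (over_arr (base_change pF)) g) :
  Hom (base_change fF) (pf_ob F') :=
  pf_untranspose F' p'fF
    (base_change_map gpF gk (pf_ev pF) ∘ base_change_square sq p'fF gpF).

Record WideSub (C : Category) := {
  in_wide : forall a b : C, Hom a b -> Prop;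
  wide_id : forall a : C, in_wide (idm a);
  wide_comp : forall (a b c : C) (g : Hom b c) (f : Hom a b),
    in_wide g -> in_wide f -> in_wide (g ∘ f)
}.

Arguments in_wide {_} _ {_ _} _.

Notation "f ∈ W" := (in_wide W f) (at level 70) : cat_scope.

Definition contains_isos (C : Category) (W : WideSub C) : Prop :=
  forall (a b : C) (f : Hom a b), is_iso f -> f ∈ W.

(* The third implication is part of being a subcategory. *)
Definition two_out_of_three (C : Category) (W : WideSub C) : Prop :=
  forall (a b c : C) (g : Hom b c) (f : Hom a b),
    (f ∈ W -> g ∘ f ∈ W -> g ∈ W) /\
    (g ∈ W -> g ∘ f ∈ W -> f ∈ W).

Definition stable_under_pullback (C : Category) (Fib : WideSub C) : Prop :=
  forall (A B X : C) (k : Hom X A) (f : Hom B A) (P : Pullback k f),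
    k ∈ Fib -> pb_snd P ∈ Fib.

Definition stable_under_pushforward (C : Category) (Fib : WideSub C) : Prop :=
  forall (A B X : C) (k : Hom X B) (p : Hom B A),
    k ∈ Fib -> p ∈ Fib ->
    exists F : Pushforward p (mk_over k), over_arr (pf_ob F) ∈ Fib.

Definition pullbacks_behaved (C : Category) (Fib W : WideSub C) : Prop :=
  (forall (A B X : C) (w : Hom X A) (p : Hom B A) (P : Pullback w p),
     w ∈ W -> p ∈ Fib -> pb_snd P ∈ W) /\
  (forall (A A' : C) (x y : Slice A) (h : Hom x y) (f : Hom A' A)
     (P : Pullback (over_arr x) f) (Q : Pullback (over_arr y) f),
     over_arr x ∈ Fib -> over_arr y ∈ Fib -> proj1_sig h ∈ W ->
     proj1_sig (base_change_map P Q h) ∈ W).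

Definition pushforwards_behaved (C : Category) (Fib W : WideSub C) : Prop :=
  (forall (A B : C) (p : Hom B A) (x y : Slice B) (h : Hom x y)
     (F : Pushforward p x) (G : Pushforward p y) (P : Pullback (over_arr (pf_ob F)) p),
     p ∈ Fib -> over_arr x ∈ Fib -> over_arr y ∈ Fib ->
     proj1_sig h ∈ W -> proj1_sig (pf_map G P h) ∈ W) /\
  (forall (A B A' B' : C) (p : Hom B A) (p' : Hom B' A') (g : Hom B' B)
     (f : Hom A' A) (sq : p ∘ g = f ∘ p') (k : Slice B)
     (F : Pushforward p k)
     (gk : Pullback (over_arr k) g) (F' : Pushforward p' (base_change gk))
     (fF : Pullback (over_arr (pf_ob F)) f)
     (p'fF : Pullback (over_arr (base_change fF)) p')
     (pF : Pullback (over_arr (pf_ob F)) p)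
     (gpF : Pullback (over_arr (base_change pF)) g),
     p ∈ Fib -> p' ∈ Fib -> g ∈ W -> f ∈ W -> over_arr k ∈ Fib ->
     proj1_sig (pf_base_change sq F' p'fF gpF) ∈ W).

Definition homotopical (I C : Category) (WI : WideSub I) (W : WideSub C)
  (X : Functor I C) : Prop :=
  forall (i j : I) (f : Hom i j), f ∈ WI -> fmap X f ∈ W.

Definition boundary_diagram (I C : Category) (X : Functor I C) (i : I) :
  Functor (Boundary i) C :=
  functor_comp X (boundary_proj i).

Definition matching_cone (I C : Category) (X : Functor I C) (i : I) :
  Cone (boundary_diagram X i).
Proof.
  refine {| apex := X i;
            leg := fun f : Boundary i => fmap X (under_arr (proj1_sig f))
                     : Hom (X i) (boundary_diagram X i f) |}.
  intros f g h.
  exact (eq_trans (eq_sym (fmap_comp X _ _)) (f_equal (fmap X) (proj2_sig h))).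
Defined.

Definition matching_map (I C : Category) (X : Functor I C) (i : I)
  (MX : Limit (boundary_diagram X i)) : Hom (X i) (apex MX) :=
  lim_lift MX (matching_cone X i).

Definition matching_ob_map (I C : Category) (E B : Functor I C)
  (p : NatTrans E B) (i : I) (ME : Limit (boundary_diagram E i))
  (MB : Limit (boundary_diagram B i)) : Hom (apex ME) (apex MB) :=
  lim_lift MB (cone_push (whisker p (boundary_proj i)) ME).

Lemma matching_map_natural (I C : Category) (E B : Functor I C)
  (p : NatTrans E B) (i : I) (ME : Limit (boundary_diagram E i))
  (MB : Limit (boundary_diagram B i)) :
  matching_map MB ∘ p i = matching_ob_map p ME MB ∘ matching_map ME.
Proof.
  apply (lim_uniq (l := MB)); intros j.
  pose proof (lim_lift_leg MB (matching_cone B i) j) as eB.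
  pose proof (lim_lift_leg ME (matching_cone E i) j) as eE.
  pose proof (lim_lift_leg MB
    (cone_push (whisker p (boundary_proj i)) ME) j) as eM.
  rewrite !comp_assoc.
  refine (eq_trans (f_equal (fun h => h ∘ p i) eB) _).
  refine (eq_trans _ (eq_sym (f_equal (fun h => h ∘ matching_map ME) eM))).
  simpl; rewrite <- comp_assoc.
  refine (eq_trans _ (eq_sym (f_equal (comp _) eE))).
  exact (naturality p (under_arr (proj1_sig j))).
Qed.

Definition relative_matching_map (I C : Category) (E B : Functor I C)
  (p : NatTrans E B) (i : I) (ME : Limit (boundary_diagram E i))
  (MB : Limit (boundary_diagram B i))
  (P : Pullback (matching_map MB) (matching_ob_map p ME MB)) :
  Hom (E i) (pb_ob P) :=
  pb_lift P (matching_map_natural p ME MB).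

Definition Reedy_fibration (I C : Category) (Fib : WideSub C)
  (E B : Functor I C) (p : NatTrans E B) : Prop :=
  forall (i : I) (ME : Limit (boundary_diagram E i))
    (MB : Limit (boundary_diagram B i))
    (P : Pullback (matching_map MB) (matching_ob_map p ME MB)),
    relative_matching_map P ∈ Fib.

(* Main.v *)
(* Over a : U -> X i, the pushforward p_*Z at i should consist of compatible
   families of sections z_f of Z over the base change of p along X f a, for all
   f : i -> j. This presheaf is defined without recursion; it is representable
   because a family on a cosieve S of the coslice i/I is extended to one more
   object x, whose boundary lies in S, by a pushforward along a base change of p
   of a base change of the relative matching map of k. Hence the restriction of
   families from i/I to its boundary is a fibration, which is the Reedy
   condition, as the pullback of matching objects represents the families on the
   boundary.

   For a weak equivalence w : i -> j: if w is initial in the boundary of i, the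
   families on the boundary are represented by the base change of (p_*Z) j along
   X w, and the relative matching map of k at i is a trivial fibration, hence so
   is its pushforward. If all maps out of i are weak equivalences, the family of
   base changes of p may be replaced, adding the objects of the coslice one at a
   time, by the constant family p i; over the constant family a section family
   is determined by its value at the initial object of the coslice, so
   (p_*Z) i is the pushforward of Z i along p i up to weak equivalence, and
   likewise (p_*Z) j, pulled back to X i, is that of the pullback of Z j along
   Y w. *)
From Stdlib Require Import FinFun List Arith Lia Classical ClassicalEpsilon
  ProofIrrelevance FunctionalExtensionality PropExtensionality.
Require Import Defs.

Set Implicit Arguments.
Unset Strict Implicit.
Unset Printing Implicit Defensive.

Local Open Scope cat_scope.

(** Pullbacks are determined only up to isomorphism, so a pushforward assembled from chosen base
    changes would be functorial only up to coherent isomorphisms. With sections over all test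
    objects [V] as elements, restriction along [f : i -> j] is plain reindexing [g ↦ g ∘ f]; choices
    enter only in proving that representing objects exist. The one-object extension is stated for a
    family over [A] that need not come from [p], so that the constant family is an instance too, and
    for a class [K] of maps: fibrations give the Reedy condition, trivial fibrations treat a weak
    equivalence initial in a boundary. The Reedy condition on [k] enters as [fillable], which
    concerns only the maps out of one object and hence passes from I to its coslices, where the
    induction runs. The second assumption on pushforwards is applied only to squares with an
    identity as lower map: base change along [X f] is split off as the pullback of a weak
    equivalence along a fibration. *)

Section FiniteLimits.

Variable C : Category.
Hypothesis C_complete : finitely_complete C.

Inductive cospan_ob := cospan_left | cospan_right | cospan_vertex.

Definition cospan_hom (a b : cospan_ob) : Type :=
  match a, b with
  | cospan_left, cospan_left | cospan_right, cospan_right => unit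
  | _, cospan_vertex => unit
  | _, _ => Empty_set
  end.

Definition cospan : Category.
Proof.
  unshelve refine {| Ob := cospan_ob; Hom := cospan_hom |}.
  1: intros []; exact tt.
  1: intros [] [] []; simpl; intros; first [exact tt | contradiction].
  all: intros; repeat match goal with x : cospan_ob |- _ => destruct x end;
    simpl in *; repeat match goal with x : unit |- _ => destruct x
                       | x : Empty_set |- _ => destruct x end; reflexivity.
Defined.

Lemma cospan_finite : finite_category cospan.
Proof.
  split.
  - exists (cospan_left :: cospan_right :: cospan_vertex :: nil).
    intros []; simpl; auto.
  - exists
      (existT (fun i : cospan => {j : cospan & Hom i j}) cospan_left
         (existT (fun j : cospan => Hom (cospan_left : cospan) j) cospan_left tt) ::
       existT (fun i : cospan => {j : cospan & Hom i j}) cospan_left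
         (existT (fun j : cospan => Hom (cospan_left : cospan) j) cospan_vertex tt) ::
       existT (fun i : cospan => {j : cospan & Hom i j}) cospan_right
         (existT (fun j : cospan => Hom (cospan_right : cospan) j) cospan_right tt) ::
       existT (fun i : cospan => {j : cospan & Hom i j}) cospan_right
         (existT (fun j : cospan => Hom (cospan_right : cospan) j) cospan_vertex tt) ::
       existT (fun i : cospan => {j : cospan & Hom i j}) cospan_vertex
         (existT (fun j : cospan => Hom (cospan_vertex : cospan) j) cospan_vertex tt) ::
       nil).
    intros [[] [[] h]]; try destruct h; simpl; auto 6.
Qed.

Definition cospan_diagram (X Y A : C) (f : Hom X A) (g : Hom Y A) :
  Functor cospan C.
Proof.
  refine {| fob := (fun c => match c with cospan_left => X | cospan_right => Y
                             | cospan_vertex => A end) : cospan -> C;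
            fmap := fun a b => match a, b with
              | cospan_left, cospan_left => fun _ => idm X
              | cospan_right, cospan_right => fun _ => idm Y
              | cospan_vertex, cospan_vertex => fun _ => idm A
              | cospan_left, cospan_vertex => fun _ => f
              | cospan_right, cospan_vertex => fun _ => g
              | _, _ => fun e : Empty_set => match e with end
              end |}.
  - intros []; reflexivity.
  - intros [] [] [] u v; simpl in *; try destruct u; try destruct v;
      rewrite ?comp_idl, ?comp_idr; reflexivity.
Defined.

Definition cospan_cone (X Y A : C) (f : Hom X A) (g : Hom Y A) (T : C)
  (u : Hom T X) (v : Hom T Y) (e : f ∘ u = g ∘ v) : Cone (cospan_diagram f g).
Proof.
  refine {| apex := T;
            leg := fun c => match c return Hom T (cospan_diagram f g c) with
              | cospan_left => u | cospan_right => v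
              | cospan_vertex => f ∘ u end |}.
  intros [] [] h; simpl in *; try destruct h;
    rewrite ?comp_idl; first [reflexivity | symmetry; exact e].
Defined.

Lemma pullback_exists (X Y A : C) (f : Hom X A) (g : Hom Y A) :
  inhabited (Pullback f g).
Proof.
  destruct (C_complete cospan_finite (cospan_diagram f g)) as [L].
  constructor.
  pose (l := fun c : cospan => leg L c).
  assert (el : f ∘ l cospan_left = l cospan_vertex)
    by exact (@leg_comm _ _ _ L cospan_left cospan_vertex tt).
  assert (er : g ∘ l cospan_right = l cospan_vertex)
    by exact (@leg_comm _ _ _ L cospan_right cospan_vertex tt).
  refine {| pb_ob := apex L; pb_fst := l cospan_left : Hom _ X;
            pb_snd := l cospan_right : Hom _ Y;
            pb_comm := eq_trans el (eq_sym er);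
            pb_lift := fun T u v e => lim_lift L (cospan_cone e) |}.
  - intros T u v e; exact (lim_lift_leg L (cospan_cone e) cospan_left).
  - intros T u v e; exact (lim_lift_leg L (cospan_cone e) cospan_right).
  - intros T h h' e1 e2; apply (lim_uniq (l := L)); intros [].
    + exact e1.
    + exact e2.
    + change (l cospan_vertex ∘ h = l cospan_vertex ∘ h').
      rewrite <- el, <- !comp_assoc; f_equal; exact e1.
Qed.

(** Completeness asserts existence in [Prop], while objects and functors built from pullbacks need
    one as data; [epsilon] picks it. *)
Definition pbk (X Y A : C) (f : Hom X A) (g : Hom Y A) : Pullback f g :=
  epsilon (pullback_exists f g) (fun _ => True).

End FiniteLimits.

Section Isos.

Variable C : Category.

Lemma is_iso_id (a : C) : is_iso (idm a).
Proof. exists (idm a); split; apply comp_idl. Qed.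

(** Base change along an identity realized by the object itself, so that no comparison isomorphism
    appears where it is used. *)
Definition self_pullback (X A : C) (f : Hom X A) : Pullback (idm A) f.
Proof.
  refine {| pb_ob := X; pb_fst := f; pb_snd := idm X;
            pb_lift := fun T u v _ => v |}.
  - now rewrite comp_idl, comp_idr.
  - intros T u v e; now rewrite comp_idl in e.
  - intros; apply comp_idl.
  - intros T h h' _ e; now rewrite !comp_idl in e.
Defined.

Definition pullback_sym (X Y A : C) (f : Hom X A) (g : Hom Y A)
  (P : Pullback f g) : Pullback g f.
Proof.
  refine {| pb_ob := pb_ob P; pb_fst := pb_snd P; pb_snd := pb_fst P;
            pb_comm := eq_sym (pb_comm P);
            pb_lift := fun T u v e => pb_lift P (eq_sym e) |}.
  - intros; apply pb_lift_snd.
  - intros; apply pb_lift_fst.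
  - intros T h h' e e'; now apply pb_uniq.
Defined.

(* An isomorphism is a base change of an identity along an identity. *)
Lemma fib_contains_isos (Fib : WideSub C) :
  stable_under_pullback Fib -> contains_isos Fib.
Proof.
  intros H a b f [g [gf fg]].
  unshelve epose (P := {| pb_ob := a; pb_fst := f; pb_snd := f; pb_comm := eq_refl;
                 pb_lift := fun T u v _ => g ∘ u |} : Pullback (idm b) (idm b)).
  - intros T u v e; simpl; now rewrite comp_assoc, fg, comp_idl.
  - intros T u v e; simpl; rewrite !comp_idl in e; now rewrite comp_assoc, fg, comp_idl.
  - intros T h h' e _.
    apply (f_equal (comp g)) in e; now rewrite !comp_assoc, gf, !comp_idl in e.
  - exact (H _ _ _ _ _ P (wide_id Fib b)).
Qed.

Lemma wide_comp_iso (K : WideSub C) (a b c : C) (g : Hom b c) (f : Hom a b)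
  (h : Hom a c) :
  contains_isos K -> g ∈ K -> is_iso f -> g ∘ f = h -> h ∈ K.
Proof. intros Ki Kg If <-; apply wide_comp; auto. Qed.

End Isos.

(** * Pushforwards by generalized elements *)

Lemma base_change_map_fst (C : Category) (A B : C) (p : Hom B A) (x y : Slice A)
  (P : Pullback (over_arr x) p) (Q : Pullback (over_arr y) p) (h : Hom x y) :
  pb_fst Q ∘ proj1_sig (base_change_map P Q h) = proj1_sig h ∘ pb_fst P.
Proof. apply pb_lift_fst. Qed.

Lemma base_change_map_snd (C : Category) (A B : C) (p : Hom B A) (x y : Slice A)
  (P : Pullback (over_arr x) p) (Q : Pullback (over_arr y) p) (h : Hom x y) :
  pb_snd Q ∘ proj1_sig (base_change_map P Q h) = pb_snd P.
Proof. apply pb_lift_snd. Qed.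

Lemma pb_lift_eq_fst (C : Category) (X Y A : C) (f : Hom X A) (g : Hom Y A)
  (P : Pullback f g) (T T' : C) (u : Hom T X) (v : Hom T Y) (e : f ∘ u = g ∘ v)
  (t : Hom T' T) : pb_fst P ∘ (pb_lift P e ∘ t) = u ∘ t.
Proof. now rewrite comp_assoc, pb_lift_fst. Qed.

Lemma pb_lift_eq_snd (C : Category) (X Y A : C) (f : Hom X A) (g : Hom Y A)
  (P : Pullback f g) (T T' : C) (u : Hom T X) (v : Hom T Y) (e : f ∘ u = g ∘ v)
  (t : Hom T' T) : pb_snd P ∘ (pb_lift P e ∘ t) = v ∘ t.
Proof. now rewrite comp_assoc, pb_lift_snd. Qed.

(** The inverse transposition comes from definite description, so only bijectivity and naturality
    remain to be shown. *)
Definition mk_pushforward (C : Category) (A B : C) (p : Hom B A) (k : Slice B)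
  (o : Slice A)
  (tr : forall (x : Slice A) (P : Pullback (over_arr x) p),
     Hom x o -> Hom (base_change P) k)
  (bij : forall (x : Slice A) (P : Pullback (over_arr x) p)
     (v : Hom (base_change P) k), exists! u, tr x P u = v)
  (nat : forall (x y : Slice A) (P : Pullback (over_arr x) p)
     (Q : Pullback (over_arr y) p) (h : Hom x y) (u : Hom y o),
     tr x P (u ∘ h) = tr y Q u ∘ base_change_map P Q h) : Pushforward p k.
Proof.
  refine {| pf_ob := o; pf_transpose := tr;
            pf_untranspose := fun x P v =>
              proj1_sig (constructive_definite_description _ (bij x P v)) |}.
  - intros x P u.
    destruct (constructive_definite_description _ _) as [u' e]; simpl.
    destruct (bij x P (tr x P u)) as [u0 [e0 un]].
    now rewrite <- (un u' e), <- (un u eq_refl).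
  - intros x P v.
    now destruct (constructive_definite_description _ _) as [u' e].
  - exact nat.
Defined.

(* A pushforward of q along p described by generalized elements: a map from U
   is an arrow a : U -> A with a natural family of sections of q over the
   pullback of p along a. No pullback occurs in the description. *)
Record Pi (C : Category) (A B E : C) (p : Hom B A) (q : Hom E B) := {
  pi_ob : C;
  pi_arr : Hom pi_ob A;
  pi_ev : forall (V : C) (g : Hom V pi_ob) (b : Hom V B),
    p ∘ b = pi_arr ∘ g -> Hom V E;
  pi_ev_over : forall (V : C) (g : Hom V pi_ob) (b : Hom V B)
    (e : p ∘ b = pi_arr ∘ g), q ∘ pi_ev e = b;
  pi_ev_res : forall (V V' : C) (t : Hom V' V) (g : Hom V pi_ob) (b : Hom V B)
    (e : p ∘ b = pi_arr ∘ g) (e' : p ∘ (b ∘ t) = pi_arr ∘ (g ∘ t)),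
    pi_ev e' = pi_ev e ∘ t;
  pi_univ : forall (U : C) (a : Hom U A)
    (s : forall (V : C) (v : Hom V U) (b : Hom V B), p ∘ b = a ∘ v -> Hom V E),
    (forall V v b (e : p ∘ b = a ∘ v), q ∘ s V v b e = b) ->
    (forall V V' (t : Hom V' V) v b (e : p ∘ b = a ∘ v)
       (e' : p ∘ (b ∘ t) = a ∘ (v ∘ t)), s V' (v ∘ t) (b ∘ t) e' = s V v b e ∘ t) ->
    exists h : Hom U pi_ob, pi_arr ∘ h = a /\
      forall V v b (e : p ∘ b = a ∘ v) (e' : p ∘ b = pi_arr ∘ (h ∘ v)),
        pi_ev e' = s V v b e;
  pi_uniq : forall (U : C) (h h' : Hom U pi_ob),
    pi_arr ∘ h = pi_arr ∘ h' ->
    (forall V (v : Hom V U) (b : Hom V B) (e : p ∘ b = pi_arr ∘ (h ∘ v))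
       (e' : p ∘ b = pi_arr ∘ (h' ∘ v)), pi_ev e = pi_ev e') ->
    h = h'
}.

Arguments pi_ev {_ _ _ _ _ _} _ {_ _ _} _.

(** * Passage between [Pushforward] and [Pi] *)

Section PiPushforward.

Variable C : Category.

Lemma pi_ev_eq (A B E : C) (p : Hom B A) (q : Hom E B) (F : Pi p q) (V : C)
  (g g' : Hom V (pi_ob F)) (b b' : Hom V B) (e : p ∘ b = pi_arr F ∘ g)
  (e' : p ∘ b' = pi_arr F ∘ g') : g = g' -> b = b' -> pi_ev F e = pi_ev F e'.
Proof. intros -> ->; f_equal; apply proof_irrelevance. Qed.

Section OfPushforward.

Variables (A B : C) (p : Hom B A) (k : Slice B) (F : Pushforward p k)
  (P : Pullback (over_arr (pf_ob F)) p).

Definition pushforward_ev (V : C) (g : Hom V (over_dom (pf_ob F))) (b : Hom V B)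
  (e : p ∘ b = over_arr (pf_ob F) ∘ g) : Hom V (over_dom k) :=
  proj1_sig (pf_ev P) ∘ pb_lift P (eq_sym e).

(** The Yoneda argument: naturality at the identity writes every transpose as the counit after a
    base change. Evaluation through the fixed [P] therefore computes transposes for any other
    pullback [Q]. *)
Lemma pushforward_evE (x : Slice A) (Q : Pullback (over_arr x) p)
  (u : Hom x (pf_ob F)) (V : C) (t : Hom V (pb_ob Q))
  (e : p ∘ (pb_snd Q ∘ t) = over_arr (pf_ob F) ∘ (proj1_sig u ∘ (pb_fst Q ∘ t))) :
  pushforward_ev e = proj1_sig (pf_transpose F Q u) ∘ t.
Proof.
  pose proof (pf_natural Q P u (idm (pf_ob F))) as n; rewrite comp_idl in n.
  rewrite n; change (pushforward_ev e =
    proj1_sig (pf_ev P) ∘ proj1_sig (base_change_map Q P u) ∘ t).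
  unfold pushforward_ev; rewrite <- comp_assoc; f_equal.
  apply pb_uniq.
  - rewrite pb_lift_fst, (comp_assoc (pb_fst P)), (base_change_map_fst Q P u); apply comp_assoc.
  - now rewrite pb_lift_snd, (comp_assoc (pb_snd P)), (base_change_map_snd Q P u).
Qed.

End OfPushforward.

Definition pi_of_pushforward (C_complete : finitely_complete C) (A B : C)
  (p : Hom B A) (k : Slice B) (F : Pushforward p k) : Pi p (over_arr k).
Proof.
  pose (P := pbk C_complete (over_arr (pf_ob F)) p).
  refine {| pi_ob := over_dom (pf_ob F); pi_arr := over_arr (pf_ob F);
            pi_ev := fun V g b e => pushforward_ev P e |}.
  - intros V g b e; unfold pushforward_ev; rewrite comp_assoc.
    rewrite (proj2_sig (pf_ev P)); apply pb_lift_snd.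
  - intros V V' t g b e e'; unfold pushforward_ev; rewrite <- comp_assoc.
    f_equal; apply pb_uniq.
    + now rewrite pb_lift_fst, pb_lift_eq_fst.
    + now rewrite pb_lift_snd, pb_lift_eq_snd.
  - intros U a s s_over s_res.
    pose (x := mk_over a : Slice A).
    pose (Q := pbk C_complete a p : Pullback (over_arr x) p).
    (* A natural family is determined by its value at the universal pair, the two projections of
       [Q]; this value is transposed. *)
    pose (v := exist _ (s _ (pb_fst Q) (pb_snd Q) (eq_sym (pb_comm Q)))
                 (s_over _ _ _ _) : Hom (base_change Q) k).
    pose (u := pf_untranspose F Q v).
    exists (proj1_sig u); split; [exact (proj2_sig u)|].
    intros V w b e e'.
    (* Any pair [(w, b)] is the universal pair composed with a map [t] into [pb_ob Q], which reduces
       the claim to naturality of [s]. *)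
    assert (ew : w = pb_fst Q ∘ pb_lift Q (eq_sym e : over_arr x ∘ w = p ∘ b))
      by now rewrite pb_lift_fst.
    assert (eb : b = pb_snd Q ∘ pb_lift Q (eq_sym e : over_arr x ∘ w = p ∘ b))
      by now rewrite pb_lift_snd.
    set (t := pb_lift Q _) in *; clearbody t.
    subst w b.
    rewrite (pushforward_evE P (u := u)).
    unfold u; rewrite pf_untransposeK; simpl.
    symmetry; apply s_res.
  - intros U h h' ea es.
    pose (x := mk_over (over_arr (pf_ob F) ∘ h) : Slice A).
    pose (Q := pbk C_complete (over_arr x) p).
    pose (u := exist _ h eq_refl : Hom x (pf_ob F)).
    pose (u' := exist _ h' (eq_sym ea) : Hom x (pf_ob F)).
    change (proj1_sig u = proj1_sig u'); f_equal.
    rewrite <- (pf_transposeK Q u), <- (pf_transposeK Q u').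
    f_equal; apply over_hom_eq.
    assert (e : p ∘ (pb_snd Q ∘ idm _) =
      over_arr (pf_ob F) ∘ (proj1_sig u ∘ (pb_fst Q ∘ idm _))).
    { rewrite !comp_idr; simpl; rewrite comp_assoc; symmetry; apply pb_comm. }
    assert (e' : p ∘ (pb_snd Q ∘ idm _) =
      over_arr (pf_ob F) ∘ (proj1_sig u' ∘ (pb_fst Q ∘ idm _))).
    { rewrite e; simpl; rewrite !comp_assoc; exact (f_equal (fun z => z ∘ pb_fst Q ∘ idm _) ea). }
    pose proof (pushforward_evE P e) as H.
    pose proof (pushforward_evE P e') as H'.
    rewrite comp_idr in H, H'; rewrite <- H, <- H'; apply es.
Defined.

(** The way back is needed because [pushforwards_behaved] speaks of [Pushforward] and has to be
    applied to objects constructed as [Pi]. *)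
Definition pushforward_of_pi (A B : C) (p : Hom B A) (k : Slice B)
  (F : Pi p (over_arr k)) : Pushforward p k.
Proof.
  assert (ep : forall (x : Slice A) (P : Pullback (over_arr x) p)
    (u : over_hom x (mk_over (pi_arr F))),
    p ∘ pb_snd P = pi_arr F ∘ (proj1_sig u ∘ pb_fst P)).
  { intros x P u; rewrite comp_assoc.
    rewrite <- (pb_comm P); f_equal; symmetry; exact (proj2_sig u). }
  refine (@mk_pushforward C A B p k (mk_over (pi_arr F))
    (fun x P u => exist _ (pi_ev F (ep x P u)) (pi_ev_over (ep x P u))) _ _).
  - intros x P [v ev]; simpl in ev.
    (* A map out of the pullback becomes a family of sections by precomposing it with the map into
       the pullback that a pair [(t, b)] induces. *)
    destruct (@pi_univ _ _ _ _ _ _ F (over_dom x) (over_arr x)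
      (fun V t b e => v ∘ pb_lift P (eq_sym e))) as [h [ea eh]].
    + intros V t b e; rewrite comp_assoc; exact (eq_trans (f_equal (fun z => z ∘ _) ev) (pb_lift_snd P _)).
    + intros V V' t w b e e'; rewrite <- comp_assoc; f_equal; apply pb_uniq.
      * now rewrite pb_lift_fst, pb_lift_eq_fst.
      * now rewrite pb_lift_snd, pb_lift_eq_snd.
    + exists (exist _ h ea); split.
      * apply over_hom_eq; simpl.
        rewrite (eh _ _ _ (eq_sym (pb_comm P))).
        rewrite <- (comp_idr v) at 2; f_equal; apply pb_uniq.
        -- now rewrite pb_lift_fst, comp_idr.
        -- now rewrite pb_lift_snd, comp_idr.
      * intros [h' ea'] e; apply over_hom_eq; simpl in *.
        apply (f_equal (@proj1_sig _ _)) in e; simpl in e.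
        apply (@pi_uniq _ _ _ _ _ _ F); [now rewrite ea|].
        intros V w b e1 e2.
        assert (e3 : p ∘ b = over_arr x ∘ w)
          by now rewrite e1, comp_assoc, ea.
        rewrite (eh _ _ _ e3), <- e.
        assert (e4 : p ∘ (pb_snd P ∘ pb_lift P (eq_sym e3)) =
          pi_arr F ∘ (h' ∘ pb_fst P ∘ pb_lift P (eq_sym e3))).
        { rewrite pb_lift_snd, <- comp_assoc, pb_lift_fst; exact e2. }
        rewrite <- (pi_ev_res _ e4); apply pi_ev_eq.
        -- now rewrite <- comp_assoc, pb_lift_fst.
        -- now rewrite pb_lift_snd.
  - intros x y P Q h u; apply over_hom_eq; simpl.
    assert (e : p ∘ (pb_snd Q ∘ proj1_sig (base_change_map P Q h)) =
      pi_arr F ∘ (proj1_sig u ∘ pb_fst Q ∘ proj1_sig (base_change_map P Q h))).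
    { rewrite !comp_assoc; f_equal; rewrite <- comp_assoc; apply ep. }
    etransitivity; [|exact (pi_ev_res (ep y Q u) e)].
    apply pi_ev_eq.
    + refine (eq_trans (eq_sym (comp_assoc _ _ _)) (eq_trans _ (comp_assoc _ _ _))).
      f_equal; symmetry; apply base_change_map_fst.
    + symmetry; apply base_change_map_snd.
Defined.

End PiPushforward.

(** * Pushforwards and weak equivalences *)

Section PiWeq.

Variables (C : Category) (Fib W : WideSub C).
Hypothesis C_complete : finitely_complete C.

Lemma pi_exists (A B E : C) (p : Hom B A) (q : Hom E B) :
  stable_under_pushforward Fib -> p ∈ Fib -> q ∈ Fib ->
  exists F : Pi p q, pi_arr F ∈ Fib.
Proof.
  intros H hp hq; destruct (H _ _ _ _ _ hq hp) as [F hF].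
  now exists (pi_of_pushforward C_complete F).
Qed.

Hypothesis C_pushforwards : pushforwards_behaved Fib W.

(** The condition on evaluations says that the transpose of [m] is [h] after the counit, which
    characterizes the map induced by [h] on pushforwards. *)
Lemma pi_map_weq (A B E E' : C) (p : Hom B A) (q : Hom E B) (q' : Hom E' B)
  (F : Pi p q) (F' : Pi p q') (h : Hom E E') (m : Hom (pi_ob F) (pi_ob F')) :
  p ∈ Fib -> q ∈ Fib -> q' ∈ Fib -> h ∈ W -> q' ∘ h = q ->
  pi_arr F' ∘ m = pi_arr F ->
  (forall V (g : Hom V (pi_ob F)) (b : Hom V B) (e : p ∘ b = pi_arr F ∘ g)
     (e' : p ∘ b = pi_arr F' ∘ (m ∘ g)), pi_ev F' e' = h ∘ pi_ev F e) ->
  m ∈ W.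
Proof.
  intros hp hq hq' hh eh em ev.
  pose (x := mk_over q : Slice B); pose (y := mk_over q' : Slice B).
  pose (h' := exist _ h eh : Hom x y).
  pose (G := pushforward_of_pi (k := x) F).
  pose (G' := pushforward_of_pi (k := y) F').
  pose (P := pbk C_complete (over_arr (pf_ob G)) p).
  pose proof (proj1 C_pushforwards A B p x y h' G G' P hp hq hq' hh) as H.
  pose (m' := exist _ m em : Hom (pf_ob G) (pf_ob G')).
  enough (e : pf_map G' P h' = m') by (rewrite e in H; exact H).
  unfold pf_map; rewrite <- (pf_transposeK P m'); f_equal.
  apply over_hom_eq; symmetry; simpl.
  erewrite pi_ev_eq; [apply (ev _ (idm _ ∘ pb_fst P) (pb_snd P)) | | reflexivity].
  rewrite comp_idl; reflexivity.
  Unshelve.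
  rewrite comp_idl, (comp_assoc (pi_arr F')), em; symmetry; exact (pb_comm P).
Qed.

(** [q] is a weak equivalence over [B] from the fibration [q] to [idm B], and the pushforward of
    [idm B] is [idm A]; the induced map between the pushforwards is [pi_arr F]. *)
Lemma pi_trivial (A B E : C) (p : Hom B A) (q : Hom E B) (F : Pi p q) :
  p ∈ Fib -> q ∈ Fib -> q ∈ W -> pi_arr F ∈ W.
Proof.
  intros hp hq wq.
  (* The pushforward of [idm B]: the only section sends [b] to itself. *)
  unshelve epose (F' := {| pi_ob := A; pi_arr := idm A;
      pi_ev := fun V g b _ => b |} : Pi p (idm B)).
  - intros; apply comp_idl.
  - reflexivity.
  - intros U a s s1 _; exists a; split; [apply comp_idl|].
    intros V v b e _; rewrite <- (s1 V v b e) at 1; now rewrite comp_idl.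
  - intros U h h' e _; now rewrite !comp_idl in e.
  - apply (@pi_map_weq _ _ _ _ p q (idm B) F F' q); auto using wide_id, comp_idl.
    + intros V g b e e'; symmetry; exact (pi_ev_over e).
Qed.

(* The second half of [pushforwards_behaved] for a square whose lower map is an
   identity. *)
Lemma pi_base_weq (A B B' E : C) (p : Hom B A) (p' : Hom B' A) (g : Hom B' B)
  (q : Hom E B) (gq : Pullback q g) (F : Pi p q) (F' : Pi p' (pb_snd gq))
  (m : Hom (pi_ob F) (pi_ob F')) :
  p ∈ Fib -> p' ∈ Fib -> q ∈ Fib -> g ∈ W -> p ∘ g = p' ->
  pi_arr F' ∘ m = pi_arr F ->
  (forall V (v : Hom V (pi_ob F)) (b : Hom V B') (e : p ∘ (g ∘ b) = pi_arr F ∘ v)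
     (e' : p' ∘ b = pi_arr F' ∘ (m ∘ v)), pb_fst gq ∘ pi_ev F' e' = pi_ev F e) ->
  m ∈ W.
Proof.
  intros hp hp' hq hg ep em ev.
  pose (k := mk_over q : Slice B).
  pose (gk := gq : Pullback (over_arr k) g).
  pose (G := pushforward_of_pi (k := k) F).
  pose (G' := pushforward_of_pi (k := base_change gk) F').
  assert (sq : p ∘ g = idm A ∘ p') by now rewrite comp_idl.
  (* With this pullback along [idm A] the base change of the pushforward has [pi_ob F] itself as
     domain, so that [m] is a candidate for the comparison map. *)
  pose (fF := pullback_sym (self_pullback (pi_arr F))
    : Pullback (over_arr (pf_ob G)) (idm A)).
  pose (p'fF := pbk C_complete (over_arr (base_change fF)) p').
  pose (pF := pbk C_complete (over_arr (pf_ob G)) p).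
  pose (gpF := pbk C_complete (over_arr (base_change pF)) g).
  pose proof (proj2 C_pushforwards A B A B' p p' g (idm A) sq k G gk G' fF p'fF
    pF gpF hp hp' hg (wide_id W A) hq) as H.
  pose (m' := exist _ m em : Hom (base_change fF) (pf_ob G')).
  enough (e : pf_base_change sq G' p'fF gpF = m') by (rewrite e in H; exact H).
  unfold pf_base_change; rewrite <- (pf_transposeK p'fF m'); f_equal.
  (* Both transposes are maps over [B'] into the pullback [gk], so only their projections to [E]
     need an argument. *)
  apply over_hom_eq; apply (@pb_uniq _ _ _ _ _ _ gk).
  2: { refine (eq_trans _ (eq_sym (proj2_sig (pf_transpose G' p'fF m')))).
       exact (proj2_sig (base_change_map gpF gk (pf_ev pF)
                         ∘ base_change_square sq p'fF gpF)). }
  assert (c : p' ∘ pb_snd p'fF = pi_arr F ∘ pb_fst p'fF)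
    by (symmetry; exact (pb_comm p'fF)).
  assert (c' : p ∘ (g ∘ pb_snd p'fF) = pi_arr F ∘ pb_fst p'fF)
    by (rewrite comp_assoc, ep; exact c).
  transitivity (pi_ev F c').
  2: { symmetry; apply ev. }
  (* [t] is the canonical map between the two iterated pullbacks; [t1] and [t2] give its image in
     the pullback of [p], where the counit of [F] is evaluated. *)
  pose (t := proj1_sig (base_change_square sq p'fF gpF)).
  assert (t1 : pb_fst pF ∘ (pb_fst gpF ∘ t) = pb_fst p'fF).
  { unfold t, base_change_square; simpl.
    rewrite pb_lift_fst, pb_lift_fst; apply comp_idl. }
  assert (t2 : pb_snd pF ∘ (pb_fst gpF ∘ t) = g ∘ pb_snd p'fF).
  { unfold t, base_change_square; simpl.
    now rewrite pb_lift_fst, pb_lift_snd. }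
  transitivity (pb_fst gk ∘ (proj1_sig (base_change_map gpF gk (pf_ev pF)) ∘ t));
    [reflexivity|].
  rewrite (comp_assoc (pb_fst gk)), (base_change_map_fst gpF gk (pf_ev pF)).
  rewrite <- (comp_assoc (proj1_sig _)); symmetry; unfold pf_ev; simpl.
  refine (eq_trans _ (pi_ev_res _ _)); apply pi_ev_eq.
  - rewrite comp_idl; symmetry; exact t1.
  - symmetry; exact t2.
  Unshelve.
  + rewrite comp_idl.
    exact (eq_trans (f_equal (comp p) t2) (eq_trans c' (f_equal (comp _) (eq_sym t1)))).
Qed.

End PiWeq.

(** * Extending a family of sections by one object *)

(** An object over [A] representing the relation [R], with generic element [pt_el]. For the base
    changes of p it is a pullback, for the constant family it is the source of a component of p;
    speaking of [R] avoids fixing either. *)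
Record Points (C : Category) (A D : C)
  (R : forall V : C, Hom V A -> Hom V D -> Prop) := {
  pt_ob : C;
  pt_arr : Hom pt_ob A;
  pt_el : Hom pt_ob D;
  pt_in : R pt_ob pt_arr pt_el;
  pt_lift : forall (V : C) (v : Hom V A) (b : Hom V D), R V v b -> Hom V pt_ob;
  pt_lift_arr : forall (V : C) (v : Hom V A) (b : Hom V D) (r : R V v b),
    pt_arr ∘ pt_lift r = v;
  pt_lift_el : forall (V : C) (v : Hom V A) (b : Hom V D) (r : R V v b),
    pt_el ∘ pt_lift r = b;
  pt_uniq : forall (V : C) (m m' : Hom V pt_ob),
    pt_arr ∘ m = pt_arr ∘ m' -> pt_el ∘ m = pt_el ∘ m' -> m = m'
}.

Arguments pt_lift {_ _ _ _} _ {_ _ _} _.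

Definition stable_rel (C : Category) (A D : C)
  (R : forall V : C, Hom V A -> Hom V D -> Prop) : Prop :=
  forall (V V' : C) (t : Hom V' V) (v : Hom V A) (b : Hom V D),
    R V v b -> R V' (v ∘ t) (b ∘ t).

Definition pull_rel (C : Category) (A A' D : C) (c : Hom A' A)
  (R : forall V : C, Hom V A -> Hom V D -> Prop) :
  forall V : C, Hom V A' -> Hom V D -> Prop :=
  fun V v b => R V (c ∘ v) b.

(** [R'] need only be equivalent to the pulled back relation: in [compares_step] they differ by
    associativity and by the equation [rep_arr Q' ∘ c = rep_arr Q]. *)
Definition points_pull (C : Category) (A A' D : C) (c : Hom A' A)
  (R : forall V : C, Hom V A -> Hom V D -> Prop)
  (R' : forall V : C, Hom V A' -> Hom V D -> Prop) (R_res : stable_rel R)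
  (RR' : forall V (v : Hom V A') b, R' V v b <-> R V (c ∘ v) b)
  (P : Points R) (Q : Pullback (pt_arr P) c) : Points R'.
Proof.
  refine {| pt_ob := pb_ob Q; pt_arr := pb_snd Q; pt_el := pt_el P ∘ pb_fst Q;
    pt_lift := fun V v b r => pb_lift Q (pt_lift_arr P (proj1 (RR' V v b) r)) |}.
  - apply RR'; rewrite <- (pb_comm Q); apply R_res, pt_in.
  - intros V v b r; apply pb_lift_snd.
  - intros V v b r; rewrite <- comp_assoc, pb_lift_fst; apply pt_lift_el.
  - intros V m m' e e'; apply pb_uniq; [|exact e].
    apply (@pt_uniq _ _ _ _ P).
    + now rewrite !comp_assoc, (pb_comm Q), <- !comp_assoc, e.
    + now rewrite !comp_assoc.
Defined.

Section Fillers.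

Variables (C J : Category) (deg : J -> nat) (Y Z : Functor J C)
  (k : NatTrans Z Y).

(** Represents the elements of [Z x] over [b] with boundary [z]. When matching objects exist and [z]
    is a matching family, this is the base change of the relative matching map along the map given
    by [b] and [z]; asking for lower degree selects the non-identity maps out of [x]. *)
Record Filler (x : J) (U : C) (b : Hom U (Y x))
  (z : forall (y : J) (h : Hom x y), deg y < deg x -> Hom U (Z y)) := {
  fl_ob : C;
  fl_arr : Hom fl_ob U;
  fl_el : Hom fl_ob (Z x);
  fl_over : k x ∘ fl_el = b ∘ fl_arr;
  fl_bd : forall (y : J) (h : Hom x y) (l : deg y < deg x),
    fmap Z h ∘ fl_el = z y h l ∘ fl_arr;
  fl_univ : forall (V : C) (v : Hom V U) (t : Hom V (Z x)),
    k x ∘ t = b ∘ v ->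
    (forall y (h : Hom x y) (l : deg y < deg x), fmap Z h ∘ t = z y h l ∘ v) ->
    exists m : Hom V fl_ob, fl_arr ∘ m = v /\ fl_el ∘ m = t;
  fl_uniq : forall (V : C) (m m' : Hom V fl_ob),
    fl_arr ∘ m = fl_arr ∘ m' -> fl_el ∘ m = fl_el ∘ m' -> m = m'
}.

Definition matching_family (x : J) (U : C) (b : Hom U (Y x))
  (z : forall (y : J) (h : Hom x y), deg y < deg x -> Hom U (Z y)) : Prop :=
  (forall y (h : Hom x y) l, k y ∘ z y h l = fmap Y h ∘ b) /\
  (forall y y' (h : Hom x y) (h' : Hom y y') l l',
     z y' (h' ∘ h) l' = fmap Z h' ∘ z y h l).

(* For [K] the fibrations this is the condition on the relative matching map at
   x, with the matching objects described by generalized elements. *)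
Definition fillable (K : WideSub C) (x : J) : Prop :=
  forall U (b : Hom U (Y x)) z, matching_family b z ->
  exists F : Filler b z, fl_arr F ∈ K.

(** Pasting of pullbacks. The equations [eb] and [ez] allow [b'] and [z'] to be presented
    differently from the composites with [g]. *)
Definition filler_pull (x : J) (U U' : C) (b : Hom U (Y x))
  (z : forall (y : J) (h : Hom x y), deg y < deg x -> Hom U (Z y))
  (F : Filler b z) (g : Hom U' U) (Q : Pullback (fl_arr F) g) (b' : Hom U' (Y x))
  (z' : forall (y : J) (h : Hom x y), deg y < deg x -> Hom U' (Z y))
  (eb : b' = b ∘ g) (ez : forall y (h : Hom x y) l, z' y h l = z y h l ∘ g) :
  Filler b' z'.
Proof.
  refine {| fl_ob := pb_ob Q; fl_arr := pb_snd Q; fl_el := fl_el F ∘ pb_fst Q |}.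
  - now rewrite eb, comp_assoc, fl_over, <- !comp_assoc, pb_comm.
  - intros y h l; rewrite ez.
    now rewrite comp_assoc, (fl_bd F _ l), <- !comp_assoc, pb_comm.
  - intros V v t e1 e2.
    destruct (fl_univ F (v := g ∘ v) (t := t)) as [m [m1 m2]].
    + now rewrite e1, eb, comp_assoc.
    + intros y h l; now rewrite (e2 y h l), ez, comp_assoc.
    + exists (pb_lift Q m1); split; [apply pb_lift_snd|].
      now rewrite <- comp_assoc, pb_lift_fst.
  - intros V m m' e1 e2; apply pb_uniq; [|exact e1].
    apply (@fl_uniq _ _ _ _ F).
    + now rewrite !comp_assoc, (pb_comm Q), <- !comp_assoc, e1.
    + now rewrite !comp_assoc.
Defined.

(* What is needed to extend a compatible family of sections by one more object x:
   the new section at x is defined on the points [sd_R] over A and its boundary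
   is prescribed. *)
Record StepData (x : J) (A : C) := {
  sd_D : C;
  sd_R : forall V : C, Hom V A -> Hom V sd_D -> Prop;
  sd_R_res : stable_rel sd_R;
  sd_y : Hom sd_D (Y x);
  sd_bd : forall (y : J) (h : Hom x y), deg y < deg x ->
    forall (V : C) (v : Hom V A) (b : Hom V sd_D), sd_R v b -> Hom V (Z y);
  sd_bd_over : forall y (h : Hom x y) l V (v : Hom V A) (b : Hom V sd_D)
    (r : sd_R v b), k y ∘ sd_bd h l r = fmap Y h ∘ (sd_y ∘ b);
  sd_bd_res : forall y (h : Hom x y) l V V' (t : Hom V' V) (v : Hom V A)
    (b : Hom V sd_D) (r : sd_R v b) (r' : sd_R (v ∘ t) (b ∘ t)),
    sd_bd h l r' = sd_bd h l r ∘ t;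
  sd_bd_act : forall y y' (h : Hom x y) (h' : Hom y y') l l' V (v : Hom V A)
    (b : Hom V sd_D) (r : sd_R v b),
    sd_bd (h' ∘ h) l' r = fmap Z h' ∘ sd_bd h l r
}.

Lemma sd_bd_eq (x : J) (A : C) (T : StepData x A) y (h : Hom x y) l V
  (v v' : Hom V A) (b b' : Hom V (sd_D T)) (r : sd_R v b) (r' : sd_R v' b') :
  v = v' -> b = b' -> sd_bd h l r = sd_bd h l r'.
Proof. intros -> ->; f_equal; apply proof_irrelevance. Qed.

Record is_step_section (x : J) (A : C) (T : StepData x A) (U : C) (a : Hom U A)
  (s : forall (V : C) (v : Hom V U) (b : Hom V (sd_D T)),
     sd_R (a ∘ v) b -> Hom V (Z x)) : Prop := {
  step_over : forall V (v : Hom V U) b (r : sd_R (a ∘ v) b),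
    k x ∘ s V v b r = sd_y T ∘ b;
  step_res : forall V V' (t : Hom V' V) (v : Hom V U) b (r : sd_R (a ∘ v) b)
    (r' : sd_R (a ∘ (v ∘ t)) (b ∘ t)), s V' (v ∘ t) (b ∘ t) r' = s V v b r ∘ t;
  step_bd : forall V (v : Hom V U) b (r : sd_R (a ∘ v) b) y (h : Hom x y) l,
    fmap Z h ∘ s V v b r = sd_bd h l r
}.

(** Only the universal property is recorded, not the points, filler and [Pi] from which [step_of_pi]
    builds such an object; [step_iso] can then replace one construction by another. *)
Record Step (x : J) (A : C) (T : StepData x A) := {
  st_ob : C;
  st_arr : Hom st_ob A;
  st_ev : forall (V : C) (v : Hom V st_ob) (b : Hom V (sd_D T)),
    sd_R (st_arr ∘ v) b -> Hom V (Z x);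
  st_ev_section : is_step_section st_ev;
  st_univ : forall (U : C) (a : Hom U A)
    (s : forall (V : C) (v : Hom V U) (b : Hom V (sd_D T)),
       sd_R (a ∘ v) b -> Hom V (Z x)),
    is_step_section s ->
    exists h : Hom U st_ob, st_arr ∘ h = a /\
      forall V (v : Hom V U) b (r : sd_R (a ∘ v) b)
        (r' : sd_R (st_arr ∘ (h ∘ v)) b), st_ev r' = s V v b r;
  st_uniq : forall (U : C) (h h' : Hom U st_ob),
    st_arr ∘ h = st_arr ∘ h' ->
    (forall V (v : Hom V U) b (r : sd_R (st_arr ∘ (h ∘ v)) b)
       (r' : sd_R (st_arr ∘ (h' ∘ v)) b), st_ev r = st_ev r') ->
    h = h'
}.

Arguments st_ev {_ _ _} _ {_ _ _} _.

Lemma st_ev_eq (x : J) (A : C) (T : StepData x A) (Q : Step T) V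
  (v v' : Hom V (st_ob Q)) (b b' : Hom V (sd_D T)) (r : sd_R (st_arr Q ∘ v) b)
  (r' : sd_R (st_arr Q ∘ v') b') : v = v' -> b = b' -> st_ev Q r = st_ev Q r'.
Proof. intros -> ->; f_equal; apply proof_irrelevance. Qed.

Section StepOfPi.

Variables (x : J) (A : C) (T : StepData x A) (P : Points (@sd_R _ _ T)).

Definition step_boundary (y : J) (h : Hom x y) (l : deg y < deg x) :
  Hom (pt_ob P) (Z y) := sd_bd h l (pt_in P).

Lemma step_matching : matching_family (sd_y T ∘ pt_el P) step_boundary.
Proof.
  split.
  - intros; apply sd_bd_over.
  - intros; apply sd_bd_act.
Qed.

Variables (F : Filler (sd_y T ∘ pt_el P) step_boundary)
  (G : Pi (pt_arr P) (fl_arr F)).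

(** A value over [b] with the prescribed boundary is the same as a lift to the filler. Sections
    subject to boundary conditions thus become plain sections of [fl_arr F] over the points, which
    is what [Pi] represents. *)
Definition step_of_pi : Step T.
Proof.
  refine {| st_ob := pi_ob G; st_arr := pi_arr G;
            st_ev := fun V v b r => fl_el F ∘ pi_ev G (pt_lift_arr P r) |}.
  - split.
    + intros V v b r.
      rewrite comp_assoc, fl_over, <- comp_assoc, pi_ev_over, <- comp_assoc.
      now rewrite pt_lift_el.
    + intros V V' t v b r r'; rewrite <- comp_assoc; f_equal.
      assert (e : pt_arr P ∘ (pt_lift P r ∘ t) = pi_arr G ∘ (v ∘ t))
        by now rewrite comp_assoc, pt_lift_arr, comp_assoc.
      rewrite <- (pi_ev_res _ e); apply pi_ev_eq; [reflexivity|].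
      apply (@pt_uniq _ _ _ _ P).
      * now rewrite pt_lift_arr, e.
      * now rewrite comp_assoc, !pt_lift_el.
    + intros V v b r y h l.
      rewrite comp_assoc, (fl_bd F _ l), <- comp_assoc, pi_ev_over.
      unfold step_boundary.
      assert (r' : sd_R (pt_arr P ∘ pt_lift P r) (pt_el P ∘ pt_lift P r))
        by apply sd_R_res, pt_in.
      rewrite <- (sd_bd_res _ _ _ r'); apply sd_bd_eq.
      * apply pt_lift_arr.
      * apply pt_lift_el.
  - intros U a s [s1 s2 s3].
    assert (R : forall V (v : Hom V U) (b : Hom V (pt_ob P)),
      pt_arr P ∘ b = a ∘ v -> sd_R (a ∘ v) (pt_el P ∘ b)).
    { intros V v b <-; apply sd_R_res, pt_in. }
    assert (ex : forall V (v : Hom V U) (b : Hom V (pt_ob P))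
      (e : pt_arr P ∘ b = a ∘ v),
      exists m : Hom V (fl_ob F), fl_arr F ∘ m = b /\ fl_el F ∘ m = s V v _ (R V v b e)).
    { intros V v b e; apply (fl_univ F (v := b)).
      - now rewrite s1, comp_assoc.
      - intros y h l; rewrite (s3 _ _ _ _ _ _ l).
        unfold step_boundary.
        assert (r' : sd_R (pt_arr P ∘ b) (pt_el P ∘ b))
          by apply sd_R_res, pt_in.
        rewrite <- (sd_bd_res _ _ _ r'); apply sd_bd_eq; auto. }
    (* Lifts to a filler are unique, so lifts chosen separately for each [V], [v] and [b] still form
       a natural family. *)
    pose (m V v b e := proj1_sig (constructive_indefinite_description _ (ex V v b e))).
    assert (m1 : forall V v b e, fl_arr F ∘ m V v b e = b).
    { intros V v b e; unfold m.
      now destruct (constructive_indefinite_description _ _). }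
    assert (m2 : forall V v b e, fl_el F ∘ m V v b e = s V v _ (R V v b e)).
    { intros V v b e; unfold m.
      now destruct (constructive_indefinite_description _ _). }
    clearbody m.
    destruct (@pi_univ _ _ _ _ _ _ G U a m m1) as [h [h1 h2]].
    + intros V V' t v b e e'; apply (@fl_uniq _ _ _ _ F).
      * now rewrite comp_assoc, !m1.
      * rewrite comp_assoc, !m2, <- (s2 _ _ _ _ _ _ (eq_ind_r
          (fun b => sd_R (a ∘ (v ∘ t)) b) (R _ _ _ e') (eq_sym (comp_assoc _ _ _)))).
        destruct (comp_assoc (pt_el P) b t); f_equal; apply proof_irrelevance.
    + exists h; split; [exact h1|].
      intros V v b r r'.
      assert (e : pt_arr P ∘ pt_lift P r' = a ∘ v)
        by now rewrite pt_lift_arr, comp_assoc, h1.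
      rewrite (h2 _ _ _ e), m2.
      generalize (R _ _ _ e).
      rewrite pt_lift_el; intros r''; f_equal; apply proof_irrelevance.
  - intros U h h' e H; apply (@pi_uniq _ _ _ _ _ _ G); [exact e|].
    intros V v b e1 e2; apply (@fl_uniq _ _ _ _ F).
    + now rewrite !pi_ev_over.
    + assert (r : sd_R (pi_arr G ∘ (h ∘ v)) (pt_el P ∘ b))
        by (rewrite <- e1; apply sd_R_res, pt_in).
      assert (r' : sd_R (pi_arr G ∘ (h' ∘ v)) (pt_el P ∘ b))
        by (rewrite <- e2; apply sd_R_res, pt_in).
      assert (l1 : b = pt_lift P r).
      { apply (@pt_uniq _ _ _ _ P);
          [now rewrite pt_lift_arr | now rewrite pt_lift_el]. }
      assert (l2 : b = pt_lift P r').
      { apply (@pt_uniq _ _ _ _ P);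
          [now rewrite pt_lift_arr | now rewrite pt_lift_el]. }
      rewrite (pi_ev_eq e1 (pt_lift_arr P r) eq_refl l1).
      rewrite (pi_ev_eq e2 (pt_lift_arr P r') eq_refl l2).
      apply H.
Defined.

End StepOfPi.


Lemma step_iso (x : J) (A : C) (T : StepData x A) (Q Q' : Step T) :
  exists m : Hom (st_ob Q) (st_ob Q'), is_iso m /\ st_arr Q' ∘ m = st_arr Q /\
    forall V (v : Hom V (st_ob Q)) b (r : sd_R (st_arr Q ∘ v) b)
      (r' : sd_R (st_arr Q' ∘ (m ∘ v)) b), st_ev Q' r' = st_ev Q r.
Proof.
  destruct (st_univ Q' (st_ev_section Q)) as [m [m1 m2]].
  destruct (st_univ Q (st_ev_section Q')) as [n [n1 n2]].
  exists m; split; [|now split].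
  exists n; split; apply st_uniq.
  - now rewrite comp_assoc, n1, m1, comp_idr.
  - intros V v b r r'.
    assert (r1 : sd_R (st_arr Q' ∘ (m ∘ v)) b).
    { rewrite comp_assoc, m1; now rewrite comp_idl in r'. }
    assert (r2 : sd_R (st_arr Q ∘ v) b) by now rewrite comp_idl in r'.
    assert (r3 : sd_R (st_arr Q ∘ (n ∘ (m ∘ v))) b)
      by now rewrite comp_assoc, n1.
    rewrite (st_ev_eq r r3 (eq_sym (comp_assoc _ _ _)) eq_refl), (n2 _ _ _ r1).
    rewrite (m2 _ _ _ r2); apply st_ev_eq; [now rewrite comp_idl | reflexivity].
  - now rewrite comp_assoc, m1, n1, comp_idr.
  - intros V v b r r'.
    assert (r1 : sd_R (st_arr Q ∘ (n ∘ v)) b).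
    { rewrite comp_assoc, n1; now rewrite comp_idl in r'. }
    assert (r2 : sd_R (st_arr Q' ∘ v) b) by now rewrite comp_idl in r'.
    assert (r3 : sd_R (st_arr Q' ∘ (m ∘ (n ∘ v))) b)
      by now rewrite comp_assoc, m1.
    rewrite (st_ev_eq r r3 (eq_sym (comp_assoc _ _ _)) eq_refl), (m2 _ _ _ r1).
    rewrite (n2 _ _ _ r2); apply st_ev_eq; [now rewrite comp_idl | reflexivity].
Qed.

Lemma step_exists (Fib K : WideSub C) (x : J) (A : C) (T : StepData x A)
  (P : Points (@sd_R _ _ T)) :
  (forall (A B E : C) (p : Hom B A) (q : Hom E B), p ∈ Fib -> q ∈ K ->
     exists F : Pi p q, pi_arr F ∈ K) ->
  fillable K x -> pt_arr P ∈ Fib -> exists Q : Step T, st_arr Q ∈ K.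
Proof.
  intros K_pi fx hP.
  destruct (fx _ _ _ (step_matching P)) as [F hF].
  destruct (K_pi _ _ _ _ _ hP hF) as [G hG].
  now exists (step_of_pi G).
Qed.

Definition sd_pull (x : J) (A A' : C) (c : Hom A' A) (T : StepData x A) :
  StepData x A'.
Proof.
  refine {| sd_D := sd_D T; sd_R := pull_rel c (@sd_R _ _ T); sd_y := sd_y T;
            sd_bd := fun y h l V v b r => sd_bd h l r |}.
  - intros V V' t v b r; unfold pull_rel; rewrite comp_assoc.
    now apply sd_R_res.
  - intros; apply sd_bd_over.
  - intros y h l V V' t v b r r'.
    assert (r'' : sd_R (c ∘ v ∘ t) (b ∘ t)) by now apply sd_R_res.
    rewrite <- (sd_bd_res _ _ r r''); apply sd_bd_eq;
      [apply comp_assoc | reflexivity].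
  - intros; apply sd_bd_act.
Defined.

(** A Beck-Chevalley property: an element over [a] for the pulled back data is an element over
    [c ∘ a] for [T], and such elements factor through the pullback of [st_arr Q]. *)
Definition step_pull (x : J) (A A' : C) (c : Hom A' A) (T : StepData x A)
  (Q : Step T) (P : Pullback (st_arr Q) c) : Step (sd_pull c T).
Proof.
  assert (R : forall V (v : Hom V (pb_ob P)) b,
    sd_R (s := sd_pull c T) (pb_snd P ∘ v) b -> sd_R (st_arr Q ∘ (pb_fst P ∘ v)) b).
  { intros V v b r; simpl in r; unfold pull_rel in r.
    now rewrite comp_assoc, (pb_comm P), <- comp_assoc. }
  refine {| st_ob := pb_ob P; st_arr := pb_snd P;
            st_ev := fun V v b r => st_ev Q (R V v b r) |}.
  - split.
    + intros; apply (step_over (st_ev_section Q)).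
    + intros V V' t v b r r'.
      assert (r'' : sd_R (st_arr Q ∘ ((pb_fst P ∘ v) ∘ t)) (b ∘ t))
        by (rewrite <- comp_assoc; now apply R).
      rewrite <- (step_res (st_ev_section Q) _ r''); apply st_ev_eq;
        [apply comp_assoc | reflexivity].
    + intros V v b r y h l; rewrite (step_bd (st_ev_section Q) _ _ l); simpl.
      apply sd_bd_eq; [|reflexivity].
      now rewrite comp_assoc, (pb_comm P), <- comp_assoc.
  - intros U a s [s1 s2 s3].
    assert (R' : forall V (v : Hom V U) b, sd_R (c ∘ a ∘ v) b ->
      sd_R (s := sd_pull c T) (a ∘ v) b).
    { intros V v b r; simpl; unfold pull_rel; now rewrite comp_assoc. }
    destruct (@st_univ _ _ _ Q U (c ∘ a) (fun V v b r => s V v b (R' V v b r)))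
      as [h [h1 h2]].
    + split.
      * intros; apply s1.
      * intros; apply s2.
      * intros V v b r y h l; rewrite (s3 _ _ _ _ _ _ l); simpl.
        apply sd_bd_eq; [apply comp_assoc | reflexivity].
    + exists (pb_lift P h1); split; [apply pb_lift_snd|].
      intros V v b r r'.
      assert (r1 : sd_R (c ∘ a ∘ v) b) by now rewrite <- comp_assoc.
      assert (r2 : sd_R (st_arr Q ∘ (h ∘ v)) b) by now rewrite comp_assoc, h1.
      rewrite (st_ev_eq _ r2 (pb_lift_eq_fst P h1 v) eq_refl), (h2 _ _ _ r1).
      f_equal; apply proof_irrelevance.
  - intros U h h' e H; apply (@pb_uniq _ _ _ _ _ _ P); [|exact e].
    apply (@st_uniq _ _ _ Q).
    + now rewrite !comp_assoc, (pb_comm P), <- !comp_assoc, e.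
    + intros V v b r r'.
      assert (r1 : sd_R (s := sd_pull c T) (pb_snd P ∘ (h ∘ v)) b).
      { simpl; unfold pull_rel.
        now rewrite (comp_assoc c), <- (pb_comm P), <- !comp_assoc, (comp_assoc (pb_fst P)). }
      assert (r2 : sd_R (s := sd_pull c T) (pb_snd P ∘ (h' ∘ v)) b).
      { simpl; unfold pull_rel.
        now rewrite (comp_assoc c), <- (pb_comm P), <- !comp_assoc, (comp_assoc (pb_fst P)). }
      rewrite (st_ev_eq r (R _ _ _ r1) (eq_sym (comp_assoc _ _ _)) eq_refl).
      rewrite (st_ev_eq r' (R _ _ _ r2) (eq_sym (comp_assoc _ _ _)) eq_refl).
      apply H.
Defined.

(** * Changing the base of a step along a weak equivalence *)

Section StepWeq.

Variables (Fib W : WideSub C).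
Hypothesis C_complete : finitely_complete C.
Hypothesis Fib_pullback : stable_under_pullback Fib.
Hypothesis Fib_pushforward : stable_under_pushforward Fib.
Hypothesis W_isos : contains_isos W.
Hypothesis W_2of3 : two_out_of_three W.
Hypothesis C_pushforwards : pushforwards_behaved Fib W.

(** By [bd_phi] the prescribed boundaries agree along [phi], so the filler for [T'] may be taken to
    be the base change along [g] of the filler for [T]. Restriction of sections along [phi] is then
    the map treated by [pi_base_weq]. *)
Lemma step_weq (x : J) (A : C) (T T' : StepData x A)
  (phi : Hom (sd_D T') (sd_D T))
  (R_phi : forall V (v : Hom V A) b, sd_R (s := T') v b -> sd_R (s := T) v (phi ∘ b))
  (y_phi : sd_y T' = sd_y T ∘ phi)
  (bd_phi : forall y (h : Hom x y) l V (v : Hom V A) b (r' : sd_R (s := T') v b)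
     (r : sd_R (s := T) v (phi ∘ b)), sd_bd h l r' = sd_bd h l r)
  (P : Points (@sd_R _ _ T)) (P' : Points (@sd_R _ _ T'))
  (g : Hom (pt_ob P') (pt_ob P)) (Q : Step T) (Q' : Step T')
  (m : Hom (st_ob Q) (st_ob Q')) :
  fillable Fib x -> pt_arr P ∈ Fib -> pt_arr P' ∈ Fib ->
  pt_arr P ∘ g = pt_arr P' -> pt_el P ∘ g = phi ∘ pt_el P' -> g ∈ W ->
  st_arr Q' ∘ m = st_arr Q ->
  (forall V (v : Hom V (st_ob Q)) b (r : sd_R (s := T) (st_arr Q ∘ v) (phi ∘ b))
     (r' : sd_R (s := T') (st_arr Q' ∘ (m ∘ v)) b), st_ev Q' r' = st_ev Q r) ->
  m ∈ W.
Proof.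
  intros fx hP hP' g1 g2 gW m1 m2.
  destruct (fx _ _ _ (step_matching P)) as [F hF].
  pose (gq := pbk C_complete (fl_arr F) g).
  assert (eb : sd_y T' ∘ pt_el P' = sd_y T ∘ pt_el P ∘ g)
    by now rewrite y_phi, <- !comp_assoc, g2.
  assert (ez : forall y (h : Hom x y) l,
    step_boundary P' h l = step_boundary P h l ∘ g).
  { intros y h l; unfold step_boundary.
    assert (r : sd_R (pt_arr P ∘ g) (pt_el P ∘ g)) by apply sd_R_res, pt_in.
    assert (r' : sd_R (s := T) (pt_arr P') (phi ∘ pt_el P'))
      by apply R_phi, pt_in.
    rewrite (bd_phi _ _ _ _ _ _ (pt_in P') r').
    rewrite <- (sd_bd_res _ _ _ r); apply sd_bd_eq; now symmetry. }
  pose (F' := filler_pull gq eb ez).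
  assert (hF' : fl_arr F' ∈ Fib) by (apply (Fib_pullback gq); exact hF).
  destruct (pi_exists C_complete Fib_pushforward hP hF) as [G _].
  destruct (pi_exists C_complete Fib_pushforward hP' hF') as [G' _].
  pose (S := step_of_pi G); pose (S' := step_of_pi G').
  (* [n] restricts sections along [phi], between the two steps built from the compatible fillers. *)
  destruct (@st_univ _ _ _ S' (st_ob S) (st_arr S)
    (fun V v b r => st_ev S (R_phi _ _ _ r))) as [n [n1 n2]].
  { split.
    - intros; rewrite (step_over (st_ev_section S)), y_phi; apply comp_assoc.
    - intros V V' t v b r r'.
      assert (r'' : sd_R (st_arr S ∘ (v ∘ t)) (phi ∘ b ∘ t))
        by (rewrite <- comp_assoc; now apply R_phi).
      rewrite <- (step_res (st_ev_section S) _ r''); apply st_ev_eq;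
        [reflexivity | apply comp_assoc].
    - intros V v b r y h l; rewrite (step_bd (st_ev_section S) _ _ l).
      symmetry; apply bd_phi. }
  assert (nW : n ∈ W).
  { apply (@pi_base_weq _ Fib W C_complete C_pushforwards _ _ _ _ (pt_arr P)
      (pt_arr P') g (fl_arr F) gq G G' n); auto.
    intros V v b e e'; apply (@fl_uniq _ _ _ _ F).
    - rewrite comp_assoc, (pb_comm gq), <- comp_assoc, !pi_ev_over; reflexivity.
    - assert (r' : sd_R (s := T') (st_arr S' ∘ (n ∘ v)) (pt_el P' ∘ b)).
      { simpl; rewrite <- e'; apply sd_R_res, pt_in. }
      assert (r : sd_R (s := T') (st_arr S ∘ v) (pt_el P' ∘ b))
        by (rewrite <- n1, <- comp_assoc; exact r').
      assert (H : fl_el F ∘ (pb_fst gq ∘ pi_ev G' (pt_lift_arr P' r')) =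
        fl_el F ∘ pi_ev G (pt_lift_arr P (R_phi _ _ _ r)))
        by (rewrite comp_assoc; exact (n2 _ _ _ r r')).
      rewrite (pi_ev_eq e' (pt_lift_arr P' r') eq_refl).
      2: { apply (@pt_uniq _ _ _ _ P'); [now rewrite pt_lift_arr|].
           symmetry; apply pt_lift_el. }
      refine (eq_trans H _); f_equal; apply pi_ev_eq; [reflexivity|].
      apply (@pt_uniq _ _ _ _ P).
      + now rewrite pt_lift_arr, e.
      + now rewrite pt_lift_el, !comp_assoc, g2. }
  destruct (step_iso Q S) as [i [iI [i1 i2]]].
  destruct (step_iso Q' S') as [j [jI [j1 j2]]].
  (* Both composites restrict the same section along [phi], so [m] is [n] up to the isomorphisms [i]
     and [j]. *)
  assert (e : j ∘ m = n ∘ i).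
  { apply (@st_uniq _ _ _ S').
    - now rewrite !comp_assoc, j1, m1, n1, i1.
    - intros V v b r r'.
      assert (r1 : sd_R (st_arr Q' ∘ (m ∘ v)) b).
      { revert r; now rewrite !comp_assoc, j1. }
      assert (r2 : sd_R (s := T) (st_arr Q ∘ v) (phi ∘ b)).
      { apply R_phi; revert r1; now rewrite comp_assoc, m1. }
      assert (r3 : sd_R (st_arr S ∘ (i ∘ v)) b).
      { revert r'; now rewrite <- comp_assoc, (comp_assoc (st_arr S')), n1. }
      assert (r4 : sd_R (st_arr S' ∘ (n ∘ (i ∘ v))) b)
        by now rewrite comp_assoc, n1.
      assert (r5 : sd_R (st_arr S' ∘ (j ∘ (m ∘ v))) b)
        by now rewrite comp_assoc, j1.
      rewrite (st_ev_eq r r5 (eq_sym (comp_assoc _ _ _)) eq_refl).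
      rewrite (st_ev_eq r' r4 (eq_sym (comp_assoc _ _ _)) eq_refl).
      rewrite (j2 _ _ _ r1), (m2 _ _ _ r2), (n2 _ _ _ r3); symmetry; apply i2. }
  apply (proj2 (W_2of3 j m)); [auto|].
  rewrite e; apply wide_comp; auto.
Qed.

End StepWeq.

End Fillers.

Arguments st_ev {_ _ _ _ _ _ _ _ _} _ {_ _ _} _.

(** * Families of sections indexed by a cosieve *)

(** A disjunction in [Prop] cannot be eliminated into [P x], so excluded middle decides [S x], and
    [p0] is transported along [x = x0] in the other case. *)
Lemma ext_family (J : Type) (S : J -> Prop) (x0 : J) (P : J -> Type)
  (phi : forall x, S x -> P x) (p0 : P x0) :
  ~ S x0 ->
  {psi : forall x, S x \/ x = x0 -> P x |
    (forall x s s', psi x s = phi x s') /\ forall s, psi x0 s = p0}.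
Proof.
  intros nS.
  exists (fun x s => match excluded_middle_informative (S x) with
    | left s' => phi x s'
    | right n => match eq_sym (match s with or_introl s' => False_ind _ (n s')
                               | or_intror e => e end) in _ = y return P y with
                 | eq_refl => p0 end
    end).
  split.
  - intros x s s'; destruct (excluded_middle_informative (S x)) as [s''|n].
    + f_equal; apply proof_irrelevance.
    + contradiction.
  - intros s; destruct (excluded_middle_informative (S x0)) as [s'|n].
    + contradiction.
    + now rewrite (proof_irrelevance _ (eq_sym _) eq_refl).
Qed.

Section Sections.

Variables (C J : Category) (deg : J -> nat) (Y Z : Functor J C)
  (k : NatTrans Z Y).
Hypothesis J_inverse : forall (x y : J) (h : Hom x y),
  deg y < deg x \/ mk_under h = mk_under (idm x).

Lemma inverse_hom_case (x : J) (P : forall y, Hom x y -> Prop) :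
  P x (idm x) -> (forall y h, deg y < deg x -> P y h) -> forall y h, P y h.
Proof.
  intros p0 p1 y h; destruct (J_inverse h) as [l|e]; [now apply p1|].
  (* The arrow and its codomain have to be replaced together, hence the predicate on arrows out of
     [x]. *)
  change ((fun u : Under x => P (under_cod u) (under_arr u)) (mk_under h)).
  now rewrite e.
Qed.

(* A family of objects over A indexed by J and mapping to Y, given by its
   generalized elements: those over [v : V -> A] are the [b : V -> fm_D x] with
   [fm_R v b]. *)
Record Fam (A : C) := {
  fm_D : Functor J C;
  fm_y : NatTrans fm_D Y;
  fm_R : forall (x : J) (V : C), Hom V A -> Hom V (fm_D x) -> Prop;
  fm_R_res : forall x, stable_rel (@fm_R x);
  fm_R_act : forall (x y : J) (h : Hom x y) (V : C) (v : Hom V A)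
    (b : Hom V (fm_D x)), fm_R v b -> fm_R v (fmap fm_D h ∘ b)
}.

Section Reps.

Variables (A : C) (B : Fam A).

(** Sections defined on [S] only, so that they can be built one object at a time; for a coslice, [S]
    everything and the base changes of p they are the elements of the pushforward over [a]. *)
Record Sec (S : J -> Prop) (U : C) (a : Hom U A) := {
  sec :> forall (x : J), S x -> forall (V : C) (v : Hom V U)
    (b : Hom V (fm_D B x)), fm_R (a ∘ v) b -> Hom V (Z x);
  sec_over : forall x s V (v : Hom V U) (b : Hom V (fm_D B x))
    (r : fm_R (a ∘ v) b), k x ∘ sec s r = fm_y B x ∘ b;
  sec_res : forall x s V V' (t : Hom V' V) (v : Hom V U) (b : Hom V (fm_D B x))
    (r : fm_R (a ∘ v) b) (r' : fm_R (a ∘ (v ∘ t)) (b ∘ t)),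
    sec s r' = sec s r ∘ t;
  sec_act : forall x y (h : Hom x y) s s' V (v : Hom V U) (b : Hom V (fm_D B x))
    (r : fm_R (a ∘ v) b) (r' : fm_R (a ∘ v) (fmap (fm_D B) h ∘ b)),
    sec s' r' = fmap Z h ∘ sec s r
}.

Lemma sec_eq (S : J -> Prop) (U : C) (a : Hom U A) (z : Sec S a) (x : J)
  (s s' : S x) (V : C) (v v' : Hom V U) (b b' : Hom V (fm_D B x))
  (r : fm_R (a ∘ v) b) (r' : fm_R (a ∘ v') b') :
  v = v' -> b = b' -> z x s V v b r = z x s' V v' b' r'.
Proof. intros -> ->; f_equal; apply proof_irrelevance. Qed.

Lemma fm_R_assoc (x : J) (U V V' : C) (a : Hom U A) (t : Hom V U) (v : Hom V' V)
  (b : Hom V' (fm_D B x)) : fm_R (a ∘ t ∘ v) b -> fm_R (a ∘ (t ∘ v)) b.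
Proof. now rewrite comp_assoc. Qed.

Definition sec_pull (S : J -> Prop) (U U' : C) (a : Hom U A) (z : Sec S a)
  (t : Hom U' U) : Sec S (a ∘ t).
Proof.
  refine {| sec := fun x s V v b r => z x s V (t ∘ v) b (fm_R_assoc r) |}.
  - intros; apply sec_over.
  - intros x s V V' w v b r r'.
    rewrite <- (sec_res z s (fm_R_assoc r) (eq_ind _ (fun w => fm_R (a ∘ w) _)
      (fm_R_assoc r') _ (comp_assoc _ _ _))).
    apply sec_eq; [apply comp_assoc | reflexivity].
  - intros; apply sec_act.
Defined.

Record Rep (S : J -> Prop) := {
  rep_ob : C;
  rep_arr : Hom rep_ob A;
  rep_sec : Sec S rep_arr;
  rep_univ : forall (U : C) (a : Hom U A) (z : Sec S a),
    exists h : Hom U rep_ob, rep_arr ∘ h = a /\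
      forall x s V (v : Hom V U) (b : Hom V (fm_D B x)) (r : fm_R (a ∘ v) b)
        (r' : fm_R (rep_arr ∘ (h ∘ v)) b), rep_sec x s V _ b r' = z x s V v b r;
  rep_uniq : forall (U : C) (h h' : Hom U rep_ob),
    rep_arr ∘ h = rep_arr ∘ h' ->
    (forall x s V (v : Hom V U) (b : Hom V (fm_D B x))
       (r : fm_R (rep_arr ∘ (h ∘ v)) b) (r' : fm_R (rep_arr ∘ (h' ∘ v)) b),
       rep_sec x s V _ b r = rep_sec x s V _ b r') ->
    h = h'
}.

Lemma rep_iso (S : J -> Prop) (Q Q' : Rep S) :
  exists m : Hom (rep_ob Q) (rep_ob Q'), is_iso m /\ rep_arr Q' ∘ m = rep_arr Q /\
    forall x s V (v : Hom V (rep_ob Q)) (b : Hom V (fm_D B x))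
      (r : fm_R (rep_arr Q ∘ v) b) (r' : fm_R (rep_arr Q' ∘ (m ∘ v)) b),
      rep_sec Q' x s V _ b r' = rep_sec Q x s V _ b r.
Proof.
  destruct (rep_univ Q' (rep_sec Q)) as [m [m1 m2]].
  destruct (rep_univ Q (rep_sec Q')) as [n [n1 n2]].
  exists m; split; [|now split].
  exists n; split; apply rep_uniq.
  - now rewrite comp_assoc, n1, m1, comp_idr.
  - intros x s V v b r r'.
    assert (r1 : fm_R (rep_arr Q' ∘ (m ∘ v)) b).
    { rewrite comp_assoc, m1; now rewrite comp_idl in r'. }
    assert (r2 : fm_R (rep_arr Q ∘ v) b) by now rewrite comp_idl in r'.
    assert (r3 : fm_R (rep_arr Q ∘ (n ∘ (m ∘ v))) b)
      by now rewrite comp_assoc, n1.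
    rewrite (sec_eq _ s s r r3 (eq_sym (comp_assoc _ _ _)) eq_refl).
    rewrite (n2 _ _ _ _ _ r1), (m2 _ _ _ _ _ r2).
    apply sec_eq; [now rewrite comp_idl | reflexivity].
  - now rewrite comp_assoc, m1, n1, comp_idr.
  - intros x s V v b r r'.
    assert (r1 : fm_R (rep_arr Q ∘ (n ∘ v)) b).
    { rewrite comp_assoc, n1; now rewrite comp_idl in r'. }
    assert (r2 : fm_R (rep_arr Q' ∘ v) b) by now rewrite comp_idl in r'.
    assert (r3 : fm_R (rep_arr Q' ∘ (m ∘ (n ∘ v))) b)
      by now rewrite comp_assoc, m1.
    rewrite (sec_eq _ s s r r3 (eq_sym (comp_assoc _ _ _)) eq_refl).
    rewrite (m2 _ _ _ _ _ r1), (n2 _ _ _ _ _ r2).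
    apply sec_eq; [now rewrite comp_idl | reflexivity].
Qed.

Definition cosieve (S : J -> Prop) : Prop :=
  forall (x y : J) (h : Hom x y), S x -> S y.

(** * Adding one object to a cosieve *)

Section Extend.

Variables (S : J -> Prop) (x0 : J).
Hypothesis S_cosieve : cosieve S.
Hypothesis S_x0 : ~ S x0.
Hypothesis S_boundary : forall y (h : Hom x0 y), deg y < deg x0 -> S y.

(** No map leads from [S] to [x0], because [S] is a cosieve without [x0]. A map out of [x0] is an
    identity or lowers the degree and ends in [S], so [z3] is the only compatibility left to
    assume. *)
Lemma sec_ext (U : C) (a : Hom U A) (z : Sec S a)
  (z0 : forall (V : C) (v : Hom V U) (b : Hom V (fm_D B x0)),
     fm_R (a ∘ v) b -> Hom V (Z x0)) :
  (forall V (v : Hom V U) (b : Hom V (fm_D B x0)) (r : fm_R (a ∘ v) b),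
     k x0 ∘ z0 V v b r = fm_y B x0 ∘ b) ->
  (forall V V' (t : Hom V' V) (v : Hom V U) (b : Hom V (fm_D B x0))
     (r : fm_R (a ∘ v) b) (r' : fm_R (a ∘ (v ∘ t)) (b ∘ t)),
     z0 V' _ _ r' = z0 V _ _ r ∘ t) ->
  (forall V (v : Hom V U) (b : Hom V (fm_D B x0)) (r : fm_R (a ∘ v) b)
     y (h : Hom x0 y) (s : S y) (r' : fm_R (a ∘ v) (fmap (fm_D B) h ∘ b)),
     deg y < deg x0 -> fmap Z h ∘ z0 V v b r = z y s V v _ r') ->
  {z' : Sec (fun x => S x \/ x = x0) a |
    (forall x s s' V v b r, z' x s V v b r = z x s' V v b r) /\
    (forall s V v b r, z' x0 s V v b r = z0 V v b r)}.
Proof.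
  intros z1 z2 z3.
  destruct (@ext_family J S x0 (fun x => forall (V : C) (v : Hom V U)
    (b : Hom V (fm_D B x)), fm_R (a ∘ v) b -> Hom V (Z x)) z z0 S_x0)
    as [psi [p1 p2]].
  unshelve eexists.
  - refine {| sec := psi |}.
    + intros x s V v b r; destruct s as [s|e].
      * rewrite (p1 x _ s); apply sec_over.
      * subst x; rewrite p2; apply z1.
    + intros x s V V' t v b r r'; destruct s as [s|e].
      * rewrite !(p1 x _ s); apply sec_res.
      * subst x; rewrite p2; apply z2.
    + intros x y h s s' V v b r r'; destruct s as [s|e].
      * rewrite (p1 x _ s), (p1 y _ (S_cosieve h s)); apply sec_act.
      * subst x; rewrite p2; revert s' r'; pattern y, h; revert y h.
        apply inverse_hom_case.
        -- intros s' r'; rewrite p2; revert r'; rewrite !fmap_id, !comp_idl.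
           intros r'; f_equal; apply proof_irrelevance.
        -- intros y h l s' r'; rewrite (p1 y _ (S_boundary h l)).
           symmetry; now apply z3.
  - simpl; split.
    + intros; now rewrite (p1 _ _ s').
    + intros; now rewrite p2.
Qed.

Variable Q : Rep S.

(** The generic section over [S] dictates the boundary at [x0]: along [h] it is the value at [y] on
    the image of [b] under [h]. *)
Definition ext_data : StepData deg k x0 (rep_ob Q).
Proof.
  refine {| sd_D := fm_D B x0; sd_R := pull_rel (rep_arr Q) (@fm_R _ B x0);
            sd_y := fm_y B x0;
            sd_bd := fun y h l V v b r => rep_sec Q y (S_boundary h l) V v
              (fmap (fm_D B) h ∘ b) (fm_R_act h r) |}.
  - intros V V' t v b; unfold pull_rel; rewrite comp_assoc; apply fm_R_res.
  - intros y h l V v b r; rewrite sec_over, !comp_assoc.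
    f_equal; symmetry; apply naturality.
  - intros y h l V V' t v b r r'.
    assert (r'' : fm_R (rep_arr Q ∘ (v ∘ t)) (fmap (fm_D B) h ∘ b ∘ t))
      by (rewrite <- comp_assoc; now apply fm_R_act).
    rewrite <- (sec_res _ _ (fm_R_act h r) r'').
    apply sec_eq; [reflexivity | apply comp_assoc].
  - intros y y' h h' l l' V v b r.
    assert (r'' : fm_R (rep_arr Q ∘ v) (fmap (fm_D B) h' ∘ (fmap (fm_D B) h ∘ b)))
      by now apply fm_R_act, fm_R_act.
    rewrite <- (sec_act _ (S_boundary h l) (S_boundary (h' ∘ h) l') (fm_R_act h r) r'').
    apply sec_eq; [reflexivity|]; now rewrite fmap_comp, comp_assoc.
Defined.

Variable Q0 : Step ext_data.

Lemma ext_R (V : C) (v : Hom V (st_ob Q0)) (b : Hom V (fm_D B x0)) :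
  fm_R (rep_arr Q ∘ st_arr Q0 ∘ v) b -> sd_R (s := ext_data) (st_arr Q0 ∘ v) b.
Proof. simpl; unfold pull_rel; now rewrite comp_assoc. Qed.

Lemma ext_section_exists : {z' : Sec (fun x => S x \/ x = x0) (rep_arr Q ∘ st_arr Q0) |
    (forall x s s' V v b r, z' x s V v b r = sec_pull (rep_sec Q) (st_arr Q0) x s' V v b r) /\
    (forall s V v b r, z' x0 s V v b r = st_ev Q0 (ext_R r))}.
Proof.
  apply sec_ext.
  - intros; apply (step_over (st_ev_section Q0)).
  - intros; apply (step_res (st_ev_section Q0)).
  - intros V v b r y h s r' l; rewrite (step_bd (st_ev_section Q0) _ h l).
    simpl; apply sec_eq; reflexivity.
Qed.

(** A section on the larger cosieve is its restriction to [S], a map into [rep_ob Q], together with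
    a step section over that map. *)
Definition rep_ext : Rep (fun x => S x \/ x = x0).
Proof.
  refine {| rep_ob := st_ob Q0; rep_arr := rep_arr Q ∘ st_arr Q0;
            rep_sec := proj1_sig ext_section_exists |}.
  - intros U a z; destruct ext_section_exists as [w [w1 w2]]; simpl.
    destruct (rep_univ Q (U := U) (a := a)
      {| sec := fun x s => z x (or_introl s);
         sec_over := fun x s => sec_over z (or_introl s);
         sec_res := fun x s => sec_res z (or_introl s);
         sec_act := fun x y h s s' => @sec_act _ _ _ z x y h (or_introl s) (or_introl s') |})
      as [h [h1 h2]].
    simpl in h2.
    assert (R : forall V (v : Hom V U) b, pull_rel (rep_arr Q) (@fm_R _ B x0) (h ∘ v) b ->
      fm_R (a ∘ v) b).
    { unfold pull_rel; intros V v b; now rewrite comp_assoc, h1. }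
    destruct (@st_univ _ _ _ _ _ _ _ _ _ Q0 U h
      (fun V v b r => z x0 (or_intror eq_refl) V v b (R V v b r))) as [g [g1 g2]].
    + split.
      * intros; apply sec_over.
      * intros; apply sec_res.
      * intros V v b r y l lt; simpl.
        assert (r' : fm_R (a ∘ v) (fmap (fm_D B) l ∘ b)) by now apply fm_R_act, R.
        rewrite <- (sec_act z (or_intror eq_refl) (or_introl (S_boundary l lt)) (R _ _ _ r) r').
        symmetry; apply h2.
    + exists g; split; [now rewrite <- comp_assoc, g1|].
      intros x s V v b r r'; destruct s as [s|e].
      * rewrite (w1 _ _ s); simpl.
        assert (r'' : fm_R (rep_arr Q ∘ (h ∘ v)) b)
          by (rewrite comp_assoc, h1; exact r).
        rewrite <- (h2 _ _ _ _ _ r r''); apply sec_eq; [|reflexivity].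
        now rewrite comp_assoc, g1.
      * subst x; rewrite w2.
        assert (r'' : pull_rel (rep_arr Q) (@fm_R _ B x0) (h ∘ v) b)
          by (unfold pull_rel; rewrite comp_assoc, h1; exact r).
        rewrite (g2 _ _ _ r''); apply sec_eq; reflexivity.
  - intros U h h' e H; destruct ext_section_exists as [w [w1 w2]]; simpl in *.
    apply (@st_uniq _ _ _ _ _ _ _ _ _ Q0).
    + apply (@rep_uniq _ Q); [now rewrite !comp_assoc|].
      intros x s V v b r r'.
      assert (r1 : fm_R (rep_arr Q ∘ st_arr Q0 ∘ (h ∘ v)) b)
        by now rewrite <- !comp_assoc in *.
      assert (r2 : fm_R (rep_arr Q ∘ st_arr Q0 ∘ (h' ∘ v)) b)
        by now rewrite <- !comp_assoc in *.
      pose proof (H x (or_introl s) V v b r1 r2) as H0.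
      rewrite !(w1 _ _ s) in H0; simpl in H0.
      rewrite (sec_eq _ s s r (fm_R_assoc r1) (eq_sym (comp_assoc _ _ _)) eq_refl), H0.
      apply sec_eq; [apply comp_assoc | reflexivity].
    + intros V v b r r'.
      assert (r1 : fm_R (rep_arr Q ∘ st_arr Q0 ∘ (h ∘ v)) b)
        by now rewrite <- comp_assoc.
      assert (r2 : fm_R (rep_arr Q ∘ st_arr Q0 ∘ (h' ∘ v)) b)
        by now rewrite <- comp_assoc.
      pose proof (H x0 (or_intror eq_refl) V v b r1 r2) as H0.
      rewrite !w2 in H0.
      rewrite (st_ev_eq r (ext_R r1) eq_refl eq_refl), H0.
      apply st_ev_eq; reflexivity.
Defined.

Lemma rep_ext_old (x : J) s s' V (v : Hom V (st_ob Q0)) (b : Hom V (fm_D B x))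
  (r : fm_R (rep_arr rep_ext ∘ v) b) (r' : fm_R (rep_arr Q ∘ (st_arr Q0 ∘ v)) b) :
  rep_sec rep_ext x s V v b r = rep_sec Q x s' V _ b r'.
Proof.
  unfold rep_ext; simpl; destruct ext_section_exists as [w [w1 w2]]; simpl.
  rewrite (w1 _ _ s'); simpl; apply sec_eq; reflexivity.
Qed.

Lemma rep_ext_new s V (v : Hom V (st_ob Q0)) (b : Hom V (fm_D B x0))
  (r : fm_R (rep_arr rep_ext ∘ v) b)
  (r' : sd_R (s := ext_data) (st_arr Q0 ∘ v) b) :
  rep_sec rep_ext x0 s V v b r = st_ev Q0 r'.
Proof.
  unfold rep_ext; simpl; destruct ext_section_exists as [w [w1 w2]]; simpl.
  rewrite w2; apply st_ev_eq; reflexivity.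
Qed.

End Extend.

End Reps.

End Sections.

Lemma exists_max_deg (J : Type) (deg : J -> nat) (S : J -> Prop) (l : list J) :
  (exists x, S x) -> (forall x, S x -> In x l) ->
  exists x, S x /\ forall y, S y -> deg y <= deg x.
Proof.
  revert S; induction l as [|a l IH]; intros S [x Sx] H; [destruct (H x Sx)|].
  destruct (classic (exists x, S x /\ x <> a)) as [[x' [Sx' ne]]|n].
  - destruct (IH (fun x => S x /\ x <> a)) as [m [[Sm ma] hm]].
    + now exists x'.
    + intros y [Sy ya]; destruct (H y Sy); [now destruct ya|assumption].
    + destruct (classic (S a /\ deg m < deg a)) as [[Sa lt]|na].
      * exists a; split; [exact Sa|]; intros y Sy.
        destruct (classic (y = a)) as [->|ya]; [lia|].
        specialize (hm y (conj Sy ya)); lia.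
      * exists m; split; [exact Sm|]; intros y Sy.
        destruct (classic (y = a)) as [->|ya]; [|now apply hm].
        destruct (le_lt_dec (deg a) (deg m)); [assumption|]; now destruct na.
  - exists x; split; [exact Sx|]; intros y Sy.
    assert (E : forall z, S z -> z = a)
      by (intros z Sz; apply NNPP; intros ne; apply n; now exists z).
    now rewrite (E y Sy), (E x Sx).
Qed.

(** Removing an element [x0] of maximal degree leaves a cosieve, as a map into [x0] from another
    element would start in higher degree. The list bounds the size of [S] and makes the induction
    end. *)
Lemma cosieve_ind (J : Category) (deg : J -> nat) :
  (forall (x y : J) (h : Hom x y),
     deg y < deg x \/ mk_under h = mk_under (idm x)) ->
  forall P : (J -> Prop) -> Prop,
  P (fun _ => False) ->
  (forall (S : J -> Prop) (x0 : J), cosieve S -> ~ S x0 ->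
     (forall y (h : Hom x0 y), deg y < deg x0 -> S y) ->
     P S -> P (fun x => S x \/ x = x0)) ->
  forall (l : list J) (S : J -> Prop), cosieve S ->
    (forall x, S x -> In x l) -> P S.
Proof.
  intros inv P P0 P1 l.
  remember (length l) as n eqn:en; revert l en.
  induction n as [n IH] using lt_wf_ind; intros l -> S cS hS.
  destruct (classic (exists x, S x)) as [ex|nex].
  - destruct (exists_max_deg deg ex hS) as [x0 [S0 m0]].
    (* Extensionality turns this into an equation of predicates, so that the motive [P] can be
       rewritten along it. *)
    assert (E : S = (fun x => (S x /\ x <> x0) \/ x = x0)).
    { apply functional_extensionality; intros x; apply propositional_extensionality.
      split; [|now intros [[s _]| ->]].
      intros s; destruct (classic (x = x0)); [now right|now left]. }
    assert (lt : forall x y (h : Hom x y), S x -> y <> x -> deg y < deg x).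
    { intros x y h s ne; destruct (inv _ _ h) as [l'|e]; [exact l'|].
      now apply (f_equal (@under_cod _ _)) in e. }
    rewrite E; apply P1.
    + intros x y h [s ne]; split; [now apply (cS _ _ h)|].
      intros ->; pose proof (lt _ _ h s (fun e => ne (eq_sym e))).
      specialize (m0 x s); lia.
    + tauto.
    + intros y h l'; split; [now apply (cS _ _ h)|]; intros ->; lia.
    + pose (dec := fun x y : J => excluded_middle_informative (x = y)).
      refine (IH _ (remove_length_lt dec l x0 (hS x0 S0)) _ eq_refl _ _ _).
      * intros x y h [s ne]; split; [now apply (cS _ _ h)|].
        intros ->; pose proof (lt _ _ h s (fun e => ne (eq_sym e))).
        specialize (m0 x s); lia.
      * intros x [s ne]; apply in_in_remove; auto.
  - replace S with (fun _ : J => False); [exact P0|].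
    apply functional_extensionality; intros x; apply propositional_extensionality.
    split; [tauto|]; intros s; apply nex; now exists x.
Qed.

(** * Existence and restriction of representing objects *)

Section RepTower.

Variables (C J : Category) (deg : J -> nat) (Y Z : Functor J C)
  (k : NatTrans Z Y) (Fib : WideSub C).
Hypothesis J_inverse : forall (x y : J) (h : Hom x y),
  deg y < deg x \/ mk_under h = mk_under (idm x).
Hypothesis C_complete : finitely_complete C.
Hypothesis Fib_pullback : stable_under_pullback Fib.
Hypothesis Fib_pushforward : stable_under_pushforward Fib.

Definition fibrant_fam (A : C) (B : Fam Y A) : Prop :=
  forall x, exists P : Points (@fm_R _ _ _ _ B x), pt_arr P ∈ Fib.

Lemma rep_empty (A : C) (B : Fam Y A) :
  exists Q : Rep k B (fun _ => False), is_iso (rep_arr Q).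
Proof.
  assert (z : Sec k B (fun _ => False) (idm A)).
  { refine {| sec := fun x s => False_rect _ s |}.
    - intros x s; destruct s.
    - intros x s; destruct s.
    - intros x y h s; destruct s. }
  unshelve eexists.
  - refine {| rep_ob := A; rep_arr := idm A; rep_sec := z |}.
    + intros U a w; exists a; split; [apply comp_idl|]; intros x [].
    + intros U h h' e _; now rewrite !comp_idl in e.
  - apply is_iso_id.
Qed.

Section Step.

Variable K : WideSub C.
Hypothesis K_pi : forall (A B E : C) (p : Hom B A) (q : Hom E B),
  p ∈ Fib -> q ∈ K -> exists F : Pi p q, pi_arr F ∈ K.

Lemma ext_step_exists (A : C) (B : Fam Y A) (S : J -> Prop) (x0 : J)
  (S_boundary : forall y (h : Hom x0 y), deg y < deg x0 -> S y) (Q : Rep k B S) :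
  fibrant_fam B -> fillable deg k K x0 ->
  exists Q0 : Step (ext_data S_boundary Q), st_arr Q0 ∈ K.
Proof.
  intros fB fx; destruct (fB x0) as [P hP].
  pose (P' := points_pull (R' := @sd_R _ _ _ _ _ _ _ _ (ext_data S_boundary Q))
    (@fm_R_res _ _ _ _ B x0) (fun V v b => iff_refl _)
    (pbk C_complete (pt_arr P) (rep_arr Q))).
  apply (step_exists (P := P') K_pi fx).
  now apply (Fib_pullback (pbk C_complete (pt_arr P) (rep_arr Q))).
Qed.

Definition restricts (A : C) (B : Fam Y A) (S S' : J -> Prop) (Q : Rep k B S)
  (Q' : Rep k B S') (m : Hom (rep_ob Q') (rep_ob Q)) : Prop :=
  rep_arr Q ∘ m = rep_arr Q' /\
  forall x s s' V (v : Hom V (rep_ob Q')) (b : Hom V (fm_D B x))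
    (r : fm_R (rep_arr Q ∘ (m ∘ v)) b) (r' : fm_R (rep_arr Q' ∘ v) b),
    rep_sec Q x s V _ b r = rep_sec Q' x s' V v b r'.

(** A representing object over the larger cosieve is isomorphic to one made by [rep_ext], and a
    restriction map is unique; hence [m] is the structure map of a step after an isomorphism. *)
Lemma restricts_in (A : C) (B : Fam Y A) (S : J -> Prop) (x0 : J) (Q : Rep k B S)
  (Q' : Rep k B (fun x => S x \/ x = x0)) (m : Hom (rep_ob Q') (rep_ob Q)) :
  contains_isos K -> cosieve S -> ~ S x0 ->
  (forall y (h : Hom x0 y), deg y < deg x0 -> S y) ->
  fibrant_fam B -> fillable deg k K x0 -> restricts m -> m ∈ K.
Proof.
  intros K_isos cS nS bS fB fx [m1 m2].
  destruct (ext_step_exists bS Q fB fx) as [Q0 hQ0].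
  pose (Q1 := rep_ext J_inverse cS nS Q0).
  destruct (rep_iso Q' Q1) as [i [iI [i1 i2]]].
  apply (wide_comp_iso (g := st_arr Q0) (f := i)); auto.
  apply (@rep_uniq _ _ _ _ _ _ _ _ Q).
  - now rewrite comp_assoc, m1.
  - intros x s V v b r r'.
    assert (r1 : fm_R (rep_arr Q ∘ (st_arr Q0 ∘ (i ∘ v))) b)
      by now rewrite (comp_assoc (st_arr Q0)).
    assert (r2 : fm_R (rep_arr Q1 ∘ (i ∘ v)) b)
      by (simpl; now rewrite <- comp_assoc).
    assert (r3 : fm_R (rep_arr Q' ∘ v) b) by now rewrite <- i1, <- comp_assoc.
    rewrite (m2 x s (or_introl s) V v b r' r3).
    rewrite <- (i2 x (or_introl s) V v b r3 r2).
    refine (eq_trans _ (eq_sym (rep_ext_old (or_introl s) s r2 r1))).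
    apply sec_eq; [now rewrite comp_assoc | reflexivity].
Qed.

End Step.

Lemma rep_exists (A : C) (B : Fam Y A) (l : list J) (S : J -> Prop) :
  fibrant_fam B -> (forall x, fillable deg k Fib x) -> cosieve S ->
  (forall x, S x -> In x l) -> exists Q : Rep k B S, rep_arr Q ∈ Fib.
Proof.
  intros fB fx cS hS; revert S cS hS; apply (cosieve_ind J_inverse).
  - destruct (rep_empty B) as [Q iQ]; exists Q.
    now apply fib_contains_isos.
  - intros S x0 cS nS bS [Q hQ].
    destruct (ext_step_exists (fun A B E p q => pi_exists C_complete Fib_pushforward)
      bS Q fB (fx x0)) as [Q0 hQ0].
    exists (rep_ext J_inverse cS nS Q0); simpl; now apply wide_comp.
Qed.

(** * Comparing sections over two base families *)

Section Comparison.

Variable W : WideSub C.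
Hypothesis W_isos : contains_isos W.
Hypothesis W_2of3 : two_out_of_three W.
Hypothesis C_pullbacks : pullbacks_behaved Fib W.
Hypothesis C_pushforwards : pushforwards_behaved Fib W.

Variables (A : C) (B B' : Fam Y A) (phi : NatTrans (fm_D B') (fm_D B)).
Hypothesis y_phi : forall x, fm_y B' x = fm_y B x ∘ phi x.
Hypothesis R_phi : forall x V (v : Hom V A) (b : Hom V (fm_D B' x)),
  fm_R v b -> fm_R v (phi x ∘ b).

Definition compares (S : J -> Prop) (Q : Rep k B S) (Q' : Rep k B' S)
  (m : Hom (rep_ob Q) (rep_ob Q')) : Prop :=
  rep_arr Q' ∘ m = rep_arr Q /\
  forall x s V (v : Hom V (rep_ob Q)) (b : Hom V (fm_D B' x))
    (r : fm_R (rep_arr Q' ∘ (m ∘ v)) b) (r' : fm_R (rep_arr Q ∘ v) (phi x ∘ b)),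
    rep_sec Q' x s V _ b r = rep_sec Q x s V v _ r'.

Hypothesis points_weq : forall x,
  exists (P : Points (@fm_R _ _ _ _ B x)) (P' : Points (@fm_R _ _ _ _ B' x))
    (g : Hom (pt_ob P') (pt_ob P)),
    pt_arr P ∈ Fib /\ pt_arr P' ∈ Fib /\ g ∈ W /\
    pt_arr P ∘ g = pt_arr P' /\ pt_el P ∘ g = phi x ∘ pt_el P'.

(** The comparison factors through the pullback of [st_arr Q0'] along [c]. The first factor compares
    two steps over the same object and is covered by [step_weq]; the second is the pullback of [c]
    along a fibration. *)
Lemma compares_step (S : J -> Prop) (x0 : J) (cS : cosieve S) (nS : ~ S x0)
  (bS : forall y (h : Hom x0 y), deg y < deg x0 -> S y)
  (Q : Rep k B S) (Q' : Rep k B' S) (c : Hom (rep_ob Q) (rep_ob Q'))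
  (Q0 : Step (ext_data bS Q)) (Q0' : Step (ext_data bS Q')) :
  fillable deg k Fib x0 -> compares c -> c ∈ W -> st_arr Q0' ∈ Fib ->
  exists m, compares (Q := rep_ext J_inverse cS nS Q0)
    (Q' := rep_ext J_inverse cS nS Q0') m /\ m ∈ W.
Proof.
  intros fx [c1 c2] cW hQ0'.
  pose (T := ext_data bS Q).
  (* Pulling back along [c] puts both steps over [rep_ob Q], as [step_weq] requires. *)
  pose (T' := sd_pull c (ext_data bS Q')).
  pose (pb := pbk C_complete (st_arr Q0') c).
  pose (Q2 := step_pull pb : Step T').
  assert (R : forall V (v : Hom V (rep_ob Q)) b,
    sd_R (s := T') v b -> sd_R (s := T) v (phi x0 ∘ b)).
  { intros V v b; simpl; unfold pull_rel; rewrite comp_assoc, c1; apply R_phi. }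
  assert (bd : forall y (h : Hom x0 y) l V (v : Hom V (rep_ob Q)) b
    (r' : sd_R (s := T') v b) (r : sd_R (s := T) v (phi x0 ∘ b)),
    sd_bd h l r' = sd_bd h l r).
  { intros y h l V v b r' r; simpl.
    assert (r'' : fm_R (rep_arr Q ∘ v) (phi y ∘ (fmap (fm_D B') h ∘ b))).
    { rewrite comp_assoc, <- naturality, <- comp_assoc; now apply fm_R_act. }
    rewrite (c2 _ _ _ _ _ _ r''); apply sec_eq; [reflexivity|].
    now rewrite !comp_assoc, naturality. }
  destruct (@st_univ _ _ _ _ _ _ _ _ _ Q2 (st_ob Q0) (st_arr Q0)
    (fun V v b r => st_ev Q0 (R _ _ _ r))) as [m [m1 m2]].
  { split.
    - intros; rewrite (step_over (st_ev_section Q0)); simpl.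
      now rewrite y_phi, comp_assoc.
    - intros V V' t v b r r'.
      assert (r'' : sd_R (s := T) (st_arr Q0 ∘ (v ∘ t)) (phi x0 ∘ b ∘ t))
        by (rewrite <- comp_assoc; now apply R).
      rewrite <- (step_res (st_ev_section Q0) _ r''); apply st_ev_eq;
        [reflexivity | apply comp_assoc].
    - intros V v b r y h l; rewrite (step_bd (st_ev_section Q0) _ h l).
      symmetry; apply bd. }
  assert (mW : m ∈ W).
  { destruct (points_weq x0) as [P [P' [g [hP [hP' [gW [g1 g2]]]]]]].
    pose (g' := exist _ g g1 : Hom (mk_over (pt_arr P') : Slice A) (mk_over (pt_arr P))).
    pose (pP := pbk C_complete (pt_arr P) (rep_arr Q)
      : Pullback (over_arr (mk_over (pt_arr P))) (rep_arr Q)).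
    pose (pP' := pbk C_complete (pt_arr P') (rep_arr Q)
      : Pullback (over_arr (mk_over (pt_arr P'))) (rep_arr Q)).
    pose (PT := points_pull (R' := @sd_R _ _ _ _ _ _ _ _ T)
      (@fm_R_res _ _ _ _ B x0) (fun V v b => iff_refl _) pP).
    assert (eR : forall V (v : Hom V (rep_ob Q)) b,
      sd_R (s := T') v b <-> fm_R (f := B') (x := x0) (rep_arr Q ∘ v) b).
    { intros V v b; simpl; unfold pull_rel; now rewrite comp_assoc, c1. }
    pose (PT' := points_pull (R' := @sd_R _ _ _ _ _ _ _ _ T')
      (@fm_R_res _ _ _ _ B' x0) eR pP').
    pose (gp := base_change_map pP' pP g').
    apply (@step_weq _ _ _ _ _ _ Fib W C_complete Fib_pullback Fib_pushforward
      W_isos W_2of3 C_pushforwards x0 (rep_ob Q) T T' (phi x0) R (y_phi x0) bd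
      PT PT' (proj1_sig gp) Q0 Q2 m); auto.
    - now apply (Fib_pullback pP).
    - now apply (Fib_pullback pP').
    - apply (base_change_map_snd pP' pP g').
    - pose proof (base_change_map_fst pP' pP g') as E; fold gp in E.
      change (pt_el P ∘ pb_fst pP ∘ proj1_sig gp = phi x0 ∘ (pt_el P' ∘ pb_fst pP')).
      rewrite <- comp_assoc; refine (eq_trans (f_equal (comp (pt_el P)) E) _).
      simpl; now rewrite comp_assoc, g2, comp_assoc.
    (* [g] is a weak equivalence between fibrations over [A], so it stays one after base change
       along the arbitrary map [rep_arr Q]. *)
    - now apply (proj2 C_pullbacks _ _ _ _ g' (rep_arr Q) pP' pP).
    - intros V v b r r'.
      assert (r0 : sd_R (s := T') (st_arr Q0 ∘ v) b)
        by (rewrite <- m1, <- comp_assoc; exact r').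
      rewrite (m2 _ _ _ r0); apply st_ev_eq; reflexivity. }
  assert (E : st_arr Q0' ∘ (pb_fst pb ∘ m) = c ∘ st_arr Q0).
  { rewrite comp_assoc, (pb_comm pb), <- comp_assoc; f_equal; exact m1. }
  exists (pb_fst pb ∘ m); split; [split|].
  - simpl; rewrite <- comp_assoc; refine (eq_trans (f_equal (comp _) E) _).
    now rewrite comp_assoc, c1.
  - assert (e : forall V (v : Hom V (st_ob Q0)),
      st_arr Q0' ∘ (pb_fst pb ∘ m ∘ v) = c ∘ (st_arr Q0 ∘ v)).
    { intros V v; rewrite (comp_assoc (st_arr Q0')), E; symmetry; apply comp_assoc. }
    intros x s V v b r r'.
    destruct (classic (S x)) as [s'|n].
    + assert (r1 : fm_R (rep_arr Q' ∘ (st_arr Q0' ∘ (pb_fst pb ∘ m ∘ v))) b)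
        by (rewrite comp_assoc; exact r).
      assert (r2 : fm_R (rep_arr Q ∘ (st_arr Q0 ∘ v)) (phi x ∘ b))
        by (rewrite comp_assoc; exact r').
      rewrite (rep_ext_old s s' r r1).
      rewrite (rep_ext_old s s' r' r2).
      assert (r3 : fm_R (rep_arr Q' ∘ (c ∘ (st_arr Q0 ∘ v))) b)
        by now rewrite <- e.
      rewrite <- (c2 _ s' _ _ _ r3 r2); apply sec_eq; [apply e | reflexivity].
    + destruct s as [s| ->]; [contradiction|].
      assert (r1 : sd_R (s := ext_data bS Q') (st_arr Q0' ∘ (pb_fst pb ∘ m ∘ v)) b)
        by (simpl; unfold pull_rel; rewrite comp_assoc; exact r).
      assert (r2 : sd_R (s := T) (st_arr Q0 ∘ v) (phi x0 ∘ b))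
        by (simpl; unfold pull_rel; rewrite comp_assoc; exact r').
      rewrite (rep_ext_new (or_intror eq_refl) r r1).
      rewrite (rep_ext_new (or_intror eq_refl) r' r2).
      assert (r3 : sd_R (s := T') (st_arr Q0 ∘ v) b).
      { simpl; unfold pull_rel; rewrite <- e; exact r1. }
      assert (r4 : sd_R (s := T') (st_arr Q2 ∘ (m ∘ v)) b).
      { now rewrite comp_assoc, m1. }
      transitivity (st_ev Q0 (R _ _ _ r3)); [|apply st_ev_eq; reflexivity].
      rewrite <- (m2 V v b r3 r4); simpl.
      apply st_ev_eq; [now rewrite comp_assoc | reflexivity].
  - apply wide_comp; [|exact mW].
    now apply (proj1 C_pullbacks _ _ _ _ _ (pullback_sym pb)).
Qed.

(** A representing object over a cosieve need not be built from one over a smaller cosieve, so the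
    induction only produces some pair with a comparison in [W]. Uniqueness of comparisons transfers
    this to the given [m]. *)
Lemma compares_weq (l : list J) (S : J -> Prop) (Q : Rep k B S) (Q' : Rep k B' S)
  (m : Hom (rep_ob Q) (rep_ob Q')) :
  (forall x, fillable deg k Fib x) -> cosieve S -> (forall x, S x -> In x l) ->
  compares m -> m ∈ W.
Proof.
  intros fx cS hS [m1 m2].
  assert (H : exists (Q : Rep k B S) (Q' : Rep k B' S) m,
    compares (Q := Q) (Q' := Q') m /\ m ∈ W).
  { clear Q Q' m m1 m2; revert S cS hS; apply (cosieve_ind J_inverse).
    - destruct (rep_empty B) as [Q iQ], (rep_empty B') as [Q' [g [g1 g2]]].
      exists Q, Q', (g ∘ rep_arr Q); split; [split|].
      + now rewrite comp_assoc, g2, comp_idl.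
      + intros x [].
      + apply wide_comp; auto; apply W_isos; now exists (rep_arr Q').
    - intros S x0 cS nS bS [Q [Q' [c [hc cW]]]].
      assert (fB : fibrant_fam B).
      { intros x; destruct (points_weq x) as [P [P' [g [hP _]]]]; now exists P. }
      assert (fB' : fibrant_fam B').
      { intros x; destruct (points_weq x) as [P [P' [g [_ [hP' _]]]]]; now exists P'. }
      destruct (ext_step_exists (fun A B E p q => pi_exists C_complete Fib_pushforward)
        bS Q fB (fx x0)) as [Q0 hQ0].
      destruct (ext_step_exists (fun A B E p q => pi_exists C_complete Fib_pushforward)
        bS Q' fB' (fx x0)) as [Q0' hQ0'].
      exists (rep_ext J_inverse cS nS Q0), (rep_ext J_inverse cS nS Q0').
      now apply (compares_step cS nS (c := c)). }
  destruct H as [Q1 [Q1' [n [[n1 n2] nW]]]].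
  destruct (rep_iso Q Q1) as [i [iI [i1 i2]]].
  destruct (rep_iso Q' Q1') as [j [jI [j1 j2]]].
  assert (e : j ∘ m = n ∘ i).
  { apply (@rep_uniq _ _ _ _ _ _ _ _ Q1').
    - now rewrite !comp_assoc, j1, m1, n1, i1.
    - intros x s V v b r r'.
      assert (r1 : fm_R (rep_arr Q' ∘ (m ∘ v)) b).
      { revert r; now rewrite !comp_assoc, j1. }
      assert (r2 : fm_R (rep_arr Q ∘ v) (phi x ∘ b)).
      { apply R_phi; revert r1; now rewrite comp_assoc, m1. }
      assert (r3 : fm_R (rep_arr Q1 ∘ (i ∘ v)) (phi x ∘ b))
        by now rewrite comp_assoc, i1.
      assert (r4 : fm_R (rep_arr Q1' ∘ (n ∘ (i ∘ v))) b)
        by now rewrite (comp_assoc n).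
      assert (r5 : fm_R (rep_arr Q1' ∘ (j ∘ (m ∘ v))) b)
        by now rewrite (comp_assoc j).
      rewrite (sec_eq _ s s r r5 (eq_sym (comp_assoc _ _ _)) eq_refl).
      rewrite (sec_eq _ s s r' r4 (eq_sym (comp_assoc _ _ _)) eq_refl).
      rewrite (j2 _ _ _ _ _ r1), (m2 _ _ _ _ _ _ r2), (n2 _ _ _ _ _ _ r3).
      symmetry; apply i2. }
  apply (proj2 (W_2of3 j m)); [auto|].
  rewrite e; apply wide_comp; auto.
Qed.

End Comparison.

End RepTower.

(** * Reedy fibrations by generalized elements *)

Lemma finite_injection (A B : Type) (f : A -> B) :
  (forall a a', f a = f a' -> a = a') -> Finite B -> Finite A.
Proof.
  intros inj [l hl].
  exists (flat_map (fun b => match excluded_middle_informative (exists a, f a = b) with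
    | left e => proj1_sig (constructive_indefinite_description _ e) :: nil
    | right _ => nil end) l).
  intros a; apply in_flat_map; exists (f a); split; [apply hl|].
  destruct (excluded_middle_informative _) as [e|n].
  - left; destruct (constructive_indefinite_description _ e) as [a' ea']; simpl.
    now apply inj.
  - destruct n; now exists a.
Qed.

Lemma finite_prod (A B : Type) : Finite A -> Finite B -> Finite (A * B).
Proof.
  intros [l hl] [l' hl']; exists (list_prod l l'); intros [a b].
  now apply in_prod.
Qed.

Definition total_hom (I : Category) : Type := {i : I & {j : I & Hom i j}}.

Definition to_total (I : Category) (i j : I) (f : Hom i j) : total_hom I :=
  existT (fun i : I => {j : I & Hom i j}) i (existT (fun j : I => Hom i j) j f).

Lemma under_total_inj (I : Category) (i : I) (x y : Under i) :
  to_total (under_arr x) = to_total (under_arr y) -> x = y.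
Proof.
  destruct x as [j f], y as [l g]; simpl; intros e.
  apply inj_pair2 in e.
  exact (f_equal (fun u : {j : I & Hom i j} => mk_under (projT2 u)) e).
Qed.

Lemma coslice_finite (I : Category) (i : I) :
  finite_category I -> Finite (Coslice i).
Proof.
  intros [_ F]; apply (finite_injection (f := fun x : Under i => to_total (under_arr x)));
    [apply under_total_inj | exact F].
Qed.

(** The target of a morphism of the boundary is forced to be the composite of its source with the
    underlying map, so these two arrows of I determine it. *)
Lemma boundary_hom_inj (I : Category) (i : I) (m m' : total_hom (Boundary i)) :
  to_total (under_arr (proj1_sig (projT1 m))) =
    to_total (under_arr (proj1_sig (projT1 m'))) ->
  to_total (proj1_sig (projT2 (projT2 m))) =
    to_total (proj1_sig (projT2 (projT2 m'))) ->
  m = m'.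
Proof.
  intros e1 e2.
  destruct m as [[x hx] [[[b g] hy] h]], m' as [[x' hx'] [[[b' g'] hy'] h']].
  simpl in *; apply under_total_inj in e1; subst x'.
  rewrite (proof_irrelevance _ hx' hx); clear hx'.
  destruct x as [a f], h as [h e], h' as [h' e']; simpl in *; subst g g'.
  apply (under_total_inj (x := mk_under h) (y := mk_under h')) in e2.
  (* [F] rebuilds the morphism from its source [f] and its underlying map, replacing a nested
     dependent equality by the equation [e2] under [a]. *)
  pose (F := fun (u : Under a) (n : mk_under (under_arr u ∘ f) <> mk_under (idm i)) =>
    existT (fun x : Boundary i => {y : Boundary i & Hom x y})
      (exist _ (mk_under f : Coslice i) hx)
      (existT (fun y : Boundary i => Hom (exist _ (mk_under f : Coslice i) hx : Boundary i) y)
         (exist _ (mk_under (under_arr u ∘ f) : Coslice i) n)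
         (exist _ (under_arr u) eq_refl))).
  assert (G : forall u u' n n', u = u' -> F u n = F u' n')
    by (intros u u' n n' ->; f_equal; apply proof_irrelevance).
  exact (G (mk_under h) (mk_under h') hy hy' e2).
Qed.

Lemma boundary_finite (I : Category) (i : I) :
  finite_category I -> finite_category (Boundary i).
Proof.
  intros F; split.
  - apply (finite_injection (f := fun x : Boundary i => proj1_sig x)).
    + intros [x hx] [y hy]; simpl; intros e; subst y; f_equal; apply proof_irrelevance.
    + now apply coslice_finite.
  - destruct F as [_ F].
    apply (finite_injection (f := fun m : total_hom (Boundary i) =>
      (to_total (under_arr (proj1_sig (projT1 m))),
       to_total (proj1_sig (projT2 (projT2 m)))))).
    + intros m m' e; apply boundary_hom_inj;
        [exact (f_equal fst e) | exact (f_equal snd e)].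
    + now apply finite_prod.
Qed.

(** * From matching objects to fillers, and from I to its coslices *)

Section ReedyFillable.

Variables (I C : Category) (deg : I -> nat) (Y Z : Functor I C)
  (k : NatTrans Z Y) (K : WideSub C).
Hypothesis deg_lt : forall (i j : I) (f : Hom i j), non_identity f -> deg j < deg i.

Lemma lt_non_identity (i j : I) (f : Hom i j) : deg j < deg i -> non_identity f.
Proof.
  intros l e; apply (f_equal (@under_cod _ _)) in e; simpl in e; subst j; lia.
Qed.

Lemma inverse_cases (i j : I) (f : Hom i j) :
  deg j < deg i \/ mk_under f = mk_under (idm i).
Proof.
  destruct (classic (mk_under f = mk_under (idm i))) as [e|n]; [now right|].
  left; now apply deg_lt in n.
Qed.

Lemma inverse_le (i j : I) (f : Hom i j) : deg j <= deg i.
Proof.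
  destruct (inverse_cases f) as [l|e]; [lia|].
  apply (f_equal (@under_cod _ _)) in e; simpl in e; now subst j.
Qed.

Lemma boundary_lt (i : I) (f : Boundary i) : deg (under_cod (proj1_sig f)) < deg i.
Proof. destruct f as [[j f] n]; exact (deg_lt n). Qed.

(** A matching family [z] is a cone, hence a map [u] into the matching object of [Z]; with [b] it
    gives a map into the target of the relative matching map, along which that map is pulled
    back. *)
Lemma Reedy_fillable (i : I) :
  finite_category I -> finitely_complete C -> stable_under_pullback K ->
  Reedy_fibration K k -> fillable deg k K i.
Proof.
  intros I_fin C_complete K_pb kR U b z [z1 z2].
  destruct (C_complete _ (boundary_finite i I_fin) (boundary_diagram Z i)) as [MZ].
  destruct (C_complete _ (boundary_finite i I_fin) (boundary_diagram Y i)) as [MY].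
  pose (P := pbk C_complete (matching_map MY) (matching_ob_map k MZ MY)).
  unshelve epose (c := {| apex := U;
    leg := fun f : Boundary i => z (under_cod (proj1_sig f)) (under_arr (proj1_sig f))
       (boundary_lt f)
       : Hom U (boundary_diagram Z i f) |} : Cone (boundary_diagram Z i)).
  { intros [[x f] hx] [[y g] hy] [h e]; simpl in *; subst g; symmetry; apply z2. }
  assert (hu : exists u : Hom U (apex MZ), forall f : Boundary i, leg MZ f ∘ u =
    z (under_cod (proj1_sig f)) (under_arr (proj1_sig f)) (boundary_lt f))
    by (exists (lim_lift MZ c); exact (lim_lift_leg MZ c)).
  destruct hu as [u u_leg]; clear c.
  assert (eu : matching_map MY ∘ b = matching_ob_map k MZ MY ∘ u).
  { apply (lim_uniq (l := MY)); intros f.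
    rewrite !comp_assoc.
    refine (eq_trans (f_equal (fun h => h ∘ b) (lim_lift_leg MY (matching_cone Y i) f)) _).
    refine (eq_trans _ (eq_sym (f_equal (fun h => h ∘ u) (lim_lift_leg MY
       (cone_push (whisker k (boundary_proj i)) MZ) f)))).
    simpl; rewrite <- comp_assoc; refine (eq_trans _ (eq_sym (f_equal (comp _) (u_leg f)))).
    symmetry; apply z1. }
  pose (w := pb_lift P eu).
  pose (r := relative_matching_map P).
  assert (r1 : pb_fst P ∘ r = k i) by apply pb_lift_fst.
  assert (r2 : pb_snd P ∘ r = matching_map MZ) by apply pb_lift_snd.
  assert (r3 : forall f : Boundary i, leg MZ f ∘ matching_map MZ =
    fmap Z (under_arr (proj1_sig f))) by exact (lim_lift_leg MZ (matching_cone Z i)).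
  pose (Q := pbk C_complete r w).
  unshelve eexists.
  - refine {| fl_ob := pb_ob Q; fl_arr := pb_snd Q; fl_el := pb_fst Q |}.
    + rewrite <- r1, <- comp_assoc, (pb_comm Q), comp_assoc; unfold w.
      now rewrite pb_lift_fst.
    + intros y h l.
      pose (f := exist _ (mk_under h) (lt_non_identity (f := h) l) : Boundary i).
      transitivity (leg MZ f ∘ matching_map MZ ∘ pb_fst Q); [now rewrite r3|].
      rewrite <- r2, <- !comp_assoc, (pb_comm Q), (comp_assoc (pb_snd P)).
      unfold w; rewrite pb_lift_snd, comp_assoc.
      refine (eq_trans (f_equal (fun h => h ∘ _) (u_leg f)) _); simpl.
      do 2 f_equal; apply proof_irrelevance.
    + intros V v t t1 t2.
      assert (e : r ∘ t = w ∘ v).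
      { apply pb_uniq; rewrite !comp_assoc; unfold w.
        - now rewrite r1, pb_lift_fst.
        - rewrite r2, pb_lift_snd; apply (lim_uniq (l := MZ)); intros f.
          rewrite !comp_assoc, r3.
          refine (eq_trans _ (eq_sym (f_equal (fun h => h ∘ v) (u_leg f)))).
          apply t2. }
      exists (pb_lift Q e); split; [apply pb_lift_snd | apply pb_lift_fst].
    + intros V m m' e e'; now apply pb_uniq.
  - apply (K_pb _ _ _ _ _ Q), kR.
Qed.

Definition coslice_deg (j : I) (x : Coslice j) : nat := deg (under_cod x).

Lemma coslice_inverse (j : I) (x y : Coslice j) (h : Hom x y) :
  coslice_deg y < coslice_deg x \/ mk_under h = mk_under (idm x).
Proof.
  destruct x as [a f], y as [b g], h as [h e]; simpl in h, e; unfold coslice_deg; simpl.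
  destruct (inverse_cases h) as [l|e']; [now left|right].
  (* [g] is propositionally [h ∘ f]; generalizing it lets [e'] replace [h] and its codomain at
     once. *)
  revert g e.
  change (forall g (e : under_arr (mk_under h) ∘ f = g),
    mk_under (exist _ (under_arr (mk_under h)) e :
      @Hom (Coslice j) (mk_under f) (mk_under g)) = mk_under (idm (mk_under f : Coslice j))).
  rewrite e'; simpl; intros g e.
  assert (eg : f = g) by (rewrite <- e; symmetry; apply comp_idl).
  revert e; destruct eg; intros e.
  f_equal; apply (under_hom_eq (x := mk_under f) (y := mk_under f)); reflexivity.
Qed.

(** Every map [h] out of [a] lifts uniquely to a map of the coslice out of [f : j -> a], with target
    [h ∘ f], so the matching families at [x] are those at [a]. *)
Lemma coslice_fillable (j : I) (x : Coslice j) :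
  fillable deg k K (under_cod x) ->
  fillable (@coslice_deg j) (whisker k (coslice_proj j)) K x.
Proof.
  destruct x as [a f]; simpl; intros H U b z [z1 z2].
  pose (lift := fun y (h : Hom a y) =>
    exist _ h eq_refl : @Hom (Coslice j) (mk_under f) (mk_under (h ∘ f))).
  destruct (H U b (fun y h l => z (mk_under (h ∘ f)) (lift y h) l)) as [F hF].
  { split.
    - intros y h l; exact (z1 (mk_under (h ∘ f)) (lift y h) l).
    - intros y y' h h' l l'.
      pose (h2 := exist _ h' (comp_assoc _ _ _)
        : @Hom (Coslice j) (mk_under (h ∘ f)) (mk_under (h' ∘ h ∘ f))).
      refine (eq_trans _ (z2 _ _ (lift _ h) h2 l l')).
      f_equal; apply under_hom_eq; reflexivity. }
  unshelve eexists.
  - refine {| fl_ob := fl_ob F; fl_arr := fl_arr F;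
      fl_el := fl_el F : Hom _ (functor_comp Z (coslice_proj j) (mk_under f)) |}.
    + apply (fl_over F).
    + intros [y g] [h e] l; simpl in *; subst g.
      exact (fl_bd F h l).
    + intros V v t t1 t2; apply (fl_univ F t1).
      intros y h l; exact (t2 _ (lift y h) l).
    + intros; now apply (@fl_uniq _ _ _ _ _ _ _ _ _ _ F).
  - exact hF.
Qed.

End ReedyFillable.

(** * Pushforwards of diagrams *)

Section Levelwise.

Variables (I C : Category) (deg : I -> nat) (Fib : WideSub C).
Hypothesis deg_lt : forall (i j : I) (f : Hom i j), non_identity f -> deg j < deg i.
Hypothesis I_finite : finite_category I.
Hypothesis C_complete : finitely_complete C.
Hypothesis Fib_pullback : stable_under_pullback Fib.
Hypothesis Fib_pushforward : stable_under_pushforward Fib.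

(* p is its own pushforward along the identity of X, so [rep_exists] applies. *)
Lemma fillable_levelwise (X Y : Functor I C) (p : NatTrans Y X) (i : I) :
  (forall j, fillable deg p Fib j) -> p i ∈ Fib.
Proof.
  intros fp.
  pose (X' := functor_comp X (coslice_proj i)).
  (* Over [v] this family has a single element at each [x], so its sections are compatible families
     of lifts to [Y]. They are represented by [Y i], since [idm i] is initial in the coslice. *)
  unshelve epose (B := {| fm_D := X'; fm_y := nat_id X';
    fm_R := fun x V (v : Hom V (X i)) b => b = fmap X (under_arr x) ∘ v |}
    : Fam X' (X i)).
  { intros x V V' t v b ->; symmetry; apply comp_assoc. }
  { intros x y h V v b ->; simpl; rewrite comp_assoc, <- fmap_comp.
    now rewrite (proj2_sig h). }
  assert (fB : fibrant_fam Fib B).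
  { intros x; unshelve eexists.
    - unshelve refine {| pt_ob := X i; pt_arr := idm (X i);
        pt_el := fmap X (under_arr x) : Hom (X i) (fm_D B x);
        pt_lift := fun V v b r => v |}.
      + simpl; now rewrite comp_idr.
      + intros; apply comp_idl.
      + intros V v b r; symmetry; exact r.
      + intros V m m' e _; now rewrite !comp_idl in e.
    - apply wide_id. }
  destruct (coslice_finite i I_finite) as [l hl].
  destruct (@rep_exists C (Coslice i) (@coslice_deg I deg i) X'
    (functor_comp Y (coslice_proj i)) (whisker p (coslice_proj i)) Fib
    (@coslice_inverse _ _ deg_lt i) C_complete Fib_pullback Fib_pushforward (X i) B l
    (fun _ => True) fB) as [Q hQ].
  { intros x; apply coslice_fillable, fp. }
  { intros x y h _; exact Logic.I. }
  { intros x _; apply hl. }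
  assert (R : forall (x : Coslice i) V (v : Hom V (Y i)) (b : Hom V (fm_D B x)),
    fm_R (p i ∘ v) b -> p (under_cod x) ∘ (fmap Y (under_arr x) ∘ v) = b).
  { intros x V v b r; simpl in r.
    now rewrite r, !comp_assoc, naturality. }
  pose (s := fun (x : Coslice i) (_ : True) V (v : Hom V (Y i)) (b : Hom V (fm_D B x))
    (_ : fm_R (p i ∘ v) b) => fmap Y (under_arr x) ∘ v
    : Hom V (functor_comp Y (coslice_proj i) x)).
  unshelve epose (z := {| sec := s |}
    : Sec (whisker p (coslice_proj i)) B (fun _ => True) (p i)).
  { intros x [] V v b r; unfold s; simpl; rewrite (R x V v b r); symmetry; apply comp_idl. }
  { intros; apply comp_assoc. }
  { intros x y h [] [] V v b r r'; unfold s; simpl.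
    now rewrite comp_assoc, <- fmap_comp, (proj2_sig h). }
  unshelve epose (QY := {| rep_ob := Y i; rep_arr := p i; rep_sec := z |}
    : Rep (whisker p (coslice_proj i)) B (fun _ => True)).
  - intros U a w.
    assert (r0 : fm_R (f := B) (x := mk_under (idm i)) (a ∘ idm U) a)
      by (simpl; now rewrite fmap_id, comp_idl, comp_idr).
    exists (w (mk_under (idm i)) Logic.I U (idm U) a r0); split.
    + refine (eq_trans (sec_over w Logic.I r0) _); apply comp_idl.
    + intros x [] V v b r r'.
      assert (r1 : fm_R (f := B) (x := mk_under (idm i)) (a ∘ v) (a ∘ v))
        by (simpl; now rewrite fmap_id, comp_idl).
      assert (r2 : fm_R (f := B) (x := mk_under (idm i)) (a ∘ (idm U ∘ v)) (a ∘ v))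
        by (now rewrite comp_idl).
      pose (h := exist _ (under_arr x) (comp_idr _)
        : @Hom (Coslice i) (mk_under (idm i)) x).
      assert (r3 : fm_R (a ∘ v) (fmap (fm_D B) h ∘ (a ∘ v))) by now apply fm_R_act.
      refine (eq_trans (f_equal (comp (fmap Y (under_arr x)))
        (eq_trans (eq_sym (sec_res w Logic.I r0 r2))
          (sec_eq w Logic.I Logic.I r2 r1 (comp_idl v) eq_refl))) _).
      refine (eq_trans (eq_sym (sec_act w Logic.I Logic.I r1 r3)) _).
      apply sec_eq; [reflexivity|]; symmetry; exact r.
  - intros U h h' e H.
    assert (r : fm_R (f := B) (x := mk_under (idm i)) (p i ∘ (h ∘ idm U)) (p i ∘ h))
      by (simpl; now rewrite fmap_id, comp_idl, comp_idr).
    assert (r' : fm_R (f := B) (x := mk_under (idm i)) (p i ∘ (h' ∘ idm U)) (p i ∘ h))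
      by (simpl; now rewrite fmap_id, comp_idl, comp_idr).
    pose proof (H _ Logic.I U (idm U) _ r r') as E; simpl in E; unfold s in E; simpl in E.
    now rewrite fmap_id, !comp_idl, !comp_idr in E.
  - destruct (rep_iso QY Q) as [m [mI [m1 _]]].
    exact (wide_comp_iso (fib_contains_isos Fib_pullback) hQ mI m1).
Qed.

Section PointwisePushforward.

Variables (X Y Z : Functor I C) (p : NatTrans Y X) (k : NatTrans Z Y).

(* The elements over [a] of the value at j of the pushforward of k along p. *)
Record is_family (j : I) (U : C) (a : Hom U (X j))
  (s : forall (l : I) (g : Hom j l) (V : C) (v : Hom V U) (b : Hom V (Y l)),
     p l ∘ b = fmap X g ∘ (a ∘ v) -> Hom V (Z l)) : Prop := {
  family_over : forall l (g : Hom j l) V (v : Hom V U) (b : Hom V (Y l))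
    (e : p l ∘ b = fmap X g ∘ (a ∘ v)), k l ∘ s l g V v b e = b;
  family_res : forall l (g : Hom j l) V V' (t : Hom V' V) (v : Hom V U)
    (b : Hom V (Y l)) (e : p l ∘ b = fmap X g ∘ (a ∘ v))
    (e' : p l ∘ (b ∘ t) = fmap X g ∘ (a ∘ (v ∘ t))),
    s l g V' (v ∘ t) (b ∘ t) e' = s l g V v b e ∘ t;
  family_act : forall l l' (g : Hom j l) (h : Hom l l') V (v : Hom V U)
    (b : Hom V (Y l)) (e : p l ∘ b = fmap X g ∘ (a ∘ v))
    (e' : p l' ∘ (fmap Y h ∘ b) = fmap X (h ∘ g) ∘ (a ∘ v)),
    s l' (h ∘ g) V v (fmap Y h ∘ b) e' = fmap Z h ∘ s l g V v b e
}.

(** The universal property of [Rep] for the whole coslice, restated with arrows [g : j -> l] in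
    place of coslice objects, so that maps of I act by composition. *)
Record Pointwise (j : I) := {
  pw_ob : C;
  pw_arr : Hom pw_ob (X j);
  pw_ev : forall (l : I) (g : Hom j l) (V : C) (v : Hom V pw_ob) (b : Hom V (Y l)),
    p l ∘ b = fmap X g ∘ (pw_arr ∘ v) -> Hom V (Z l);
  pw_family : is_family pw_ev;
  pw_univ : forall (U : C) (a : Hom U (X j))
    (s : forall (l : I) (g : Hom j l) (V : C) (v : Hom V U) (b : Hom V (Y l)),
       p l ∘ b = fmap X g ∘ (a ∘ v) -> Hom V (Z l)),
    is_family s -> exists h : Hom U pw_ob, pw_arr ∘ h = a /\
      forall l g V (v : Hom V U) (b : Hom V (Y l))
        (e : p l ∘ b = fmap X g ∘ (a ∘ v))
        (e' : p l ∘ b = fmap X g ∘ (pw_arr ∘ (h ∘ v))), pw_ev e' = s l g V v b e;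
  pw_uniq : forall (U : C) (h h' : Hom U pw_ob),
    pw_arr ∘ h = pw_arr ∘ h' ->
    (forall l g V (v : Hom V U) (b : Hom V (Y l))
        (e : p l ∘ b = fmap X g ∘ (pw_arr ∘ (h ∘ v)))
        (e' : p l ∘ b = fmap X g ∘ (pw_arr ∘ (h' ∘ v))), pw_ev e = pw_ev e') ->
    h = h'
}.

Arguments pw_ev {_} _ {_ _ _ _ _} _.

Lemma pw_ev_eq (j : I) (Q : Pointwise j) (l : I) (g g' : Hom j l) (V : C)
  (v v' : Hom V (pw_ob Q)) (b b' : Hom V (Y l))
  (e : p l ∘ b = fmap X g ∘ (pw_arr Q ∘ v))
  (e' : p l ∘ b' = fmap X g' ∘ (pw_arr Q ∘ v')) :
  g = g' -> v = v' -> b = b' -> pw_ev Q e = pw_ev Q e'.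
Proof. intros -> -> ->; f_equal; apply proof_irrelevance. Qed.

(** A general [a0] is allowed because the value at [j] is also studied over [X i], after base change
    along [X f]. *)
Definition pb_fam (j : I) (A : C) (a0 : Hom A (X j)) :
  Fam (functor_comp Y (coslice_proj j)) A.
Proof.
  refine {| fm_D := functor_comp Y (coslice_proj j);
    fm_y := nat_id (functor_comp Y (coslice_proj j));
    fm_R := fun x V (v : Hom V A) (b : Hom V (Y (under_cod x))) =>
      p (under_cod x) ∘ b = fmap X (under_arr x) ∘ (a0 ∘ v) |}.
  - intros x V V' t v b e.
    refine (eq_trans (comp_assoc _ _ _) (eq_trans (f_equal (fun z => z ∘ t) e) _)).
    now rewrite <- !comp_assoc.
  - intros x y h V v b e; simpl.
    refine (eq_trans (comp_assoc _ _ _) _).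
    rewrite <- (naturality p (proj1_sig h)).
    refine (eq_trans (eq_sym (comp_assoc _ _ _)) (eq_trans (f_equal (comp _) e) _)).
    rewrite comp_assoc, <- fmap_comp; exact (f_equal (fun h => fmap X h ∘ _) (proj2_sig h)).
Defined.

Definition pb_fam_points (j : I) (A : C) (a0 : Hom A (X j)) (x : Coslice j)
  (P : Pullback (p (under_cod x)) (fmap X (under_arr x) ∘ a0)) :
  Points (@fm_R _ _ _ _ (pb_fam a0) x).
Proof.
  assert (R : forall V (v : Hom V A) b, fm_R (f := pb_fam a0) (x := x) v b ->
    p (under_cod x) ∘ b = fmap X (under_arr x) ∘ a0 ∘ v)
    by (intros V v b e; rewrite <- comp_assoc; exact e).
  refine {| pt_ob := pb_ob P; pt_arr := pb_snd P;
    pt_el := pb_fst P : Hom _ (fm_D (pb_fam a0) x);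
    pt_lift := fun V v b r => pb_lift P (R V v b r) |}.
  - simpl; rewrite comp_assoc; apply pb_comm.
  - intros; apply pb_lift_snd.
  - intros; apply pb_lift_fst.
  - intros; now apply pb_uniq.
Defined.

Lemma pb_fam_fibrant (j : I) (A : C) (a0 : Hom A (X j)) :
  (forall i, p i ∈ Fib) -> fibrant_fam Fib (pb_fam a0).
Proof.
  intros hp x.
  pose (P := pbk C_complete (p (under_cod x)) (fmap X (under_arr x) ∘ a0)).
  exists (pb_fam_points P); now apply (Fib_pullback P).
Qed.

Section SecFamily.

Variables (j : I) (A : C) (a0 : Hom A (X j)) (U : C) (a : Hom U A)
  (a1 : Hom U (X j)) (ea : a0 ∘ a = a1).

(** The equation [ea] serves two situations: [a0] an identity with [a1] equal to [a], and base
    change, where [a1] is [a0 ∘ a]. *)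
Lemma pb_fam_in (l : I) (g : Hom j l) (V : C) (v : Hom V U) (b : Hom V (Y l)) :
  p l ∘ b = fmap X g ∘ (a1 ∘ v) ->
  fm_R (f := pb_fam a0) (x := mk_under g) (a ∘ v) b.
Proof. simpl; now rewrite (comp_assoc a0), ea. Qed.

Lemma pb_fam_out (x : Coslice j) (V : C) (v : Hom V U) (b : Hom V (Y (under_cod x))) :
  fm_R (f := pb_fam a0) (x := x) (a ∘ v) b ->
  p (under_cod x) ∘ b = fmap X (under_arr x) ∘ (a1 ∘ v).
Proof. simpl; now rewrite (comp_assoc a0), ea. Qed.

Definition family_sec (s : forall (l : I) (g : Hom j l) (V : C) (v : Hom V U)
     (b : Hom V (Y l)), p l ∘ b = fmap X g ∘ (a1 ∘ v) -> Hom V (Z l))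
  (hs : is_family s) :
  Sec (whisker k (coslice_proj j)) (pb_fam a0) (fun _ => True) a.
Proof.
  refine (@Build_Sec _ _ _ _ (whisker k (coslice_proj j)) A (pb_fam a0)
    (fun _ => True) U a (fun x _ V v b r =>
    s (under_cod x) (under_arr x) V v b (pb_fam_out r)) _ _ _).
  - intros x _ V v b r; simpl.
    refine (eq_trans (family_over hs _) _); symmetry; apply comp_idl.
  - intros; apply (family_res hs).
  - intros [l g] [l' g'] [h e] _ _ V v b r r'; simpl in *; subst g'.
    apply (family_act hs).
Defined.

Lemma sec_family
  (z : Sec (whisker k (coslice_proj j)) (pb_fam a0) (fun _ => True) a) :
  is_family (a := a1) (fun l g V v b e =>
    z (mk_under g) Logic.I V v b (pb_fam_in e)).
Proof.
  split.
  - intros l g V v b e.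
    refine (eq_trans (sec_over z Logic.I (pb_fam_in e)) _).
    apply comp_idl.
  - intros l g V V' t v b e e'.
    exact (@sec_res _ _ _ _ _ _ _ _ _ _ z (mk_under g) Logic.I V V' t v b
      (pb_fam_in e) (pb_fam_in e')).
  - intros l l' g h V v b e e'.
    exact (@sec_act _ _ _ _ _ _ _ _ _ _ z (mk_under g) (mk_under (h ∘ g))
      (exist _ h eq_refl) Logic.I Logic.I V v b (pb_fam_in e)
      (pb_fam_in e')).
Qed.

End SecFamily.

Lemma pointwise_exists (j : I) :
  (forall i, p i ∈ Fib) -> (forall i, fillable deg k Fib i) ->
  exists Q : Pointwise j, pw_arr Q ∈ Fib.
Proof.
  intros hp fk; destruct (coslice_finite j I_finite) as [l hl].
  destruct (@rep_exists C (Coslice j) (@coslice_deg I deg j) _ _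
    (whisker k (coslice_proj j)) Fib (@coslice_inverse _ _ deg_lt j) C_complete
    Fib_pullback Fib_pushforward (X j) (pb_fam (idm (X j))) l (fun _ => True)
    (pb_fam_fibrant (idm (X j)) hp)) as [Q hQ].
  { intros x; apply coslice_fillable, fk. }
  { intros x y h _; exact Logic.I. }
  { intros x _; apply hl. }
  unshelve eexists.
  - unshelve refine {| pw_ob := rep_ob Q; pw_arr := rep_arr Q;
      pw_ev := fun l g V v b e => rep_sec Q (mk_under g) Logic.I V v b
        (pb_fam_in (comp_idl (rep_arr Q)) e) |}.
    + apply sec_family.
    + intros U a s hs.
      destruct (rep_univ Q (family_sec (comp_idl a) hs)) as [h [h1 h2]].
      exists h; split; [exact h1|].
      intros m g V v b e e'.
      rewrite (h2 (mk_under g) Logic.I V v b (pb_fam_in (comp_idl a) e)).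
      simpl; f_equal; apply proof_irrelevance.
    + intros U h h' e H; apply (@rep_uniq _ _ _ _ _ _ _ _ Q); [exact e|].
      intros [m g] [] V v b r r'.
      pose proof (H m g V v b (pb_fam_out (comp_idl (rep_arr Q)) r)
        (pb_fam_out (comp_idl (rep_arr Q)) r')) as E.
      refine (eq_trans _ (eq_trans E _)); f_equal; apply proof_irrelevance.
  - exact hQ.
Qed.

Lemma pw_pull_rel (j : I) (Q : Pointwise j) (A : C) (a0 : Hom A (X j))
  (P : Pullback (pw_arr Q) a0) (l : I) (g : Hom j l) (V : C) (v : Hom V (pb_ob P))
  (b : Hom V (Y l)) :
  p l ∘ b = fmap X g ∘ (a0 ∘ (pb_snd P ∘ v)) ->
  p l ∘ b = fmap X g ∘ (pw_arr Q ∘ (pb_fst P ∘ v)).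
Proof. now rewrite (comp_assoc a0), <- (pb_comm P), <- comp_assoc. Qed.

(** Elements over [a] after base change are elements over [a0 ∘ a], so the pullback of the value at
    [j] represents the sections over the family based at [a0]. *)
Definition pw_pull (j : I) (Q : Pointwise j) (A : C) (a0 : Hom A (X j))
  (P : Pullback (pw_arr Q) a0) :
  Rep (whisker k (coslice_proj j)) (pb_fam a0) (fun _ => True).
Proof.
  unshelve refine {| rep_ob := pb_ob P; rep_arr := pb_snd P;
    rep_sec := @Build_Sec _ _ _ _ (whisker k (coslice_proj j)) A (pb_fam a0)
      (fun _ => True) _ _ (fun x _ V v b r => pw_ev Q (pw_pull_rel r)) _ _ _ |}.
  - intros x _ V v b r.
    refine (eq_trans (family_over (pw_family Q) _) _); symmetry; apply comp_idl.
  - intros x _ V V' t v b r r'; simpl.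
    assert (e : p (under_cod x) ∘ (b ∘ t) =
      fmap X (under_arr x) ∘ (pw_arr Q ∘ (pb_fst P ∘ v ∘ t)))
      by (rewrite <- (comp_assoc (pb_fst P)); exact (pw_pull_rel r')).
    refine (eq_trans _ (family_res (pw_family Q) (pw_pull_rel r) e)).
    apply pw_ev_eq; [reflexivity | apply comp_assoc | reflexivity].
  - intros [l g] [l' g'] [h e] _ _ V v b r r'; simpl in *; subst g'.
    apply (family_act (pw_family Q)).
  - intros U a z.
    pose proof (sec_family (eq_refl (a0 ∘ a)) z) as hs.
    destruct (pw_univ Q hs) as [h [h1 h2]].
    exists (pb_lift P h1); split; [apply pb_lift_snd|].
    intros [l g] [] V v b r r'; simpl in *.
    assert (e : p l ∘ b = fmap X g ∘ (a0 ∘ a ∘ v)) by now rewrite <- comp_assoc.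
    assert (e' : p l ∘ b = fmap X g ∘ (pw_arr Q ∘ (h ∘ v)))
      by now rewrite (comp_assoc (pw_arr Q)), h1.
    rewrite (pw_ev_eq _ e' eq_refl (pb_lift_eq_fst P h1 v) eq_refl), (h2 _ _ _ _ _ e).
    f_equal; apply proof_irrelevance.
  - intros U h h' e H; apply (@pb_uniq _ _ _ _ _ _ P); [|exact e].
    apply (@pw_uniq _ Q).
    + now rewrite !comp_assoc, (pb_comm P), <- !comp_assoc, e.
    + intros l g V v b r r'; simpl in H.
      assert (r1 : p l ∘ b = fmap X g ∘ (a0 ∘ (pb_snd P ∘ (h ∘ v)))).
      { now rewrite (comp_assoc a0), <- (pb_comm P), <- !comp_assoc,
          (comp_assoc (pb_fst P)). }
      assert (r2 : p l ∘ b = fmap X g ∘ (a0 ∘ (pb_snd P ∘ (h' ∘ v)))).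
      { now rewrite (comp_assoc a0), <- (pb_comm P), <- !comp_assoc,
          (comp_assoc (pb_fst P)). }
      refine (eq_trans _ (eq_trans (H (mk_under g) Logic.I V v b r1 r2) _));
        apply pw_ev_eq; rewrite ?comp_assoc; reflexivity.
Defined.

End PointwisePushforward.

End Levelwise.

Arguments pw_ev {_ _ _ _ _ _ _ _} _ {_ _ _ _ _} _.

(** * Functoriality and universal property of the pointwise values *)

Section DiagramPushforward.

Variables (I C : Category) (X Y Z : Functor I C) (p : NatTrans Y X)
  (k : NatTrans Z Y).
Hypothesis C_complete : finitely_complete C.
Variable Q : forall i : I, Pointwise p k i.

Lemma shift_rel (i j l : I) (f : Hom i j) (g : Hom j l) (U V : C)
  (a : Hom U (X i)) (v : Hom V U) (b : Hom V (Y l)) :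
  p l ∘ b = fmap X g ∘ (fmap X f ∘ a ∘ v) -> p l ∘ b = fmap X (g ∘ f) ∘ (a ∘ v).
Proof. intros ->; now rewrite fmap_comp, !comp_assoc. Qed.

(** This reindexing is the action of [f] on elements; its functoriality comes from associativity in
    I alone. *)
Lemma shift_family (i j : I) (f : Hom i j) (U : C) (a : Hom U (X i))
  (s : forall (l : I) (g : Hom i l) (V : C) (v : Hom V U) (b : Hom V (Y l)),
     p l ∘ b = fmap X g ∘ (a ∘ v) -> Hom V (Z l)) :
  is_family k s ->
  is_family k (a := fmap X f ∘ a)
    (fun l (g : Hom j l) V v b e => s l (g ∘ f) V v b (shift_rel e)).
Proof.
  intros [s1 s2 s3]; split.
  - intros; apply s1.
  - intros; apply s2.
  - intros l l' g h V v b e e'.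
    assert (e2 : p l' ∘ (fmap Y h ∘ b) = fmap X (h ∘ (g ∘ f)) ∘ (a ∘ v))
      by (rewrite (comp_assoc h); exact (shift_rel e')).
    rewrite <- (s3 _ _ _ _ _ _ _ (shift_rel e) e2).
    revert e2; rewrite (comp_assoc h); intros e2; f_equal; apply proof_irrelevance.
Qed.

Lemma pw_map_exists (i j : I) (f : Hom i j) :
  exists m : Hom (pw_ob (Q i)) (pw_ob (Q j)),
    pw_arr (Q j) ∘ m = fmap X f ∘ pw_arr (Q i) /\
    forall l (g : Hom j l) V (v : Hom V (pw_ob (Q i))) (b : Hom V (Y l))
      (e : p l ∘ b = fmap X g ∘ (pw_arr (Q j) ∘ (m ∘ v)))
      (e' : p l ∘ b = fmap X (g ∘ f) ∘ (pw_arr (Q i) ∘ v)),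
      pw_ev (Q j) e = pw_ev (Q i) e'.
Proof.
  destruct (pw_univ (Q j) (shift_family f (pw_family (Q i)))) as [m [m1 m2]].
  exists m; split; [exact m1|].
  intros l g V v b e e'.
  assert (e2 : p l ∘ b = fmap X g ∘ (fmap X f ∘ pw_arr (Q i) ∘ v))
    by now rewrite e', fmap_comp, !comp_assoc.
  rewrite (m2 _ _ _ _ _ e2); apply pw_ev_eq; reflexivity.
Qed.

Definition pw_map (i j : I) (f : Hom i j) : Hom (pw_ob (Q i)) (pw_ob (Q j)) :=
  proj1_sig (constructive_indefinite_description _ (pw_map_exists f)).

Lemma pw_map_arr (i j : I) (f : Hom i j) :
  pw_arr (Q j) ∘ pw_map f = fmap X f ∘ pw_arr (Q i).
Proof.
  unfold pw_map; destruct (constructive_indefinite_description _ _) as [m [m1 m2]].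
  exact m1.
Qed.

Lemma pw_map_ev (i j : I) (f : Hom i j) l (g : Hom j l) V
  (v : Hom V (pw_ob (Q i))) (b : Hom V (Y l))
  (e : p l ∘ b = fmap X g ∘ (pw_arr (Q j) ∘ (pw_map f ∘ v)))
  (e' : p l ∘ b = fmap X (g ∘ f) ∘ (pw_arr (Q i) ∘ v)) :
  pw_ev (Q j) e = pw_ev (Q i) e'.
Proof.
  revert e; unfold pw_map.
  destruct (constructive_indefinite_description _ _) as [m [m1 m2]]; simpl.
  intros e; apply m2.
Qed.

Definition pw_functor : Functor I C.
Proof.
  refine {| fob := fun i => pw_ob (Q i); fmap := pw_map |}.
  - intros i; apply pw_uniq.
    + now rewrite pw_map_arr, fmap_id, comp_idl, comp_idr.
    + intros l g V v b e e'.
      assert (e2 : p l ∘ b = fmap X (g ∘ idm i) ∘ (pw_arr (Q i) ∘ v))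
        by now rewrite comp_idr, e', comp_idl.
      rewrite (pw_map_ev e e2); apply pw_ev_eq;
        [apply comp_idr | now rewrite comp_idl | reflexivity].
  - intros i j l f g; apply pw_uniq.
    + now rewrite pw_map_arr, comp_assoc, pw_map_arr, <- comp_assoc, pw_map_arr,
        comp_assoc, fmap_comp.
    + intros m h V v b e e'.
      assert (e1 : p m ∘ b = fmap X (h ∘ (f ∘ g)) ∘ (pw_arr (Q i) ∘ v)).
      { now rewrite e, (comp_assoc (pw_arr _)), pw_map_arr, (fmap_comp X h),
          !comp_assoc. }
      assert (e2 : p m ∘ b = fmap X h ∘ (pw_arr (Q l) ∘ (pw_map f ∘ (pw_map g ∘ v))))
        by now rewrite e', <- (comp_assoc (pw_map f)).
      assert (e3 : p m ∘ b = fmap X (h ∘ f) ∘ (pw_arr (Q j) ∘ (pw_map g ∘ v))).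
      { now rewrite e2, (comp_assoc (pw_arr _)), pw_map_arr, fmap_comp, !comp_assoc. }
      assert (e4 : p m ∘ b = fmap X (h ∘ f ∘ g) ∘ (pw_arr (Q i) ∘ v))
        by now rewrite <- comp_assoc.
      rewrite (pw_map_ev e e1).
      rewrite (pw_ev_eq e' e2 eq_refl (eq_sym (comp_assoc _ _ _)) eq_refl).
      rewrite (pw_map_ev e2 e3), (pw_map_ev e3 e4).
      apply pw_ev_eq; [apply comp_assoc | reflexivity | reflexivity].
Defined.

Definition pw_nat : NatTrans pw_functor X.
Proof.
  refine {| component := (fun i => pw_arr (Q i)) : forall i, Hom (pw_functor i) (X i) |}.
  intros i j f; symmetry; apply pw_map_arr.
Defined.

Definition pw_over : Slice (X : FunCat I C) :=
  mk_over (pw_nat : @Hom (FunCat I C) pw_functor X).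

(** * Pullbacks of diagrams are computed pointwise *)

Section FunctorPullback.

Variables (T : Functor I C) (a : NatTrans T X)
  (P : @Pullback (FunCat I C) T Y X a p).

Let R i : Pullback (a i) (p i) := pbk C_complete (a i) (p i).

Lemma pointwise_map_eq (i j : I) (f : Hom i j) :
  a j ∘ (fmap T f ∘ pb_fst (R i)) = p j ∘ (fmap Y f ∘ pb_snd (R i)).
Proof.
  now rewrite !comp_assoc, <- !naturality, <- !comp_assoc, (pb_comm (R i)).
Qed.

Definition pointwise_pullback : Functor I C.
Proof.
  refine {| fob := fun i => pb_ob (R i);
            fmap := fun i j f => pb_lift (R j) (pointwise_map_eq f) |}.
  - intros i; apply pb_uniq.
    + now rewrite pb_lift_fst, fmap_id, comp_idl, comp_idr.
    + now rewrite pb_lift_snd, fmap_id, comp_idl, comp_idr.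
  - intros i j l f g; apply pb_uniq.
    + now rewrite pb_lift_fst, pb_lift_eq_fst, <- comp_assoc, pb_lift_fst,
        comp_assoc, fmap_comp.
    + now rewrite pb_lift_snd, pb_lift_eq_snd, <- comp_assoc, pb_lift_snd,
        comp_assoc, fmap_comp.
Defined.

Definition pointwise_fst : NatTrans pointwise_pullback T.
Proof.
  refine {| component := (fun i => pb_fst (R i)) : forall i, Hom (pointwise_pullback i) (T i) |}.
  intros i j f; symmetry; apply pb_lift_fst.
Defined.

Definition pointwise_snd : NatTrans pointwise_pullback Y.
Proof.
  refine {| component := (fun i => pb_snd (R i)) : forall i, Hom (pointwise_pullback i) (Y i) |}.
  intros i j f; symmetry; apply pb_lift_snd.
Defined.

Lemma functor_pullback_comm (i : I) :
  a i ∘ (pb_fst P : NatTrans _ _) i = p i ∘ (pb_snd P : NatTrans _ _) i.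
Proof. exact (f_equal (fun t : NatTrans (pb_ob P) X => t i) (pb_comm P)). Qed.

(** [P] is an arbitrary pullback of diagrams. The pointwise pullback maps to it, which yields the
    required point of its component at [i]. *)
Lemma functor_pullback_lift (i : I) (V : C) (t : Hom V (T i)) (b : Hom V (Y i)) :
  a i ∘ t = p i ∘ b ->
  exists m : Hom V ((pb_ob P : Functor I C) i),
    (pb_fst P : NatTrans _ _) i ∘ m = t /\ (pb_snd P : NatTrans _ _) i ∘ m = b.
Proof.
  intros e.
  assert (E : @comp (FunCat I C) _ _ _ a pointwise_fst =
              @comp (FunCat I C) _ _ _ p pointwise_snd).
  { apply nat_trans_eq; intros j; exact (pb_comm (R j)). }
  pose (u := pb_lift P E : NatTrans pointwise_pullback (pb_ob P)).
  assert (u1 : (pb_fst P : NatTrans _ _) i ∘ u i = pb_fst (R i))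
    by exact (f_equal (fun t : NatTrans pointwise_pullback T => t i) (pb_lift_fst P E)).
  assert (u2 : (pb_snd P : NatTrans _ _) i ∘ u i = pb_snd (R i))
    by exact (f_equal (fun t : NatTrans pointwise_pullback Y => t i) (pb_lift_snd P E)).
  exists (u i ∘ pb_lift (R i) e); rewrite !comp_assoc, u1, u2.
  split; [apply pb_lift_fst | apply pb_lift_snd].
Qed.

Lemma functor_pullback_uniq (i : I) (V : C)
  (m m' : Hom V ((pb_ob P : Functor I C) i)) :
  (pb_fst P : NatTrans _ _) i ∘ m = (pb_fst P : NatTrans _ _) i ∘ m' ->
  (pb_snd P : NatTrans _ _) i ∘ m = (pb_snd P : NatTrans _ _) i ∘ m' -> m = m'.
Proof.
  intros e1 e2.
  assert (E : @comp (FunCat I C) _ _ _ a pointwise_fst =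
              @comp (FunCat I C) _ _ _ p pointwise_snd).
  { apply nat_trans_eq; intros j; exact (pb_comm (R j)). }
  pose (u := pb_lift P E : NatTrans pointwise_pullback (pb_ob P)).
  assert (W : forall j, a j ∘ (pb_fst P : NatTrans _ _) j =
    p j ∘ (pb_snd P : NatTrans _ _) j) by exact functor_pullback_comm.
  unshelve epose (w := {| component := (fun j => pb_lift (R j) (W j))
      : forall j, Hom ((pb_ob P : Functor I C) j) (pointwise_pullback j) |}
    : NatTrans (pb_ob P) pointwise_pullback).
  { intros j l f; apply pb_uniq.
    - simpl; rewrite pb_lift_eq_fst, <- comp_assoc, pb_lift_fst, comp_assoc, pb_lift_fst.
      apply naturality.
    - simpl; rewrite pb_lift_eq_snd, <- comp_assoc, pb_lift_snd, comp_assoc, pb_lift_snd.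
      apply naturality. }
  (* Since [u ∘ w] is the identity, maps into [P] at [i] agree once their images under [w i] in the
     chosen pullback do. *)
  assert (uw : @comp (FunCat I C) _ _ _ u w = idm (pb_ob P)).
  { apply pb_uniq; unfold u; rewrite comp_assoc, ?pb_lift_fst, ?pb_lift_snd, comp_idr;
      apply nat_trans_eq; intros j; [apply pb_lift_fst | apply pb_lift_snd]. }
  assert (uwi : u i ∘ w i = idm _)
    by exact (f_equal (fun t : NatTrans (pb_ob P) (pb_ob P) => t i) uw).
  rewrite <- (comp_idl m), <- (comp_idl m'), <- uwi, <- !comp_assoc; f_equal.
  apply pb_uniq; simpl.
  - now rewrite !pb_lift_eq_fst.
  - now rewrite !pb_lift_eq_snd.
Qed.

End FunctorPullback.

(** * Transposition for diagrams *)

Section Transpose.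

Variables (x : Slice (X : FunCat I C)) (P : Pullback (over_arr x) (p : @Hom (FunCat I C) Y X)).

Let T : Functor I C := over_dom x.
Let a : NatTrans T X := over_arr x.
Let P1 : NatTrans (pb_ob P) T := pb_fst P.
Let P2 : NatTrans (pb_ob P) Y := pb_snd P.

Lemma over_pw_arr (u : Hom x pw_over) (i : I) :
  pw_arr (Q i) ∘ (proj1_sig u : NatTrans T pw_functor) i = a i.
Proof. exact (f_equal (fun t : NatTrans T X => t i) (proj2_sig u)). Qed.

Lemma transpose_component_rel (u : Hom x pw_over)
  (i : I) : p i ∘ P2 i =
    fmap X (idm i) ∘ (pw_arr (Q i) ∘ ((proj1_sig u : NatTrans T pw_functor) i ∘ P1 i)).
Proof.
  rewrite fmap_id, comp_idl, comp_assoc, over_pw_arr.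
  symmetry; apply (functor_pullback_comm P).
Qed.

(** At [i] the family is evaluated at [idm i]. Naturality holds because acting by [f] on that value
    and restricting the family along [f] both give its value at [f]. *)
Definition diagram_transpose (u : Hom x pw_over) :
  Hom (base_change P) (mk_over (k : @Hom (FunCat I C) Z Y)).
Proof.
  unshelve refine (exist _ ({| component := fun i =>
    pw_ev (Q i) (transpose_component_rel u i) |} : NatTrans (pb_ob P) Z) _).
  - intros i j f.
    assert (e : p j ∘ (fmap Y f ∘ P2 i) = fmap X (f ∘ idm i) ∘
      (pw_arr (Q i) ∘ ((proj1_sig u : NatTrans T pw_functor) i ∘ P1 i))).
    { rewrite comp_assoc, <- naturality, <- comp_assoc, (transpose_component_rel u i).
      now rewrite fmap_id, comp_idl, comp_idr. }
    refine (eq_trans (eq_sym (family_act (pw_family (Q i)) (transpose_component_rel u i) e)) _).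
    assert (e2 : p j ∘ (P2 j ∘ fmap (pb_ob P : Functor I C) f) = fmap X (idm j) ∘
      (pw_arr (Q j) ∘ ((proj1_sig u : NatTrans T pw_functor) j ∘ P1 j
        ∘ fmap (pb_ob P : Functor I C) f)))
      by (rewrite comp_assoc, (transpose_component_rel u j), <- !comp_assoc; reflexivity).
    refine (eq_trans _ (family_res (pw_family (Q j)) (transpose_component_rel u j) e2)).
    assert (E : (proj1_sig u : NatTrans T pw_functor) j ∘ P1 j
        ∘ fmap (pb_ob P : Functor I C) f = pw_map f ∘
        ((proj1_sig u : NatTrans T pw_functor) i ∘ P1 i)).
    { rewrite <- comp_assoc, <- naturality, comp_assoc.
      rewrite <- (naturality (proj1_sig u : NatTrans T pw_functor)).
      symmetry; apply comp_assoc. }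
    assert (e3 : p j ∘ (fmap Y f ∘ P2 i) = fmap X (idm j) ∘ (pw_arr (Q j) ∘ (pw_map f ∘
        ((proj1_sig u : NatTrans T pw_functor) i ∘ P1 i)))).
    { rewrite <- E, (naturality P2); exact e2. }
    assert (e4 : p j ∘ (fmap Y f ∘ P2 i) = fmap X (idm j ∘ f) ∘ (pw_arr (Q i) ∘
        ((proj1_sig u : NatTrans T pw_functor) i ∘ P1 i))).
    { rewrite comp_idl; now rewrite comp_idr in e. }
    symmetry; refine (eq_trans (pw_ev_eq e2 e3 eq_refl E (eq_sym (naturality P2 f)))
      (eq_trans (pw_map_ev e3 e4) _)).
    apply pw_ev_eq; [now rewrite comp_idl, comp_idr | reflexivity | reflexivity].
  - apply nat_trans_eq; intros i; apply (family_over (pw_family (Q i))).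
Defined.

(** The inverse sends [v] to the family at [i] whose value at [g] on [(w, b)] is [v l] applied to
    the point of the pullback over [fmap T g ∘ w] and [b]; [lift] supplies that point. *)
Lemma diagram_transpose_bij (v : Hom (base_change P) (mk_over (k : @Hom (FunCat I C) Z Y))) :
  exists! u, diagram_transpose u = v.
Proof.
  destruct v as [v ev]; simpl in v, ev.
  assert (ev' : forall i, k i ∘ (v : NatTrans (pb_ob P) Z) i = P2 i)
    by (intros i; exact (f_equal (fun t : NatTrans (pb_ob P) Y => t i) ev)).
  pose (v' := v : NatTrans (pb_ob P) Z).
  assert (lift : forall i l (g : Hom i l) V (w : Hom V (T i)) (b : Hom V (Y l))
    (e : p l ∘ b = fmap X g ∘ (a i ∘ w)),
    {m : Hom V ((pb_ob P : Functor I C) l) | P1 l ∘ m = fmap T g ∘ w /\ P2 l ∘ m = b}).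
  { intros i l g V w b e; apply constructive_indefinite_description.
    apply (functor_pullback_lift P).
    rewrite e, !comp_assoc; f_equal; symmetry; apply naturality. }
  assert (fam : forall i, is_family k (a := a i)
    (fun l g V w b e => v' l ∘ proj1_sig (lift i l g V w b e))).
  { intros i; split.
    - intros l g V w b e; destruct (lift i l g V w b e) as [m [m1 m2]]; simpl.
      rewrite comp_assoc; refine (eq_trans (f_equal (fun z => z ∘ m) (ev' l)) m2).
    - intros l g V V' t w b e e'.
      destruct (lift i l g V w b e) as [m [m1 m2]].
      destruct (lift i l g V' _ _ e') as [m' [m1' m2']]; simpl.
      rewrite <- comp_assoc; f_equal; apply (functor_pullback_uniq (P := P) (i := l)).
      + refine (eq_trans m1' _); rewrite comp_assoc, <- m1; symmetry; apply comp_assoc.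
      + refine (eq_trans m2' _); rewrite <- m2; symmetry; apply comp_assoc.
    - intros l l' g h V w b e e'.
      destruct (lift i l g V w b e) as [m [m1 m2]].
      destruct (lift i l' _ V _ _ e') as [m' [m1' m2']]; simpl.
      rewrite comp_assoc, (naturality v' h), <- comp_assoc; f_equal.
      apply (functor_pullback_uniq (P := P) (i := l')).
      + refine (eq_trans m1' _).
        rewrite fmap_comp, <- comp_assoc, <- m1, !comp_assoc.
        f_equal; exact (naturality P1 h).
      + refine (eq_trans m2' _); rewrite <- m2, !comp_assoc.
        f_equal; exact (naturality P2 h). }
  pose (h i := constructive_indefinite_description _ (pw_univ (Q i) (fam i))).
  assert (h1 : forall i, pw_arr (Q i) ∘ proj1_sig (h i) = a i)
    by (intros i; exact (proj1 (proj2_sig (h i)))).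
  assert (h2 := fun i => proj2 (proj2_sig (h i))); simpl in h2.
  assert (hnat : forall i j (f : Hom i j),
    pw_map f ∘ proj1_sig (h i) = proj1_sig (h j) ∘ fmap T f).
  { intros i j f; apply pw_uniq.
    - rewrite !comp_assoc, pw_map_arr, h1, <- comp_assoc, h1; apply naturality.
    - intros l g V w b e e'.
      assert (e1 : p l ∘ b = fmap X g ∘ (pw_arr (Q j) ∘ (pw_map f ∘ (proj1_sig (h i) ∘ w))))
        by (rewrite e, <- !comp_assoc; reflexivity).
      assert (e2 : p l ∘ b = fmap X (g ∘ f) ∘ (pw_arr (Q i) ∘ (proj1_sig (h i) ∘ w))).
      { rewrite e1, (comp_assoc (pw_arr _)), pw_map_arr, fmap_comp, !comp_assoc; reflexivity. }
      assert (e3 : p l ∘ b = fmap X g ∘ (pw_arr (Q j) ∘ (proj1_sig (h j) ∘ (fmap T f ∘ w))))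
        by (rewrite e', <- !comp_assoc; reflexivity).
      assert (e4 : p l ∘ b = fmap X (g ∘ f) ∘ (a i ∘ w))
        by (rewrite e2, (comp_assoc (pw_arr _)), h1; reflexivity).
      assert (e5 : p l ∘ b = fmap X g ∘ (a j ∘ (fmap T f ∘ w)))
        by (rewrite e3, (comp_assoc (pw_arr _)), h1; reflexivity).
      rewrite (pw_ev_eq e e1 eq_refl (eq_sym (comp_assoc _ _ _)) eq_refl), (pw_map_ev e1 e2).
      rewrite (pw_ev_eq e' e3 eq_refl (eq_sym (comp_assoc _ _ _)) eq_refl).
      rewrite (h2 _ _ _ _ _ _ e4), (h2 _ _ _ _ _ _ e5); f_equal.
      destruct (lift i l _ V _ _ e4) as [m [m1 m2]].
      destruct (lift j l _ V _ _ e5) as [m' [m1' m2']]; simpl.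
      apply (functor_pullback_uniq (P := P) (i := l)).
      + refine (eq_trans m1 (eq_trans _ (eq_sym m1'))).
        now rewrite fmap_comp, comp_assoc.
      + exact (eq_trans m2 (eq_sym m2')). }
  pose (hn := {| component := (fun i => proj1_sig (h i)) : forall i, Hom (T i) (pw_functor i);
                 naturality := hnat |}).
  assert (hx : @comp (FunCat I C) _ _ _ pw_nat hn = over_arr x)
    by (apply nat_trans_eq; exact h1).
  exists (exist _ hn hx : Hom x pw_over); split.
  - apply over_hom_eq, nat_trans_eq; intros i.
    change (pw_ev (Q i) (transpose_component_rel (exist _ hn hx) i) = v' i).
    assert (e : p i ∘ P2 i = fmap X (idm i) ∘ (a i ∘ P1 i)).
    { rewrite fmap_id, comp_idl; symmetry; apply (functor_pullback_comm P). }
    refine (eq_trans (h2 _ _ _ _ _ _ e _) _).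
    destruct (lift i i _ _ _ _ e) as [m [m1 m2]]; simpl.
    rewrite <- (comp_idr (v' i)) at 2; f_equal.
    apply (functor_pullback_uniq (P := P) (i := i)).
    + refine (eq_trans m1 _); now rewrite fmap_id, comp_idl, comp_idr.
    + refine (eq_trans m2 _); now rewrite comp_idr.
  (* By naturality of [u] the value at [g] is the value at [idm l] of the family restricted along
     [g], and values at identities are prescribed by [v]. *)
  - intros u' eu'; apply over_hom_eq, nat_trans_eq; intros i; simpl.
    pose (u := proj1_sig u' : NatTrans T pw_functor).
    change (proj1_sig (h i) = u i).
    apply pw_uniq.
    + rewrite h1; symmetry; apply (over_pw_arr u').
    + intros l g V w b e e'.
      assert (e1 : p l ∘ b = fmap X g ∘ (a i ∘ w))
        by (rewrite e, (comp_assoc (pw_arr _)), h1; reflexivity).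
      rewrite (h2 _ _ _ _ _ _ e1).
      destruct (lift i l _ _ _ _ e1) as [m [m1 m2]]; simpl.
      assert (E : v' l = pw_ev (Q l) (transpose_component_rel u' l)).
      { apply (f_equal (@proj1_sig _ _)) in eu'.
        exact (f_equal (fun t : NatTrans (pb_ob P) Z => t l) (eq_sym eu')). }
      rewrite E.
      assert (e2 : p l ∘ (P2 l ∘ m) = fmap X (idm l) ∘ (pw_arr (Q l) ∘ (u l ∘ P1 l ∘ m)))
        by (rewrite comp_assoc, (transpose_component_rel u' l), <- !comp_assoc; reflexivity).
      refine (eq_trans (eq_sym (family_res (pw_family (Q l))
        (transpose_component_rel u' l) e2)) _).
      assert (E2 : u l ∘ P1 l ∘ m = pw_map g ∘ (u i ∘ w)).
      { rewrite <- comp_assoc; refine (eq_trans (f_equal (comp (u l)) m1) _).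
        rewrite !comp_assoc; f_equal; symmetry; exact (naturality u g). }
      assert (e3 : p l ∘ b = fmap X (idm l) ∘ (pw_arr (Q l) ∘ (pw_map g ∘ (u i ∘ w)))).
      { rewrite <- E2, <- m2; exact e2. }
      assert (e4 : p l ∘ b = fmap X (idm l ∘ g) ∘ (pw_arr (Q i) ∘ (u i ∘ w)))
        by (rewrite comp_idl; exact e').
      refine (eq_trans (pw_ev_eq e2 e3 eq_refl E2 m2)
        (eq_trans (pw_map_ev e3 e4) _)).
      apply pw_ev_eq; [apply comp_idl | reflexivity | reflexivity].
Qed.

End Transpose.

Definition diagram_pushforward :
  Pushforward (p : @Hom (FunCat I C) Y X) (mk_over (k : @Hom (FunCat I C) Z Y)).
Proof.
  refine (@mk_pushforward (FunCat I C) X Y p (mk_over (k : @Hom (FunCat I C) Z Y))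
    pw_over diagram_transpose
    diagram_transpose_bij _).
  intros x y P R h u; apply over_hom_eq, nat_trans_eq; intros i.
  pose (hR := proj1_sig (base_change_map P R h) : NatTrans (pb_ob P) (pb_ob R)).
  pose (u' := proj1_sig u : NatTrans (over_dom y) pw_functor).
  pose (h' := proj1_sig h : NatTrans (over_dom x) (over_dom y)).
  pose (P1 := pb_fst P : NatTrans (pb_ob P) (over_dom x)).
  pose (P2 := pb_snd P : NatTrans (pb_ob P) Y).
  pose (R1 := pb_fst R : NatTrans (pb_ob R) (over_dom y)).
  pose (R2 := pb_snd R : NatTrans (pb_ob R) Y).
  change (pw_ev (Q i) (transpose_component_rel P (u ∘ h) i) =
          pw_ev (Q i) (transpose_component_rel R u i) ∘ hR i).
  assert (E1 : R1 i ∘ hR i = h' i ∘ P1 i)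
    by exact (f_equal (fun t : NatTrans (pb_ob P) (over_dom y) => t i)
                (base_change_map_fst P R h)).
  assert (E2 : R2 i ∘ hR i = P2 i)
    by exact (f_equal (fun t : NatTrans (pb_ob P) Y => t i) (base_change_map_snd P R h)).
  assert (e : p i ∘ (R2 i ∘ hR i) = fmap X (idm i) ∘ (pw_arr (Q i) ∘ (u' i ∘ R1 i ∘ hR i)))
    by (rewrite comp_assoc; refine (eq_trans (f_equal (fun z => z ∘ hR i)
          (transpose_component_rel R u i)) _); rewrite <- !comp_assoc; reflexivity).
  refine (eq_trans _ (family_res (pw_family (Q i)) _ e)).
  apply pw_ev_eq; [reflexivity | | symmetry; exact E2].
  rewrite <- comp_assoc, E1; symmetry; apply comp_assoc.
Defined.

End DiagramPushforward.

(** * Matching objects of the pushforward *)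

Section Boundaries.

Variables (I C : Category) (deg : I -> nat) (Fib : WideSub C).
Hypothesis deg_lt : forall (i j : I) (f : Hom i j), non_identity f -> deg j < deg i.
Hypothesis C_complete : finitely_complete C.
Hypothesis Fib_pullback : stable_under_pullback Fib.
Variables (X Y Z : Functor I C) (p : NatTrans Y X) (k : NatTrans Z Y).
Hypothesis p_fib : forall i, p i ∈ Fib.
Variable Q : forall i : I, Pointwise p k i.

Definition pw_rep (i : I) :
  Rep (whisker k (coslice_proj i)) (pb_fam p (idm (X i))) (fun _ => True) :=
  pw_pull (pullback_sym (self_pullback (pw_arr (Q i)))).

(** The objects of the coslice other than [idm i], expressed by degree, the form in which extension
    of sections uses a boundary. *)
Definition below (i : I) (x : Coslice i) : Prop := deg (under_cod x) < deg i.

Lemma below_boundary (i : I) (x : Coslice i) :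
  below x -> x <> mk_under (idm i).
Proof. unfold below; intros l ->; simpl in l; lia. Qed.

(** The coslice is its boundary with the one object [idm i] added, so restriction to the boundary is
    a single extension step. *)
Lemma boundary_restriction (K : WideSub C) (i : I)
  (R : Rep (whisker k (coslice_proj i)) (pb_fam p (idm (X i))) (@below i))
  (m : Hom (pw_ob (Q i)) (rep_ob R)) :
  (forall (A B E : C) (p : Hom B A) (q : Hom E B), p ∈ Fib -> q ∈ K ->
     exists F : Pi p q, pi_arr F ∈ K) ->
  contains_isos K -> fillable deg k K i ->
  rep_arr R ∘ m = pw_arr (Q i) ->
  (forall x s V (v : Hom V (pw_ob (Q i))) (b : Hom V (Y (under_cod x)))
     (r : fm_R (f := pb_fam p (idm (X i))) (x := x) (rep_arr R ∘ (m ∘ v)) b)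
     (e : p (under_cod x) ∘ b = fmap X (under_arr x) ∘ (pw_arr (Q i) ∘ v)),
     rep_sec R x s V _ b r = pw_ev (Q i) e) ->
  m ∈ K.
Proof.
  intros K_pi K_isos fk m1 m2.
  (* [pw_rep] is indexed by the predicate [True]; a variable [S'] lets it be replaced by the union
     with [idm i] through extensionality. *)
  assert (H : forall S', S' = (fun x : Coslice i => below x \/ x = mk_under (idm i)) ->
    forall (R' : Rep (whisker k (coslice_proj i)) (pb_fam p (idm (X i))) S')
      (n : Hom (rep_ob R') (rep_ob R)), restricts n -> n ∈ K).
  { intros S' -> R' n hn.
    apply (restricts_in (@coslice_inverse _ _ deg_lt i) C_complete Fib_pullback K_pi
      (Q' := R')); auto.
    - intros x y h l; exact (Nat.le_lt_trans _ _ _ (inverse_le deg_lt (proj1_sig h)) l).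
    - intros l; exact (below_boundary l eq_refl).
    - now apply pb_fam_fibrant.
    - now apply coslice_fillable. }
  apply (H (fun _ => True)) with (R' := pw_rep i).
  - apply functional_extensionality; intros x; apply propositional_extensionality.
    split; [intros _|auto].
    destruct (inverse_cases deg_lt (under_arr x)) as [l|e]; [now left|right].
    now destruct x.
  - split; [exact m1|].
    intros x s s' V v b r r'.
    assert (e : p (under_cod x) ∘ b = fmap X (under_arr x) ∘ (pw_arr (Q i) ∘ v)).
    { simpl in r'; now rewrite comp_idl in r'. }
    refine (eq_trans (m2 x s V v b r e) _); simpl; apply pw_ev_eq; [reflexivity| |reflexivity].
    symmetry; apply comp_idl.
Qed.

Section BoundarySections.

Variables (i : I) (U : C) (a : Hom U (X i))
  (z : Sec (whisker k (coslice_proj i)) (pb_fam p (idm (X i))) (@below i) a).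

Lemma sec_under_eq (l : I) (g g' : Hom i l) s s' V (v v' : Hom V U)
  (b b' : Hom V (Y l)) r r' :
  g = g' -> v = v' -> b = b' ->
  z (mk_under g) s V v b r = z (mk_under g') s' V v' b' r'.
Proof.
  intros -> -> ->; rewrite (proof_irrelevance _ s s'); f_equal; apply proof_irrelevance.
Qed.

Lemma below_comp (c l : I) (f : Hom i c) (g : Hom c l) :
  deg c < deg i -> below (mk_under (g ∘ f) : Coslice i).
Proof. exact (Nat.le_lt_trans _ _ _ (inverse_le deg_lt g)). Qed.

Lemma boundary_rel (c l : I) (f : Hom i c) (g : Hom c l) V (v : Hom V U)
  (b : Hom V (Y l)) :
  p l ∘ b = fmap X g ∘ (fmap X f ∘ a ∘ v) ->
  fm_R (f := pb_fam p (idm (X i))) (x := mk_under (g ∘ f)) (a ∘ v) b.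
Proof. intros e; exact (pb_fam_in (comp_idl a) (shift_rel e)). Qed.

(** Every composite [g ∘ f] stays below [i], so a section on the boundary restricts along [f] to a
    complete family at [c]. *)
Lemma boundary_family (c : I) (f : Hom i c) (lt : deg c < deg i) :
  is_family k (a := fmap X f ∘ a) (fun l (g : Hom c l) V v b e =>
    z (mk_under (g ∘ f)) (below_comp f g lt) V v b (boundary_rel e)).
Proof.
  split.
  - intros l g V v b e.
    refine (eq_trans (sec_over z (below_comp f g lt) (boundary_rel e)) _).
    apply comp_idl.
  - intros l g V V' t v b e e'.
    exact (@sec_res _ _ _ _ _ _ _ _ _ _ z (mk_under (g ∘ f)) (below_comp f g lt)
      V V' t v b (boundary_rel e) (boundary_rel e')).
  - intros l l' g h V v b e e'.
    pose (h0 := exist _ h eq_refl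
      : @Hom (Coslice i) (mk_under (g ∘ f)) (mk_under (h ∘ (g ∘ f)))).
    pose proof (@fm_R_act _ _ _ _ (pb_fam p (idm (X i))) _ _ h0 V _ b (boundary_rel e)) as r.
    refine (eq_trans _ (@sec_act _ _ _ _ _ _ _ _ _ _ z (mk_under (g ∘ f))
      (mk_under (h ∘ (g ∘ f))) h0 (below_comp f g lt)
      (below_comp (g ∘ f) h (below_comp f g lt)) V v b (boundary_rel e) r)).
    apply (@sec_under_eq l' (h ∘ g ∘ f) (h ∘ (g ∘ f)));
      [symmetry; apply comp_assoc | reflexivity | reflexivity].
Qed.

End BoundarySections.

(** * Boundary sections and matching objects *)

Section Matching.

Variables (i : I) (MQ : Limit (boundary_diagram (pw_functor Q) i))
  (MX : Limit (boundary_diagram X i))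
  (P : Pullback (matching_map MX) (matching_ob_map (pw_nat Q) MQ MX)).

Let mleg (x : Boundary i) : Hom (apex MQ) (pw_ob (Q (under_cod (proj1_sig x)))) :=
  leg MQ x.

Lemma matching_leg (x : Boundary i) :
  pw_arr (Q (under_cod (proj1_sig x))) ∘ (mleg x ∘ pb_snd P) =
  fmap X (under_arr (proj1_sig x)) ∘ pb_fst P.
Proof.
  transitivity (leg MX x ∘ matching_ob_map (pw_nat Q) MQ MX ∘ pb_snd P).
  - rewrite comp_assoc; symmetry; apply (f_equal (fun h => h ∘ pb_snd P)).
    exact (lim_lift_leg MX (cone_push (whisker (pw_nat Q) (boundary_proj i)) MQ) x).
  - rewrite <- comp_assoc, <- (pb_comm P), comp_assoc.
    apply (f_equal (fun h => h ∘ pb_fst P)).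
    exact (lim_lift_leg MX (matching_cone X i) x).
Qed.

Lemma matching_leg_comm (x y : Boundary i) (h : Hom x y) :
  pw_map Q (proj1_sig h) ∘ mleg x = mleg y.
Proof. exact (leg_comm MQ h). Qed.

Definition bd (x : Coslice i) (s : below x) : Boundary i :=
  exist _ x (below_boundary s).

Lemma matching_rel (x : Coslice i) (s : below x) V (v : Hom V (pb_ob P))
  (b : Hom V (Y (under_cod x))) :
  fm_R (f := pb_fam p (idm (X i))) (x := x) (pb_fst P ∘ v) b ->
  p (under_cod x) ∘ b = fmap X (idm (under_cod x)) ∘
    (pw_arr (Q (under_cod x)) ∘ (mleg (bd s) ∘ pb_snd P ∘ v)).
Proof.
  simpl; intros r; rewrite fmap_id, comp_idl in *; rewrite r, !comp_assoc.
  apply (f_equal (fun h => h ∘ v)); symmetry.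
  rewrite <- (comp_assoc (pw_arr _)); exact (matching_leg (bd s)).
Qed.

(** An element of the matching object has at each boundary arrow [x] a family at the codomain of
    [x]; evaluating it at the identity gives the section at [x]. *)
Definition matching_sec :
  Sec (whisker k (coslice_proj i)) (pb_fam p (idm (X i))) (@below i) (pb_fst P).
Proof.
  refine (@Build_Sec _ _ _ _ (whisker k (coslice_proj i)) (X i)
    (pb_fam p (idm (X i))) (@below i) (pb_ob P) (pb_fst P)
    (fun x s V v b r => pw_ev (Q (under_cod x)) (matching_rel s r)) _ _ _).
  - intros x s V v b r.
    refine (eq_trans (family_over (pw_family (Q (under_cod x))) _) _).
    symmetry; apply comp_idl.
  - intros x s V V' t v b r r'.
    assert (e : p (under_cod x) ∘ (b ∘ t) = fmap X (idm (under_cod x)) ∘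
      (pw_arr (Q (under_cod x)) ∘ (mleg (bd s) ∘ pb_snd P ∘ v ∘ t)))
      by (rewrite <- (comp_assoc (_ ∘ pb_snd P)); exact (matching_rel s r')).
    refine (eq_trans _ (family_res (pw_family (Q (under_cod x))) (matching_rel s r) e)).
    apply pw_ev_eq; [reflexivity | apply comp_assoc | reflexivity].
  - intros x y h s s' V v b r r'.
    pose (h0 := proj1_sig h : Hom (under_cod x) (under_cod y)).
    assert (E : mleg (bd s') ∘ pb_snd P ∘ v = pw_map Q h0 ∘ (mleg (bd s) ∘ pb_snd P ∘ v)).
    { rewrite !comp_assoc; do 2 apply (f_equal (fun g => g ∘ _)); symmetry.
      exact (matching_leg_comm (x := bd s) (y := bd s') h). }
    assert (e1 : p (under_cod y) ∘ (fmap Y h0 ∘ b) = fmap X (idm (under_cod y)) ∘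
      (pw_arr (Q (under_cod y)) ∘ (pw_map Q h0 ∘ (mleg (bd s) ∘ pb_snd P ∘ v))))
      by (rewrite <- E; exact (matching_rel s' r')).
    assert (e2 : p (under_cod y) ∘ (fmap Y h0 ∘ b) = fmap X (idm (under_cod y) ∘ h0) ∘
      (pw_arr (Q (under_cod x)) ∘ (mleg (bd s) ∘ pb_snd P ∘ v))).
    { rewrite e1, (comp_assoc (pw_arr _)), pw_map_arr, fmap_comp, !comp_assoc; reflexivity. }
    assert (e3 : p (under_cod y) ∘ (fmap Y h0 ∘ b) = fmap X (h0 ∘ idm (under_cod x)) ∘
      (pw_arr (Q (under_cod x)) ∘ (mleg (bd s) ∘ pb_snd P ∘ v)))
      by (rewrite comp_idr; now rewrite comp_idl in e2).
    refine (eq_trans (pw_ev_eq _ e1 eq_refl E eq_refl) _).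
    refine (eq_trans (pw_map_ev e1 e2) _).
    refine (eq_trans (pw_ev_eq e2 e3 _ eq_refl eq_refl) _).
    + now rewrite comp_idl, comp_idr.
    + exact (family_act (pw_family (Q (under_cod x))) (matching_rel s r) e3).
Defined.

Lemma matching_univ (U : C) (a : Hom U (X i))
  (z : Sec (whisker k (coslice_proj i)) (pb_fam p (idm (X i))) (@below i) a) :
  exists h : Hom U (pb_ob P), pb_fst P ∘ h = a /\
    forall x s V (v : Hom V U) (b : Hom V (fm_D (pb_fam p (idm (X i))) x))
      (r : fm_R (a ∘ v) b) (r' : fm_R (pb_fst P ∘ (h ∘ v)) b),
      matching_sec x s V _ b r' = z x s V v b r.
Proof.
  assert (lt : forall x : Boundary i, deg (under_cod (proj1_sig x)) < deg i)
    by (intros x; apply (boundary_lt deg_lt)).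
  pose (H x := constructive_indefinite_description _
    (pw_univ (Q (under_cod (proj1_sig x)))
       (boundary_family z (under_arr (proj1_sig x)) (lt x)))).
  pose (h x := proj1_sig (H x)).
  assert (h1 : forall x, pw_arr (Q (under_cod (proj1_sig x))) ∘ h x =
    fmap X (under_arr (proj1_sig x)) ∘ a)
    by (intros x; exact (proj1 (proj2_sig (H x)))).
  assert (h2 : forall x l (g : Hom (under_cod (proj1_sig x)) l) V (v : Hom V U)
    (b : Hom V (Y l))
    (e : p l ∘ b = fmap X g ∘ (fmap X (under_arr (proj1_sig x)) ∘ a ∘ v))
    (e' : p l ∘ b = fmap X g ∘ (pw_arr (Q (under_cod (proj1_sig x))) ∘ (h x ∘ v))),
    pw_ev (Q (under_cod (proj1_sig x))) e' =
    z (mk_under (g ∘ under_arr (proj1_sig x)))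
      (below_comp (under_arr (proj1_sig x)) g (lt x)) V v b (boundary_rel e))
    by (intros x; exact (proj2 (proj2_sig (H x)))).
  clearbody h; clear H.
  (* The families obtained by restricting [z] along the arrows of the boundary are compatible, hence
     form a cone over the values of the pushforward. *)
  assert (hc : forall (x y : Boundary i) (f : Hom x y), pw_map Q (proj1_sig f) ∘ h x = h y).
  { intros x y f; pose (f0 := proj1_sig f : Hom (under_cod (proj1_sig x)) (under_cod (proj1_sig y))).
    assert (ef : f0 ∘ under_arr (proj1_sig x) = under_arr (proj1_sig y))
      by exact (proj2_sig f).
    change (pw_map Q f0 ∘ h x = h y).
    apply pw_uniq.
    - rewrite comp_assoc, pw_map_arr, <- comp_assoc, !h1, comp_assoc, <- fmap_comp.
      exact (f_equal (fun g => fmap X g ∘ a) ef).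
    - intros l g V v b e e'.
      assert (e1 : p l ∘ b = fmap X g ∘ (pw_arr (Q (under_cod (proj1_sig y))) ∘
        (pw_map Q f0 ∘ (h x ∘ v)))) by (rewrite e, <- (comp_assoc (pw_map Q f0)); reflexivity).
      assert (e2 : p l ∘ b = fmap X (g ∘ f0) ∘ (pw_arr (Q (under_cod (proj1_sig x))) ∘ (h x ∘ v))).
      { rewrite e1, (comp_assoc (pw_arr _)), pw_map_arr, fmap_comp, !comp_assoc; reflexivity. }
      assert (e3 : p l ∘ b = fmap X (g ∘ f0) ∘ (fmap X (under_arr (proj1_sig x)) ∘ a ∘ v))
        by (rewrite e2, (comp_assoc (pw_arr _)), h1; reflexivity).
      assert (e4 : p l ∘ b = fmap X g ∘ (fmap X (under_arr (proj1_sig y)) ∘ a ∘ v))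
        by (rewrite e', (comp_assoc (pw_arr _)), h1; reflexivity).
      rewrite (pw_ev_eq e e1 eq_refl (eq_sym (comp_assoc _ _ _)) eq_refl).
      rewrite (pw_map_ev e1 e2), (h2 _ _ _ _ _ _ e3), (h2 _ _ _ _ _ _ e4).
      apply sec_under_eq; [|reflexivity|reflexivity].
      rewrite <- comp_assoc; exact (f_equal (comp g) ef). }
  pose (c := {| apex := U; leg := h : forall x, Hom U (boundary_diagram (pw_functor Q) i x);
                leg_comm := hc |}).
  pose (u := lim_lift MQ c).
  assert (u1 : forall x, mleg x ∘ u = h x) by exact (lim_lift_leg MQ c).
  assert (eu : matching_map MX ∘ a = matching_ob_map (pw_nat Q) MQ MX ∘ u).
  { apply (lim_uniq (l := MX)); intros x; rewrite !comp_assoc.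
    refine (eq_trans (f_equal (fun h => h ∘ a) (lim_lift_leg MX (matching_cone X i) x)) _).
    refine (eq_trans _ (eq_sym (f_equal (fun h => h ∘ u) (lim_lift_leg MX
      (cone_push (whisker (pw_nat Q) (boundary_proj i)) MQ) x)))).
    simpl; rewrite <- comp_assoc; refine (eq_trans (eq_sym (h1 x)) _).
    f_equal; symmetry; apply u1. }
  exists (pb_lift P eu); split; [apply pb_lift_fst|].
  intros x s V v b r r'.
  assert (E : mleg (bd s) ∘ pb_snd P ∘ (pb_lift P eu ∘ v) = h (bd s) ∘ v).
  { rewrite <- comp_assoc, pb_lift_eq_snd, comp_assoc; now rewrite u1. }
  assert (e : p (under_cod x) ∘ b = fmap X (idm (under_cod x)) ∘
    (pw_arr (Q (under_cod x)) ∘ (h (bd s) ∘ v)))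
    by (rewrite <- E; exact (matching_rel s r')).
  assert (e1 : p (under_cod x) ∘ b = fmap X (idm (under_cod x)) ∘
    (fmap X (under_arr x) ∘ a ∘ v))
    by (rewrite e, (comp_assoc (pw_arr _));
        exact (f_equal (fun g => _ ∘ (g ∘ v)) (h1 (bd s)))).
  refine (eq_trans (pw_ev_eq _ e eq_refl E eq_refl) _).
  refine (eq_trans (h2 (bd s) _ _ _ _ _ e1 e) _).
  destruct x as [l g]; simpl.
  apply sec_under_eq; [apply comp_idl | reflexivity | reflexivity].
Qed.

Definition matching_rep :
  Rep (whisker k (coslice_proj i)) (pb_fam p (idm (X i))) (@below i).
Proof.
  refine {| rep_ob := pb_ob P; rep_arr := pb_fst P; rep_sec := matching_sec;
            rep_univ := matching_univ |}.
  intros U h h' e H; apply (@pb_uniq _ _ _ _ _ _ P); [exact e|].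
  apply (lim_uniq (l := MQ)); intros x.
  change (mleg x ∘ (pb_snd P ∘ h) = mleg x ∘ (pb_snd P ∘ h')).
  assert (lt := boundary_lt deg_lt x).
  apply pw_uniq.
  - assert (L : forall h : Hom U (pb_ob P),
      pw_arr (Q (under_cod (proj1_sig x))) ∘ (mleg x ∘ (pb_snd P ∘ h)) =
      fmap X (under_arr (proj1_sig x)) ∘ (pb_fst P ∘ h)).
    { intros g; rewrite (comp_assoc (mleg x)), (comp_assoc (pw_arr _)), matching_leg.
      symmetry; apply comp_assoc. }
    now rewrite !L, e.
  - intros l g V v b e1 e2.
    pose (y := mk_under (g ∘ under_arr (proj1_sig x)) : Coslice i).
    pose (s := below_comp (under_arr (proj1_sig x)) g lt : below y).
    assert (L : mleg (bd s) = pw_map Q g ∘ mleg x).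
    { symmetry; exact (matching_leg_comm (x := x) (y := bd s)
        (exist (fun h => h ∘ under_arr (proj1_sig x) = under_arr y) g eq_refl)). }
    (* Compatibility of the legs turns the value at [g] of the leg at [x] into the value at an
       identity of the leg at [g] composed with [x], which is what [matching_sec] records. *)
    assert (T : forall (h : Hom U (pb_ob P))
      (e : p l ∘ b = fmap X g ∘ (pw_arr (Q (under_cod (proj1_sig x))) ∘
             (mleg x ∘ (pb_snd P ∘ h) ∘ v))),
      exists r : fm_R (f := pb_fam p (idm (X i))) (x := y) (pb_fst P ∘ (h ∘ v)) b,
        pw_ev (Q _) e = matching_sec y s V _ b r).
    { clear h h' e H e1 e2; intros h e.
      assert (r : fm_R (f := pb_fam p (idm (X i))) (x := y) (pb_fst P ∘ (h ∘ v)) b).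
      { simpl; rewrite comp_idl, fmap_comp, e, <- (comp_assoc (fmap X g)); f_equal.
        transitivity (pw_arr (Q (under_cod (proj1_sig x))) ∘ (mleg x ∘ pb_snd P) ∘ (h ∘ v)).
        - now rewrite !comp_assoc.
        - rewrite matching_leg; symmetry; apply comp_assoc. }
      exists r; symmetry.
      assert (E : mleg (bd s) ∘ pb_snd P ∘ (h ∘ v) =
        pw_map Q g ∘ (mleg x ∘ (pb_snd P ∘ h) ∘ v))
        by (rewrite L, !comp_assoc; reflexivity).
      assert (e1 : p l ∘ b = fmap X (idm l) ∘ (pw_arr (Q l) ∘
        (pw_map Q g ∘ (mleg x ∘ (pb_snd P ∘ h) ∘ v))))
        by (rewrite <- E; exact (matching_rel s r)).
      assert (e2 : p l ∘ b = fmap X (idm l ∘ g) ∘ (pw_arr (Q (under_cod (proj1_sig x))) ∘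
        (mleg x ∘ (pb_snd P ∘ h) ∘ v)))
        by (rewrite comp_idl; exact e).
      refine (eq_trans (pw_ev_eq _ e1 eq_refl E eq_refl) _).
      rewrite (pw_map_ev e1 e2); apply pw_ev_eq; [apply comp_idl | reflexivity | reflexivity]. }
    destruct (T h e1) as [r E1], (T h' e2) as [r' E2].
    rewrite E1, E2; exact (H y s V v b r r').
Defined.

Lemma matching_fibration :
  stable_under_pushforward Fib -> fillable deg k Fib i -> relative_matching_map P ∈ Fib.
Proof.
  intros Fib_pushforward fk.
  assert (r1 : pb_fst P ∘ relative_matching_map P = pw_arr (Q i)) by apply pb_lift_fst.
  assert (r2 : pb_snd P ∘ relative_matching_map P = matching_map MQ) by apply pb_lift_snd.
  apply (@boundary_restriction Fib i matching_rep (relative_matching_map P)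
    (fun A B E p q => pi_exists C_complete Fib_pushforward)
    (fib_contains_isos Fib_pullback) fk r1).
  intros x s V v b r e.
  assert (E : mleg (bd s) ∘ pb_snd P ∘ (relative_matching_map P ∘ v) =
    pw_map Q (under_arr x) ∘ v).
  { rewrite <- (comp_assoc (mleg _)), (comp_assoc (pb_snd P)), r2, comp_assoc.
    apply (f_equal (fun h => h ∘ v)); exact (lim_lift_leg MQ (matching_cone (pw_functor Q) i) (bd s)). }
  assert (e1 : p (under_cod x) ∘ b = fmap X (idm _) ∘ (pw_arr (Q (under_cod x)) ∘
    (pw_map Q (under_arr x) ∘ v))) by (rewrite <- E; exact (matching_rel s r)).
  assert (e2 : p (under_cod x) ∘ b = fmap X (idm _ ∘ under_arr x) ∘ (pw_arr (Q i) ∘ v))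
    by (rewrite comp_idl; exact e).
  refine (eq_trans (pw_ev_eq _ e1 eq_refl E eq_refl) _).
  rewrite (pw_map_ev e1 e2); apply pw_ev_eq; [apply comp_idl | reflexivity | reflexivity].
Qed.

End Matching.

End Boundaries.

(** * Homotopical diagrams *)

Section TrivialFibrations.

Variables (C : Category) (Fib W : WideSub C).

Definition trivial_fib : WideSub C.
Proof.
  refine {| in_wide := fun a b (f : Hom a b) => f ∈ Fib /\ f ∈ W |}.
  - intros a; split; apply wide_id.
  - intros a b c g f [g1 g2] [f1 f2]; split; now apply wide_comp.
Defined.

(** A trivial fibration [q] is a weak equivalence over [A] between the fibrations [q] and [idm A];
    its base change is one onto an identity. *)
Lemma trivial_fib_pullback :
  stable_under_pullback Fib -> pullbacks_behaved Fib W ->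
  stable_under_pullback trivial_fib.
Proof.
  intros Fp [_ Wp] A B X q g P [q1 q2]; split; [now apply (Fp _ _ _ _ _ P)|].
  pose (x := mk_over q : Slice A); pose (y := mk_over (idm A) : Slice A).
  pose (h := exist _ q (comp_idl q) : Hom x y).
  pose (R := self_pullback g : Pullback (over_arr y) g).
  pose proof (Wp A B x y h g P R q1 (wide_id Fib A) q2) as H.
  pose proof (base_change_map_snd (x := x) (y := y) P R h) as E.
  refine (eq_ind _ (fun f : Hom _ _ => f ∈ W) H _ _).
  exact (eq_trans (eq_sym (comp_idl _)) E).
Qed.

Lemma trivial_fib_pi :
  finitely_complete C -> stable_under_pushforward Fib -> pushforwards_behaved Fib W ->
  forall (A B E : C) (p : Hom B A) (q : Hom E B), p ∈ Fib -> q ∈ trivial_fib ->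
  exists F : Pi p q, pi_arr F ∈ trivial_fib.
Proof.
  intros Cc Fp Wp A B E p q hp [q1 q2].
  destruct (pi_exists Cc Fp hp q1) as [F hF].
  exists F; split; [exact hF|].
  now apply (pi_trivial Cc Wp F hp q1 q2).
Qed.

Lemma pb_fst_weq (A B X : C) (p : Hom X A) (w : Hom B A) (P : Pullback p w) :
  pullbacks_behaved Fib W -> p ∈ Fib -> w ∈ W -> pb_fst P ∈ W.
Proof. intros [H _] hp hw; now apply (H _ _ _ _ _ (pullback_sym P)). Qed.

End TrivialFibrations.

Section Homotopical.

Variables (I C : Category) (deg : I -> nat) (WI : WideSub I) (Fib W : WideSub C).
Hypothesis deg_lt : forall (i j : I) (f : Hom i j), non_identity f -> deg j < deg i.
Hypothesis I_finite : finite_category I.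
Hypothesis C_complete : finitely_complete C.
Hypothesis Fib_pullback : stable_under_pullback Fib.
Hypothesis Fib_pushforward : stable_under_pushforward Fib.
Hypothesis W_isos : contains_isos W.
Hypothesis W_2of3 : two_out_of_three W.
Hypothesis C_pullbacks : pullbacks_behaved Fib W.
Hypothesis C_pushforwards : pushforwards_behaved Fib W.
Variables (X Y Z : Functor I C) (p : NatTrans Y X) (k : NatTrans Z Y).
Hypothesis X_homotopical : homotopical WI W X.
Hypothesis Y_homotopical : homotopical WI W Y.
Hypothesis Z_homotopical : homotopical WI W Z.
Hypothesis p_fib : forall i, p i ∈ Fib.
Hypothesis k_fib : forall i, k i ∈ Fib.
Hypothesis k_fillable : forall i, fillable deg k Fib i.
Variable Q : forall i : I, Pointwise p k i.
Hypothesis Q_fib : forall i, pw_arr (Q i) ∈ Fib.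

(** * Weak equivalences that are initial in a boundary *)

Section Initial.

Variables (i j : I) (w : Hom i j) (w_nonid : non_identity w).
Hypothesis w_WI : w ∈ WI.
Hypothesis w_initial : is_initial (exist _ (mk_under w) w_nonid : Boundary i).

Lemma initial_factor (l : I) (g : Hom i l) : deg l < deg i ->
  exists h : Hom j l, h ∘ w = g /\ forall h', h' ∘ w = g -> h' = h.
Proof.
  intros lt.
  destruct (w_initial (exist _ (mk_under g) (lt_non_identity (f := g) lt))) as [[h eh] H].
  simpl in *; exists h; split; [exact eh|].
  intros h' eh'; exact (f_equal (@proj1_sig _ _) (H (exist _ h' eh'))).
Qed.

Definition factor (l : I) (g : Hom i l) (lt : deg l < deg i) : Hom j l :=
  proj1_sig (constructive_indefinite_description _ (initial_factor g lt)).

Lemma factor_eq (l : I) (g : Hom i l) (lt : deg l < deg i) : factor g lt ∘ w = g.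
Proof.
  unfold factor; now destruct (constructive_indefinite_description _ _) as [h [h1 h2]].
Qed.

Lemma factor_uniq (l : I) (g : Hom i l) (lt : deg l < deg i) (h : Hom j l) :
  h ∘ w = g -> h = factor g lt.
Proof.
  unfold factor; destruct (constructive_indefinite_description _ _) as [h0 [h1 h2]].
  apply h2.
Qed.

(** A matching family at [i] is determined by its member at [w], so the relative matching map is the
    map from [Z i] to the pullback [U0]. By 2-out-of-3 it is a weak equivalence: [Z w] is one, and
    so is the projection of [U0] to [Z j], a pullback of [Y w] along the fibration [k j]. *)
Lemma initial_fillable : fillable deg k (trivial_fib Fib W) i.
Proof.
  pose (ltj := deg_lt w_nonid).
  pose (U0 := pbk C_complete (k j) (fmap Y w)).
  (* The universal matching family, living over [U0]. *)
  pose (z0 := fun y (h : Hom i y) l => fmap Z (factor h l) ∘ pb_fst U0).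
  assert (M0 : matching_family k (pb_snd U0) z0).
  { unfold z0; split.
    - intros y h l; rewrite comp_assoc, <- naturality, <- comp_assoc, (pb_comm U0).
      now rewrite comp_assoc, <- fmap_comp, factor_eq.
    - intros y y' h h' l l'; rewrite comp_assoc, <- fmap_comp.
      do 2 f_equal; symmetry; apply factor_uniq.
      now rewrite <- comp_assoc, factor_eq. }
  destruct (k_fillable M0) as [F0 hF0].
  assert (wF0 : fl_arr F0 ∈ W).
  { assert (e : k j ∘ fmap Z w = fmap Y w ∘ k i) by now rewrite naturality.
    destruct (fl_univ F0 (v := pb_lift U0 e) (t := idm (Z i))) as [n [n1 n2]].
    { rewrite comp_idr; symmetry; apply pb_lift_snd. }
    { intros y h l; unfold z0; rewrite comp_idr, <- comp_assoc, pb_lift_fst.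
      now rewrite <- fmap_comp, factor_eq. }
    assert (E : fmap Z w ∘ fl_el F0 = pb_fst U0 ∘ fl_arr F0).
    { rewrite (fl_bd F0 w ltj); unfold z0.
      rewrite <- (factor_uniq ltj (comp_idl w)), fmap_id, comp_idl; reflexivity. }
    (* Every element of [Z i] fills the restriction of [z0] that it determines, so the filler over
       [U0] is [Z i] itself. *)
    assert (iso : is_iso (fl_el F0)).
    { exists n; split; [|exact n2].
      apply (@fl_uniq _ _ _ _ _ _ _ _ _ _ F0).
      - rewrite comp_assoc, n1, comp_idr; apply pb_uniq.
        + now rewrite pb_lift_eq_fst.
        + rewrite pb_lift_eq_snd; apply (fl_over F0).
      - now rewrite comp_assoc, n2, comp_idl, comp_idr. }
    apply (proj2 (W_2of3 (pb_fst U0) (fl_arr F0))).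
    - apply (pb_fst_weq U0 C_pullbacks); auto.
    - rewrite <- E; apply wide_comp; auto. }
  intros U b z [z1 z2].
  assert (e : k j ∘ z j w ltj = fmap Y w ∘ b) by apply z1.
  pose (P := pbk C_complete (fl_arr F0) (pb_lift U0 e)).
  assert (eb : b = pb_snd U0 ∘ pb_lift U0 e) by (symmetry; apply pb_lift_snd).
  (* Each [h] factors through [w], so any matching family is a restriction of [z0], and its filler
     is a base change of [F0]. *)
  assert (ez : forall y (h : Hom i y) l, z y h l = z0 y h l ∘ pb_lift U0 e).
  { intros y h l; unfold z0; rewrite <- comp_assoc, pb_lift_fst.
    assert (E : forall h', h' = h -> forall l', z y h' l' = z y h l)
      by (intros h' -> l'; f_equal; apply proof_irrelevance).
    assert (l' : deg y < deg i) by exact l.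
    rewrite <- (E _ (factor_eq h l) l'); apply z2. }
  exists (filler_pull P eb ez).
  exact (trivial_fib_pullback Fib_pullback C_pullbacks P (conj hF0 wF0)).
Qed.

Lemma initial_rel (P : Pullback (pw_arr (Q j)) (fmap X w)) (x : Coslice i)
  (s : below deg x) V (v : Hom V (pb_ob P)) (b : Hom V (Y (under_cod x))) :
  fm_R (f := pb_fam p (idm (X i))) (x := x) (pb_snd P ∘ v) b ->
  p (under_cod x) ∘ b = fmap X (factor (under_arr x) s) ∘ (pw_arr (Q j) ∘ (pb_fst P ∘ v)).
Proof.
  simpl; rewrite comp_idl; intros ->.
  rewrite (comp_assoc (pw_arr _)), (pb_comm P), <- (comp_assoc (fmap X w)).
  now rewrite (comp_assoc (fmap X (factor _ _))), <- fmap_comp, factor_eq.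
Qed.

(** Each arrow below [i] factors uniquely through [w], which identifies the boundary of [i] with the
    coslice of [j]; sections on the boundary are families at [j]. *)
Definition initial_rep (P : Pullback (pw_arr (Q j)) (fmap X w)) :
  Rep (whisker k (coslice_proj i)) (pb_fam p (idm (X i))) (@below I deg i).
Proof.
  unshelve refine {| rep_ob := pb_ob P; rep_arr := pb_snd P;
    rep_sec := @Build_Sec _ _ _ _ (whisker k (coslice_proj i)) (X i)
      (pb_fam p (idm (X i))) (@below I deg i) (pb_ob P) (pb_snd P)
      (fun x s V v b r => pw_ev (Q j) (initial_rel s r)) _ _ _ |}.
  - intros x s V v b r.
    refine (eq_trans (family_over (pw_family (Q j)) _) _); symmetry; apply comp_idl.
  - intros x s V V' t v b r r'.
    assert (e : p (under_cod x) ∘ (b ∘ t) = fmap X (factor (under_arr x) s) ∘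
      (pw_arr (Q j) ∘ (pb_fst P ∘ v ∘ t)))
      by (rewrite <- (comp_assoc (pb_fst P)); exact (initial_rel s r')).
    refine (eq_trans _ (family_res (pw_family (Q j)) (initial_rel s r) e)).
    apply pw_ev_eq; [reflexivity | apply comp_assoc | reflexivity].
  - intros x y h s s' V v b r r'.
    pose (h0 := proj1_sig h : Hom (under_cod x) (under_cod y)).
    assert (eh : h0 ∘ under_arr x = under_arr y) by exact (proj2_sig h).
    assert (E : h0 ∘ factor (under_arr x) s = factor (under_arr y) s').
    { apply factor_uniq; rewrite <- comp_assoc, factor_eq; exact eh. }
    assert (e : p (under_cod y) ∘ (fmap Y h0 ∘ b) =
      fmap X (h0 ∘ factor (under_arr x) s) ∘ (pw_arr (Q j) ∘ (pb_fst P ∘ v)))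
      by (rewrite E; exact (initial_rel s' r')).
    refine (eq_trans (pw_ev_eq _ e (eq_sym E) eq_refl eq_refl) _).
    exact (family_act (pw_family (Q j)) (initial_rel s r) e).
  - intros U a z.
    destruct (pw_univ (Q j) (boundary_family deg_lt z w (deg_lt w_nonid))) as [h [h1 h2]].
    exists (pb_lift P h1); split; [apply pb_lift_snd|].
    intros x s V v b r r'; simpl.
    assert (E := pb_lift_eq_fst P h1 v).
    assert (e : p (under_cod x) ∘ b = fmap X (factor (under_arr x) s) ∘
      (pw_arr (Q j) ∘ (h ∘ v))) by (rewrite <- E; exact (initial_rel s r')).
    assert (e1 : p (under_cod x) ∘ b = fmap X (factor (under_arr x) s) ∘
      (fmap X w ∘ a ∘ v)) by (rewrite e, (comp_assoc (pw_arr _)), h1; reflexivity).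
    refine (eq_trans (pw_ev_eq _ e eq_refl E eq_refl) _).
    refine (eq_trans (h2 _ _ _ _ _ e1 e) _).
    destruct x as [l g]; simpl.
    apply (@sec_under_eq _ _ _ _ _ _ _ _ _ _ _ z l (factor g s ∘ w) g);
      [apply factor_eq | reflexivity | reflexivity].
  - intros U h h' e H; apply (@pb_uniq _ _ _ _ _ _ P); [|exact e].
    apply pw_uniq; [now rewrite !comp_assoc, (pb_comm P), <- !comp_assoc, e|].
    intros l g V v b e1 e2.
    pose (s := below_comp deg_lt w g (deg_lt w_nonid)).
    assert (Eg : g = factor (g ∘ w) s) by now apply factor_uniq.
    assert (T : forall (h : Hom U (pb_ob P))
      (e : p l ∘ b = fmap X g ∘ (pw_arr (Q j) ∘ (pb_fst P ∘ h ∘ v))),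
      exists r : fm_R (f := pb_fam p (idm (X i))) (x := mk_under (g ∘ w))
          (pb_snd P ∘ (h ∘ v)) b,
        pw_ev (Q j) e = pw_ev (Q j) (initial_rel s r)).
    { clear h h' e H e1 e2; intros h e.
      assert (r : fm_R (f := pb_fam p (idm (X i))) (x := mk_under (g ∘ w))
          (pb_snd P ∘ (h ∘ v)) b).
      { simpl; rewrite comp_idl, fmap_comp, e, <- (comp_assoc (fmap X g)); f_equal.
        rewrite !comp_assoc, (pb_comm P); reflexivity. }
      exists r; apply pw_ev_eq; [exact Eg | symmetry; apply comp_assoc | reflexivity]. }
    destruct (T h e1) as [r E1], (T h' e2) as [r' E2].
    rewrite E1, E2; exact (H (mk_under (g ∘ w)) s V v b r r').
Defined.

Lemma initial_map_weq : pw_map Q w ∈ W.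
Proof.
  pose (P := pbk C_complete (pw_arr (Q j)) (fmap X w)).
  pose (m := pb_lift P (pw_map_arr Q w)).
  assert (mK : m ∈ trivial_fib Fib W).
  { apply (@boundary_restriction I C deg Fib deg_lt C_complete Fib_pullback X Y Z p k
      p_fib Q (trivial_fib Fib W) i (initial_rep P) m).
    - now apply trivial_fib_pi.
    - intros a b f If; split; [now apply fib_contains_isos | auto].
    - apply initial_fillable.
    - apply pb_lift_snd.
    - intros x s V v b r e.
      assert (E := pb_lift_eq_fst P (pw_map_arr Q w) v).
      assert (e1 : p (under_cod x) ∘ b = fmap X (factor (under_arr x) s) ∘
        (pw_arr (Q j) ∘ (pw_map Q w ∘ v))) by (rewrite <- E; exact (initial_rel s r)).
      assert (e2 : p (under_cod x) ∘ b = fmap X (factor (under_arr x) s ∘ w) ∘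
        (pw_arr (Q i) ∘ v)) by (rewrite factor_eq; exact e).
      refine (eq_trans (pw_ev_eq _ e1 eq_refl E eq_refl) _).
      rewrite (pw_map_ev e1 e2); apply pw_ev_eq; [apply factor_eq | reflexivity | reflexivity]. }
  (* The remaining factor of [pw_map Q w] is the pullback of [X w] along the fibration
     [pw_arr (Q j)]. *)
  rewrite <- (pb_lift_fst P (pw_map_arr Q w)); apply wide_comp; [|apply mK].
  apply (pb_fst_weq P C_pullbacks); auto.
Qed.

End Initial.

(* If every map out of i is a weak equivalence then the value at i of the
   pushforward along p agrees up to weak equivalence with the pushforward along
   the single fibration p i. *)
Section Constant.

Variable i : I.
Hypothesis i_WI : forall (l : I) (f : Hom i l), f ∈ WI.

Section Target.

Variables (j : I) (f : Hom i j).

Definition const_functor : Functor (Coslice j) C.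
Proof.
  refine {| fob := fun _ => Y i; fmap := fun _ _ _ => idm (Y i) |}.
  - reflexivity.
  - intros; symmetry; apply comp_idl.
Defined.

Definition const_nat : NatTrans const_functor (functor_comp Y (coslice_proj j)).
Proof.
  refine {| component := (fun x => fmap Y (under_arr x ∘ f))
    : forall x : Coslice j, Hom (const_functor x) (functor_comp Y (coslice_proj j) x) |}.
  intros x y h; simpl; rewrite comp_idr, <- fmap_comp, comp_assoc.
  exact (f_equal (fun g => fmap Y (g ∘ f)) (proj2_sig h)).
Defined.

(** The family maps to [Y] through [f], which is kept arbitrary: [f] and [idm i] are both used
    later, to bring the values at [j] and at [i] over the same base [X i]. *)
Definition const_fam : Fam (functor_comp Y (coslice_proj j)) (X i).
Proof.
  refine {| fm_D := const_functor; fm_y := const_nat;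
    fm_R := fun x V (v : Hom V (X i)) (b : Hom V (Y i)) => p i ∘ b = v |}.
  - intros x V V' t v b <-; apply comp_assoc.
  - intros x y h V v b e; simpl; now rewrite comp_idl.
Defined.

Definition const_points (x : Coslice j) : Points (@fm_R _ _ _ _ const_fam x).
Proof.
  refine {| pt_ob := Y i; pt_arr := p i; pt_el := idm (Y i) : Hom _ (fm_D const_fam x);
    pt_lift := fun V v b r => b |}.
  - apply comp_idr.
  - intros V v b r; exact r.
  - intros; apply comp_idl.
  - intros V m m' _ e; now rewrite !comp_idl in e.
Defined.

Variables (E : Pullback (k j) (fmap Y f)) (G : Pi (p i) (pb_snd E)).

Definition const_rep :
  Rep (whisker k (coslice_proj j)) const_fam (fun _ => True).
Proof.
  unshelve refine {| rep_ob := pi_ob G; rep_arr := pi_arr G;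
    rep_sec := @Build_Sec _ _ _ _ (whisker k (coslice_proj j)) (X i) const_fam
      (fun _ => True) (pi_ob G) (pi_arr G)
      (fun x _ V v b r => fmap Z (under_arr x) ∘ (pb_fst E ∘ pi_ev G (g := v) (b := b) r))
      _ _ _ |}.
  - intros x s V v b r; simpl.
    rewrite comp_assoc, <- naturality, <- comp_assoc, (comp_assoc (k j)), (pb_comm E).
    rewrite <- comp_assoc, pi_ev_over, comp_assoc, <- fmap_comp; reflexivity.
  - intros x s V V' t v b r r'; simpl.
    refine (eq_trans _ (comp_assoc _ _ _)); f_equal.
    refine (eq_trans _ (comp_assoc _ _ _)); f_equal.
    apply pi_ev_res.
  - intros x y h s s' V v b r r'; simpl.
    rewrite comp_assoc; rewrite (comp_assoc (fmap Z (proj1_sig h))), <- fmap_comp.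
    rewrite comp_assoc; f_equal.
    + apply (f_equal (fun g => fmap Z g ∘ pb_fst E)); symmetry; exact (proj2_sig h).
    + apply pi_ev_eq; [reflexivity | apply comp_idl].
  - intros U a z.
    pose (x0 := mk_under (idm j) : Coslice j).
    assert (ex : forall V (v : Hom V U) (b : Hom V (Y i)) (e : p i ∘ b = a ∘ v),
      k j ∘ z x0 Logic.I V v b e = fmap Y f ∘ b).
    { intros V v b e; refine (eq_trans (sec_over z Logic.I (e : fm_R (f := const_fam) (x := x0) (a ∘ v) b)) _).
      simpl; now rewrite comp_idl. }
    destruct (@pi_univ _ _ _ _ _ _ G U a (fun V v b e => pb_lift E (ex V v b e)))
      as [h [h1 h2]].
    + intros; apply pb_lift_snd.
    + intros V V' t v b e e'; apply pb_uniq.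
      * rewrite pb_lift_eq_fst, pb_lift_fst.
        exact (@sec_res _ _ _ _ _ _ _ _ _ _ z x0 Logic.I V V' t v b e e').
      * now rewrite pb_lift_eq_snd, pb_lift_snd.
    + exists h; split; [exact h1|].
      intros x [] V v b r r'; simpl in *.
      rewrite (h2 _ _ _ r), pb_lift_fst.
      pose (g := exist _ (under_arr x) (comp_idr _) : @Hom (Coslice j) x0 x).
      pose proof (@fm_R_act _ _ _ _ const_fam _ _ g V _ b r) as r2.
      refine (eq_trans (eq_sym (@sec_act _ _ _ _ _ _ _ _ _ _ z x0 x g Logic.I Logic.I V v b
        r r2)) _).
      apply (@sec_eq _ _ _ _ _ _ const_fam _ _ _ z x); [reflexivity | apply comp_idl].
  - intros U h h' e H; apply (@pi_uniq _ _ _ _ _ _ G); [exact e|].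
    intros V v b e1 e2; apply pb_uniq; [|now rewrite !pi_ev_over].
    pose proof (H (mk_under (idm j)) Logic.I V v b e1 e2) as E1; simpl in E1.
    now rewrite fmap_id, !comp_idl in E1.
Defined.

Variable P : Pullback (pw_arr (Q j)) (fmap X f).

Lemma const_phi_rel (x : Coslice j) V (v : Hom V (X i)) (b : Hom V (Y i)) :
  p i ∘ b = v -> fm_R (f := pb_fam p (fmap X f)) (x := x) v (const_nat x ∘ b).
Proof.
  intros <-; simpl.
  rewrite comp_assoc, <- naturality, fmap_comp, <- !comp_assoc; reflexivity.
Qed.

(** The map restricts sections along [const_nat]. Its description at the initial object of the
    coslice is kept so that the comparisons for different [f] can be related. *)
Lemma const_compares :
  exists m : Hom (pb_ob P) (pi_ob G), m ∈ W /\ pi_arr G ∘ m = pb_snd P /\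
    forall V (v : Hom V (pb_ob P)) (b : Hom V (Y i))
      (e : p i ∘ b = pi_arr G ∘ (m ∘ v))
      (e' : p j ∘ (fmap Y f ∘ b) = fmap X (idm j) ∘ (pw_arr (Q j) ∘ (pb_fst P ∘ v))),
      pb_fst E ∘ pi_ev G e = pw_ev (Q j) e'.
Proof.
  pose (R := pw_pull P).
  assert (y_phi : forall x, fm_y const_fam x = fm_y (pb_fam p (fmap X f)) x ∘ const_nat x)
    by (intros x; symmetry; apply comp_idl).
  unshelve epose (z := @Build_Sec _ _ _ _ (whisker k (coslice_proj j)) (X i) const_fam
    (fun _ => True) (pb_ob P) (pb_snd P) (fun x s V v b r =>
      rep_sec R x s V v (const_nat x ∘ b) (const_phi_rel x r)) _ _ _).
  { intros x s V v b r.
    refine (eq_trans (sec_over (rep_sec R) s _) _); apply comp_idl. }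
  { intros x s V V' t v b r r'.
    assert (r2 : fm_R (f := pb_fam p (fmap X f)) (x := x) (pb_snd P ∘ (v ∘ t)) (const_nat x ∘ b ∘ t))
      by (rewrite <- (comp_assoc (const_nat x)); exact (const_phi_rel x r')).
    refine (eq_trans _ (sec_res (rep_sec R) s (const_phi_rel x r) r2)).
    apply sec_eq; [reflexivity | apply comp_assoc]. }
  { intros x y h s s' V v b r r'.
    pose proof (@fm_R_act _ _ _ _ (pb_fam p (fmap X f)) _ _ h V _ _ (const_phi_rel x r)) as r2.
    refine (eq_trans _ (@sec_act _ _ _ _ _ _ _ _ _ _ (rep_sec R) x y h s s' V v _
      (const_phi_rel x r) r2)).
    apply sec_eq; [reflexivity|].
    rewrite !comp_assoc; apply (f_equal (fun g => g ∘ b)); symmetry; apply naturality. }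
  destruct (rep_univ const_rep z) as [m [m1 m2]].
  exists m; split; [|split; [exact m1|]].
  - destruct (coslice_finite j I_finite) as [l hl].
    apply (@compares_weq C (Coslice j) (@coslice_deg I deg j) _ _
      (whisker k (coslice_proj j)) Fib (@coslice_inverse _ _ deg_lt j) C_complete
      Fib_pullback Fib_pushforward W W_isos W_2of3 C_pullbacks C_pushforwards (X i)
      (pb_fam p (fmap X f)) const_fam const_nat y_phi const_phi_rel)
      with (l := l) (S := fun _ => True) (Q := R) (Q' := const_rep).
    + intros x.
      pose (PX := pbk C_complete (p (under_cod x)) (fmap X (under_arr x) ∘ fmap X f)).
      assert (eg : p (under_cod x) ∘ fmap Y (under_arr x ∘ f) =
        fmap X (under_arr x) ∘ fmap X f ∘ p i)
        by (rewrite <- fmap_comp; symmetry; apply naturality).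
      exists (pb_fam_points PX), (const_points x), (pb_lift PX eg).
      repeat split.
      * now apply (Fib_pullback PX).
      * exact (p_fib i).
      (* Compares [Y i] with the base change of p at [x]. Both map to [Y] at the codomain of [x] by
         weak equivalences, because all maps out of [i] are in [WI] and [X], [Y] are homotopical. *)
      * apply (proj2 (W_2of3 (pb_fst PX) (pb_lift PX eg))).
        -- apply (pb_fst_weq PX C_pullbacks); auto.
           rewrite <- fmap_comp; auto.
        -- rewrite pb_lift_fst; auto.
      * apply pb_lift_snd.
      * refine (eq_trans (pb_lift_fst PX eg) _); symmetry; apply comp_idr.
    + intros x; now apply coslice_fillable.
    + intros x y h _; exact Logic.I.
    + intros x _; apply hl.
    + split; [exact m1|].
      intros x s V v b r r'.
      assert (r0 : fm_R (f := const_fam) (x := x) (pb_snd P ∘ v) b)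
        by (rewrite <- m1, <- comp_assoc; exact r).
      refine (eq_trans (m2 x s V v b r0 r) _).
      change (rep_sec R x s V v (const_nat x ∘ b) (const_phi_rel x r0) =
              rep_sec R x s V v (const_nat x ∘ b) r').
      f_equal; apply proof_irrelevance.
  - intros V v b e e'.
    assert (r0 : fm_R (f := const_fam) (x := mk_under (idm j)) (pb_snd P ∘ v) b)
      by (rewrite <- m1, <- comp_assoc; exact e).
    pose proof (m2 (mk_under (idm j)) Logic.I V v b r0 e) as H; simpl in H.
    rewrite fmap_id, comp_idl in H; rewrite H.
    apply pw_ev_eq; [reflexivity | reflexivity|]; now rewrite comp_idl.
Qed.

End Target.

(** Values at [i] and [j] are both compared with pushforwards along [p i], of [Z i] and of the
    pullback of [Z j]. The map [h] between these two objects is a weak equivalence by 2-out-of-3,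
    hence so is the map [m] it induces, and [eq] transfers this to [r]. *)
Lemma constant_map_weq (j : I) (f : Hom i j) : pw_map Q f ∈ W.
Proof.
  pose (E := pbk C_complete (k j) (fmap Y f)).
  (* [Z i] is replaced by its pullback along [Y] of an identity, so that [const_compares] covers [i]
     as the case [f := idm i]. *)
  pose (E0 := pbk C_complete (k i) (fmap Y (idm i))).
  pose (P := pbk C_complete (pw_arr (Q j)) (fmap X f)).
  pose (P0 := pbk C_complete (pw_arr (Q i)) (fmap X (idm i))).
  pose (r := pb_lift P (pw_map_arr Q f)).
  pose (r0 := pb_lift P0 (pw_map_arr Q (idm i))).
  assert (fE : pb_snd E ∈ Fib) by now apply (Fib_pullback E).
  assert (fE0 : pb_snd E0 ∈ Fib) by now apply (Fib_pullback E0).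
  destruct (pi_exists C_complete Fib_pushforward (p_fib i) fE) as [G _].
  destruct (pi_exists C_complete Fib_pushforward (p_fib i) fE0) as [G0 _].
  destruct (const_compares G P) as [c [cW [c1 c2]]].
  destruct (const_compares G0 P0) as [c0 [c0W [c01 c02]]].
  assert (eh : k j ∘ (fmap Z f ∘ pb_fst E0) = fmap Y f ∘ pb_snd E0).
  { rewrite comp_assoc, <- naturality, <- comp_assoc, (pb_comm E0).
    refine (eq_trans (f_equal (fun g => fmap Y f ∘ (g ∘ pb_snd E0)) (fmap_id Y i)) _).
    now rewrite comp_idl. }
  pose (h := pb_lift E eh).
  assert (hs : pb_snd E ∘ h = pb_snd E0) by apply pb_lift_snd.
  assert (hf : pb_fst E ∘ h = fmap Z f ∘ pb_fst E0) by apply pb_lift_fst.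
  assert (hW : h ∈ W).
  { apply (proj2 (W_2of3 (pb_fst E) h)).
    - apply (pb_fst_weq E C_pullbacks); auto.
    - rewrite hf; apply wide_comp; auto.
      apply (pb_fst_weq E0 C_pullbacks); auto. }
  destruct (@pi_univ _ _ _ _ _ _ G (pi_ob G0) (pi_arr G0)
    (fun V v b e => h ∘ pi_ev G0 e)) as [m [m1 m2]].
  { intros V v b e; rewrite comp_assoc, hs; apply pi_ev_over. }
  { intros V V' t v b e e'; rewrite <- comp_assoc; f_equal; apply pi_ev_res. }
  assert (mW : m ∈ W).
  { apply (pi_map_weq C_complete C_pushforwards (p_fib i) fE0 fE hW hs m1).
    intros V g b e e'; apply m2. }
  assert (r0W : r0 ∈ W).
  { apply (proj2 (W_2of3 (pb_fst P0) r0)).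
    - apply (pb_fst_weq P0 C_pullbacks); auto.
    - unfold r0; rewrite pb_lift_fst.
      change (pw_map Q (idm i)) with (fmap (pw_functor Q) (idm i)).
      rewrite fmap_id; apply wide_id. }
  (* On a family at [i] and a point [b] of [Y i], the left side evaluates the family at [f] on
     [Y f ∘ b], and the right side applies [Z f] to the value at [idm i]; these agree by
     [family_act]. *)
  assert (eq : c ∘ r = m ∘ (c0 ∘ r0)).
  { apply (@pi_uniq _ _ _ _ _ _ G).
    - rewrite !comp_assoc, c1, m1, c01; unfold r, r0; now rewrite !pb_lift_snd.
    - intros V v b e e'; apply pb_uniq; [|now rewrite !pi_ev_over].
      assert (e1 : p i ∘ b = pi_arr G ∘ (c ∘ (r ∘ v))) by now rewrite (comp_assoc c).
      assert (e2 : p i ∘ b = pi_arr G ∘ (m ∘ (c0 ∘ (r0 ∘ v))))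
        by (rewrite e', <- !comp_assoc; reflexivity).
      assert (e3 : p i ∘ b = pi_arr G0 ∘ (c0 ∘ (r0 ∘ v)))
        by (rewrite e2, (comp_assoc (pi_arr G)), m1; reflexivity).
      rewrite (pi_ev_eq e e1 (eq_sym (comp_assoc _ _ _)) eq_refl).
      assert (em : m ∘ (c0 ∘ r0) ∘ v = m ∘ (c0 ∘ (r0 ∘ v)))
        by (rewrite <- !comp_assoc; reflexivity).
      rewrite (pi_ev_eq e' e2 em eq_refl), (m2 _ _ _ e3), comp_assoc, hf.
      rewrite <- comp_assoc.
      assert (rv : pb_fst P ∘ (r ∘ v) = pw_map Q f ∘ v) by apply pb_lift_eq_fst.
      assert (rv0 : pb_fst P0 ∘ (r0 ∘ v) = v).
      { unfold r0; rewrite pb_lift_eq_fst.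
        change (pw_map Q (idm i)) with (fmap (pw_functor Q) (idm i)).
        rewrite fmap_id; apply comp_idl. }
      assert (ev : p i ∘ b = pw_arr (Q i) ∘ v).
      { rewrite e1, (comp_assoc (pi_arr G)), c1, (comp_assoc (pb_snd P)).
        unfold r; now rewrite pb_lift_snd. }
      assert (d0 : p i ∘ (fmap Y (idm i) ∘ b) =
        fmap X (idm i) ∘ (pw_arr (Q i) ∘ (pb_fst P0 ∘ (r0 ∘ v))))
        by (rewrite rv0, !fmap_id, !comp_idl; exact ev).
      assert (d : p j ∘ (fmap Y f ∘ b) =
        fmap X (idm j) ∘ (pw_arr (Q j) ∘ (pb_fst P ∘ (r ∘ v)))).
      { rewrite rv, fmap_id, comp_idl, (comp_assoc (pw_arr _)), pw_map_arr.
        rewrite <- (comp_assoc (fmap X f)), <- ev, !comp_assoc, naturality; reflexivity. }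
      rewrite (c2 _ _ _ e1 d), (c02 _ _ _ e3 d0).
      assert (d1 : p j ∘ (fmap Y f ∘ b) = fmap X (idm j) ∘ (pw_arr (Q j) ∘ (pw_map Q f ∘ v)))
        by (rewrite <- rv; exact d).
      assert (d2 : p j ∘ (fmap Y f ∘ b) = fmap X (idm j ∘ f) ∘ (pw_arr (Q i) ∘ v)).
      { rewrite comp_idl, <- ev, !comp_assoc, naturality; reflexivity. }
      rewrite (pw_ev_eq d d1 eq_refl rv eq_refl), (pw_map_ev d1 d2).
      assert (d3 : p j ∘ (fmap Y f ∘ (fmap Y (idm i) ∘ b)) =
        fmap X (f ∘ idm i) ∘ (pw_arr (Q i) ∘ (pb_fst P0 ∘ (r0 ∘ v)))).
      { rewrite comp_idr, rv0, fmap_id, comp_idl, <- ev, !comp_assoc, naturality.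
        reflexivity. }
      rewrite <- (family_act (pw_family (Q i)) d0 d3); apply pw_ev_eq.
      + now rewrite comp_idl, comp_idr.
      + now symmetry.
      + now rewrite fmap_id, comp_idl. }
  assert (rW : r ∈ W).
  { apply (proj2 (W_2of3 c r)); [exact cW|].
    rewrite eq; apply wide_comp; [exact mW|]; now apply wide_comp. }
  rewrite <- (pb_lift_fst P (pw_map_arr Q f)); apply wide_comp; [|exact rW].
  apply (pb_fst_weq P C_pullbacks); auto.
Qed.

End Constant.

End Homotopical.

Theorem theorem3p5 (I C : Category) (WI : WideSub I) (Fib W : WideSub C)
  (I_finite : finite_category I)
  (I_inverse : inverse_category I)
  (WI_isos : contains_isos WI)
  (WI_2of3 : two_out_of_three WI)
  (C_complete : finitely_complete C)
  (Fib_pullback : stable_under_pullback Fib)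
  (Fib_pushforward : stable_under_pushforward Fib)
  (W_isos : contains_isos W)
  (W_2of3 : two_out_of_three W)
  (C_pullbacks : pullbacks_behaved Fib W)
  (C_pushforwards : pushforwards_behaved Fib W)
  (I_weq : forall (i j : I) (w : Hom i j) (w_nonid : non_identity w), w ∈ WI ->
     (forall (k : I) (f : Hom i k), f ∈ WI) \/
     is_initial (exist _ (mk_under w) w_nonid : Boundary i))
  (X Y Z : Functor I C)
  (X_homotopical : homotopical WI W X)
  (Y_homotopical : homotopical WI W Y)
  (Z_homotopical : homotopical WI W Z)
  (p : @Hom (FunCat I C) Y X) (k : @Hom (FunCat I C) Z Y)
  (p_Reedy : Reedy_fibration Fib p)
  (k_Reedy : Reedy_fibration Fib k) :
  exists F : Pushforward p (mk_over k),
    Reedy_fibration Fib (over_arr (pf_ob F)) /\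
    homotopical WI W (over_dom (pf_ob F)).
Proof.
  destruct I_inverse as [deg deg_lt].
  pose (p0 := p : NatTrans Y X); pose (k0 := k : NatTrans Z Y).
  assert (p_fill : forall i, fillable deg p0 Fib i)
    by (intros i; now apply Reedy_fillable).
  assert (k_fill : forall i, fillable deg k0 Fib i)
    by (intros i; now apply Reedy_fillable).
  assert (p_fib : forall i, p0 i ∈ Fib)
    by (intros i; now apply (fillable_levelwise deg_lt)).
  assert (k_fib : forall i, k0 i ∈ Fib)
    by (intros i; now apply (fillable_levelwise deg_lt)).
  assert (ex : forall i, {Q : Pointwise p0 k0 i | pw_arr Q ∈ Fib}).
  { intros i; apply constructive_indefinite_description.
    now apply (pointwise_exists deg_lt). }
  pose (Q := fun i => proj1_sig (ex i)).
  assert (Q_fib : forall i, pw_arr (Q i) ∈ Fib) by (intros i; exact (proj2_sig (ex i))).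
  exists (diagram_pushforward C_complete Q); split.
  - intros i MQ MX P; now apply (matching_fibration deg_lt).
  - intros i j f fW.
    change (pw_map Q f ∈ W).
    destruct (classic (non_identity f)) as [n|n].
    + destruct (I_weq _ _ f n fW) as [all|init].
      * now apply (@constant_map_weq I C deg WI Fib W deg_lt).
      * now apply (@initial_map_weq I C deg WI Fib W deg_lt) with (w_nonid := n).
    + apply NNPP in n.
      (* An identity weak equivalence is known only as an equality under [i], so arrow and codomain
         are replaced together. *)
      change ((fun u : Under i => pw_map Q (under_arr u) ∈ W) (mk_under f)).
      rewrite n; simpl.
      change (fmap (pw_functor Q) (idm i) ∈ W); rewrite fmap_id; apply wide_id.
Qed.
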